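(* Consider a Young tower $T:X\to X$ with invariant probability measure $\mu$ such that $\mathrm{tail}_n=O(n^{-q})$ for some $q>1$. Write $S_nf=\sum_{i=0}^{n-1}f\circ T^i$. Then, for all $p\in[1,\infty)$, there exists $C>0$ such that for any Lipschitz function $f:X\to\mathbb{R}$ with $\|f\|\le 1$ and $\int f\,d\mu=0$, and for all integers $n\ge 1$, $$\int |S_nf|^p\,d\mu\le\begin{cases} C\max(n^{p/2},\,n^{p-q+1}) & \text{if } q>2,\\ C\max((n\log n)^{p/2},\,n^{p-q+1}) & \text{if } q=2,\\ C\max(n^{p/q},\,n^{p-q+1}) & \text{if } q<2 \text{ and } p\ne q.\end{cases}$$ If $q<2$, there exists $C>0$ such that for any Lipschitz $f$ with $\|f\|\le1$ and $\int f\,d\mu=0$, all $n\ge1$ and all $t>0$, $$\mu\{x : |S_nf(x)|\ge t\}\le C\,t^{-q}\,n,$$ and therefore, for all $n\ge2$, $\int |S_nf|^q\,d\mu\le C\,n\log n$ (with a possibly different constant $C$, again independent of $f$ and $n$).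
   Context: A Young tower is a space $X$ with a partition $X=\bigcup_\alpha\bigcup_{0\le i<h_\alpha}\Delta_{\alpha,i}$ ($\alpha$ in a countable set, $h_\alpha$ positive integers), an ergodic probability measure $\mu$ and a map $T:X\to X$ preserving $\mu$. $T$ maps $\Delta_{\alpha,i}$ bijectively to $\Delta_{\alpha,i+1}$ if $i+1<h_\alpha$, and maps $\Delta_{\alpha,h_\alpha-1}$ bijectively to the basis $\Delta_0=\bigcup_\alpha\Delta_{\alpha,0}$. The distance is $d(x,y)=\rho^{s(x,y)}$, where $\rho\in(0,1)$ is fixed and the separation time $s(x,y)$ is the number of returns to the basis before the iterates of $x$ and $y$ are not in the same partition element. Denoting by $g$ the inverse of the jacobian of $T$ with respect to $\mu$, one assumes that there is a constant $C$ with $|\log g(x)-\log g(y)|\le C\,d(Tx,Ty)$ for all $x,y$ in the same partition element. The return time $\phi:\Delta_0\to\mathbb{N}$ is $\phi=h_\alpha$ on $\Delta_{\alpha,0}$, and $\mathrm{tail}_n=\mu\{x\in\Delta_0:\phi(x)\ge n\}$. The Lipschitz norm of $f:X\to\mathbb{R}$ is $\|f\|=\sup_x|f(x)|+\sup_{x,y}|f(x)-f(y)|/d(x,y)$, the second supremum being over pairs $x\neq y$ in the same partition element; $f$ is Lipschitz if $\|f\|<\infty$. *)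

(* Defs.v *)
From HB Require Import structures.
From mathcomp Require Import all_boot all_order all_algebra.
From mathcomp Require Import finmap.
From mathcomp Require Import all_classical all_reals all_analysis.

Set Implicit Arguments.
Unset Strict Implicit.
Unset Printing Implicit Defensive.

Import Order.TTheory GRing.Theory Num.Theory.
Import numFieldNormedType.Exports.

Local Open Scope classical_set_scope.
Local Open Scope ring_scope.

(* Throughout, [h a] is the height of the column [a] and [Delta a i], which is
   meaningful only for [i < h a], is its level [i]. *)

Definition base (X A : Type) (Delta : A -> nat -> set X) : set X :=
  \bigcup_a Delta a 0%N.

Definition same_elt (X A : Type) (h : A -> nat) (Delta : A -> nat -> set X)
    (x y : X) : Prop :=
  exists a i, [/\ (i < h a)%N, Delta a i x & Delta a i y].

(* The times of the returns to the base that occur before the orbits of [x]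
   and [y] separate. The separation time is the cardinality of this set, which
   is infinite when the two orbits never separate. *)
Definition joint_returns (X A : Type) (h : A -> nat)
    (Delta : A -> nat -> set X) (T : X -> X) (x y : X) : set nat :=
  [set k | [/\ (0 < k)%N, base Delta (iter k T x) &
    forall j, (j <= k)%N -> same_elt h Delta (iter j T x) (iter j T y)]].

(* rho ^ s(x, y), with rho ^ oo = 0 *)
Definition tower_dist (R : realType) (X A : Type) (h : A -> nat)
    (Delta : A -> nat -> set X) (T : X -> X) (rho : R) (x y : X) : R :=
  let S := joint_returns h Delta T x y in
  if `[< finite_set S >] then rho ^+ #|` fset_set S|%fset else 0.

Definition return_time (X A : Type) (h : A -> nat)
    (Delta : A -> nat -> set X) (x : X) : nat :=
  xget 0%N [set n | exists2 a, Delta a 0%N x & n = h a].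

Definition tail (R : realType) (d : measure_display) (X : measurableType d)
    (mu : probability X R) (A : Type) (h : A -> nat)
    (Delta : A -> nat -> set X) (n : nat) : R :=
  fine (mu [set x | base Delta x /\ (n <= return_time h Delta x)%N]).

Definition measure_preserving (R : realType) (d : measure_display)
    (X : measurableType d) (mu : probability X R) (T : X -> X) : Prop :=
  measurable_fun setT T /\
  forall B, measurable B -> mu (T @^-1` B) = mu B.

Definition ergodic (R : realType) (d : measure_display)
    (X : measurableType d) (mu : probability X R) (T : X -> X) : Prop :=
  forall B, measurable B -> T @^-1` B = B -> mu B = 0%E \/ mu B = 1%E.

(* [J] is a (version of the) Jacobian of [T] with respect to [mu], [T] being
   injective on each partition element. *)
Definition is_jacobian (R : realType) (d : measure_display)
    (X : measurableType d) (mu : probability X R) (A : Type) (h : A -> nat)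
    (Delta : A -> nat -> set X) (T : X -> X) (J : X -> R) : Prop :=
  [/\ measurable_fun setT J, forall x, 0 < J x &
    forall a i B, (i < h a)%N -> measurable B -> B `<=` Delta a i ->
      measurable (T @` B) /\ mu (T @` B) = (\int[mu]_(x in B) (J x)%:E)%E].

Record young_tower (R : realType) (d : measure_display)
    (X : measurableType d) (mu : probability X R) (A : countType)
    (h : A -> nat) (Delta : A -> nat -> set X) (T : X -> X) (rho : R) : Prop :=
  YoungTower {
    yt_height_gt0 : forall a, (0 < h a)%N;
    yt_measurable : forall a i, (i < h a)%N -> measurable (Delta a i);
    yt_cover : forall x, exists a i, (i < h a)%N /\ Delta a i x;
    yt_disjoint : trivIset [set ai : A * nat | (ai.2 < h ai.1)%N]
                           (fun ai => Delta ai.1 ai.2);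
    yt_up : forall a i, (i.+1 < h a)%N ->
      set_bij (Delta a i) (Delta a i.+1) T;
    yt_return : forall a, set_bij (Delta a (h a).-1) (base Delta) T;
    yt_preserving : measure_preserving mu T;
    yt_ergodic : ergodic mu T;
    yt_ratio : 0 < rho < 1;
    (* symmetry, the triangle inequality and d(x, x) = 0 are automatic *)
    yt_dist : forall x y, tower_dist h Delta T rho x y = 0 -> x = y;
    yt_distortion : exists2 J : X -> R, is_jacobian mu h Delta T J &
      let g x := (J x)^-1 in
      exists C : R, forall x y, same_elt h Delta x y ->
        `|ln (g x) - ln (g y)| <= C * tower_dist h Delta T rho (T x) (T y) }.

(* The value 0 is added to the second set so that the supremum is 0, not -oo,
   when the partition elements are singletons. *)
Definition lip_norm (R : realType) (X A : Type) (h : A -> nat)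
    (Delta : A -> nat -> set X) (T : X -> X) (rho : R) (f : X -> R) : \bar R :=
  (ereal_sup [set r | exists x, r = `|f x|%:E] +
   ereal_sup ([set 0] `|` [set r | exists x y,
     [/\ x <> y, same_elt h Delta x y &
       r = (`|f x - f y| / tower_dist h Delta T rho x y)%:E]]))%E.

Definition birkhoff_sum (R : realType) (X : Type) (T : X -> X) (f : X -> R)
    (n : nat) (x : X) : R :=
  \sum_(0 <= i < n) f (iter i T x).

(* Upper bound for the p-th moment of the n-th Birkhoff sum, up to a constant;
   for q < 2 it is used only when p != q. *)
Definition moment_bound (R : realType) (p q : R) (n : nat) : R :=
  let N : R := n%:R in
  if 2 < q then Num.max (N `^ (p / 2)) (N `^ (p - q + 1))
  else if q == 2 then Num.max ((N * ln N) `^ (p / 2)) (N `^ (p - q + 1))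
  else Num.max (N `^ (p / q)) (N `^ (p - q + 1)).

(* Main.v *)
Require Import Defs.
From HB Require Import structures.
From mathcomp Require Import all_boot all_order all_algebra.
From mathcomp Require Import all_classical all_reals all_analysis.
From mathcomp Require Import measurable_realfun ring lra.
Import measurable_realfun.

Set Implicit Arguments.
Unset Strict Implicit.
Unset Printing Implicit Defensive.

Import Order.TTheory GRing.Theory Num.Theory.
Import numFieldNormedType.Exports.

Local Open Scope classical_set_scope.
Local Open Scope ring_scope.

(** The proof induces on the basis of the tower, where the dynamics is close to
an independent one, and reads all the bounds off one deviation inequality.

Sampled at its returns to the basis, T becomes a full-branched Gibbs-Markov map
S that preserves the normalised restriction P of mu: by bounded distortion,
prescribing an initial word changes the law of the future by a bounded factor
only ([quasi_independence]). Doeblin's argument improves this to mixing at a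
stretched exponential rate, uniformly over words ([mixing_rate]). As S is
full-branched, inducing has removed the possible periodicity of the tower.

Summing f over the columns gives a function F on the basis. It is as large as
the column is high, but oscillates little on cylinders. Truncated at height L
and centred, it has summable correlations, so that its sums over n returns have
second moment O(n v(L)), where v(L) is the second moment of the truncated
height ([second_moment]). A stopping time argument, which quasi-independence
makes as easy as in the independent case, passes to the maxima of the sums
(Ottaviani) and then trades the exponent 2 of Chebyshev's inequality for an
arbitrary one (Hoffmann-Jorgensen): the probability that a partial sum exceeds
a large multiple of L is O((n v(L) / L^2)^r) for every r ([maximal_tail]).

Taking L proportional to t, and paying n t^(-q) for the event that one of the
first n columns is higher than L, one gets ([base_max_tail], [tower_tail])

  mu (|S_n f| >= t) = O (n t^(-q) + (n v(t) / t^2)^r).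

The passage from the basis to the whole tower is Kac's formula ([kac]), and
costs the mass t^(1-q) <= n t^(-q) of the columns higher than t / 2. Finally
v(t) is bounded for q > 2, O(log t) for q = 2 and O(t^(2-q)) for q < 2. In the
last case r = 1 gives the weak bound O(n t^(-q)) of the statement; a dyadic
summation of the deviation inequality, with 2r > p, yields the moments. *)

Lemma le_of_eq (R : realType) (x y : R) : x = y -> x <= y.
Proof. by move=> ->. Qed.

(** * Summation over the fibres of countable-valued maps *)

Section Fibers.
Context (d : measure_display) (X : measurableType d) (I : countType).
Implicit Type g : X -> I.

Definition fiber_measurable g := forall i, measurable (g @^-1` [set i]).

(** The fibres are countably many, so that unions of them are measurable. *)
Lemma fiber_measurable_preimage g (B : set I) :
  fiber_measurable g -> measurable (g @^-1` B).
Proof.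
move=> mg; rewrite (_ : g @^-1` B = \bigcup_i (g @^-1` [set i] `&` [set _ | B i])).
  apply: countable_bigcupT_measurable => // i.
  have [Bi|nBi] := pselect (B i).
    rewrite (_ : [set _ | _] = setT) ?setIT//.
    by apply/seteqP; split.
  rewrite (_ : [set _ | _] = set0) ?setI0//.
  by apply/seteqP; split.
apply/seteqP; split => [x Bx|x [i _ [/= <- //]]].
by exists (g x).
Qed.

Lemma fiber_measurable_comp d' (Y : measurableType d') g (f : I -> Y) :
  fiber_measurable g -> measurable_fun setT (fun x => f (g x)).
Proof.
move=> mg _ B mB; rewrite setTI.
exact: (@fiber_measurable_preimage g (f @^-1` B)).
Qed.

Lemma measurable_piecewise d' (Y : measurableType d') g (G : I -> X -> Y) :
  fiber_measurable g -> (forall i, measurable_fun setT (G i)) ->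
  measurable_fun setT (fun x => G (g x) x).
Proof.
move=> mg mG _ B mB; rewrite setTI.
rewrite (_ : _ @^-1` B = \bigcup_i (g @^-1` [set i] `&` G i @^-1` B)).
  apply: countable_bigcupT_measurable => // i; apply: measurableI => //.
  by rewrite -[X in measurable X]setTI; exact: mG.
apply/seteqP; split => [x Bx|x [i _ [/= <- //]]].
by exists (g x).
Qed.

Local Open Scope ereal_scope.

(** Integrals are compared fibre by fibre, as they are the sums of the integrals
    over the countably many fibres. All the summations over words, columns or
    levels below go through this lemma. *)
Lemma ge0_integral_fibers_le (R : realType) (mu : {measure set X -> \bar R}) g
    (f1 f2 : X -> \bar R) :
  fiber_measurable g ->
  measurable_fun setT f1 -> measurable_fun setT f2 ->
  (forall x, 0 <= f1 x) -> (forall x, 0 <= f2 x) ->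
  (forall i, \int[mu]_(x in g @^-1` [set i]) f1 x
             <= \int[mu]_(x in g @^-1` [set i]) f2 x) ->
  \int[mu]_x f1 x <= \int[mu]_x f2 x.
Proof.
move=> mg mf1 mf2 f10 f20 le12.
pose F (n : nat) := [set x | pickle (g x) = n].
have FT : \bigcup_k F k = setT.
  by apply/seteqP; split => // x _; exists (pickle (g x)).
have mF k : measurable (F k).
  exact: (@fiber_measurable_preimage g [set i | pickle i = k]).
have tF : trivIset setT F.
  by move=> i j _ _ [x [/= <- <-]].
rewrite -FT !ge0_integral_bigcup//; [|by rewrite FT|by rewrite FT].
apply: lee_nneseries => [i _ _|i _]; first exact: integral_ge0.
have [->|/set0P[x Fx]] := eqVneq (F i) set0; first by rewrite !integral_set0.
rewrite (_ : F i = g @^-1` [set g x])//.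
apply/seteqP; split=> [y /= Fy|y /= gy]; last by rewrite /F /= gy.
by apply: (pcan_inj (@pickleK I)); rewrite [LHS]Fy [RHS]Fx.
Qed.

Lemma ge0_integral_fibers_eq (R : realType) (mu : {measure set X -> \bar R}) g
    (f1 f2 : X -> \bar R) :
  fiber_measurable g ->
  measurable_fun setT f1 -> measurable_fun setT f2 ->
  (forall x, 0 <= f1 x) -> (forall x, 0 <= f2 x) ->
  (forall i, \int[mu]_(x in g @^-1` [set i]) f1 x
             = \int[mu]_(x in g @^-1` [set i]) f2 x) ->
  \int[mu]_x f1 x = \int[mu]_x f2 x.
Proof.
move=> mg mf1 mf2 f10 f20 e12; apply/eqP; rewrite eq_le.
by apply/andP; split; apply: (ge0_integral_fibers_le mg) => // i; rewrite e12.
Qed.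

Lemma measure_fibers_le (R : realType) (mu : {measure set X -> \bar R}) g
    (B1 B2 : set X) :
  fiber_measurable g -> measurable B1 -> measurable B2 ->
  (forall i, mu (B1 `&` g @^-1` [set i]) <= mu (B2 `&` g @^-1` [set i])) ->
  mu B1 <= mu B2.
Proof.
move=> mg mB1 mB2 le12.
have e B : measurable B -> mu B = \int[mu]_x (\1_B x)%:E.
  by move=> mB; rewrite integral_indic// setIT.
rewrite !e//; apply: (ge0_integral_fibers_le mg).
- by apply: measurableT_comp => //; exact: measurable_indic.
- by apply: measurableT_comp => //; exact: measurable_indic.
- by move=> x; rewrite lee_fin.
- by move=> x; rewrite lee_fin.
by move=> i; rewrite !integral_indic.
Qed.

Lemma measure_fibers_eq (R : realType) (mu : {measure set X -> \bar R}) g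
    (B1 B2 : set X) :
  fiber_measurable g -> measurable B1 -> measurable B2 ->
  (forall i, mu (B1 `&` g @^-1` [set i]) = mu (B2 `&` g @^-1` [set i])) ->
  mu B1 = mu B2.
Proof.
move=> mg mB1 mB2 e12; apply/eqP; rewrite eq_le.
by apply/andP; split; apply: (measure_fibers_le mg) => // i; rewrite e12.
Qed.

End Fibers.

Lemma fiber_measurable_pair (d : measure_display) (X : measurableType d)
    (I J : countType) (g : X -> I) (g' : X -> J) :
  fiber_measurable g -> fiber_measurable g' ->
  fiber_measurable (fun x => (g x, g' x)).
Proof.
move=> mg mg' [i j].
rewrite (_ : _ @^-1` _ = g @^-1` [set i] `&` g' @^-1` [set j]).
  exact: measurableI.
by apply/seteqP; split => x /= [-> ->].
Qed.

Lemma ge0_integral_mrestr (R : realType) (d : measure_display)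
    (X : measurableType d) (mu : {measure set X -> \bar R}) (D : set X)
    (mD : measurable D) (f : X -> \bar R) :
  measurable_fun setT f -> (forall x, 0 <= f x)%E ->
  (\int[mrestr mu mD]_x f x = \int[mu]_(x in D) f x)%E.
Proof.
move=> mf f0.
rewrite (@ge0_negligible_integral _ _ _ _ setT (~` D))//; last 2 first.
- exact: measurableC.
- by rewrite /= /mrestr setICl measure0.
rewrite setTD setCK; apply: eq_measure_integral => B mB BD.
by rewrite /= /mrestr (setIidl BD).
Qed.

Lemma mem_set_bool (X : Type) (b : X -> bool) x : (x \in [set y | b y]) = b x.
Proof. by apply/idP/idP; rewrite inE. Qed.

(** * Expectations of bounded measurable functions *)

Section BoundedMeasurable.
Context (R : realType) (d : measure_display) (X : measurableType d).
Implicit Types f g : X -> R.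

Definition bmeasurable f :=
  measurable_fun setT f /\ exists M : R, forall x, `|f x| <= M.

Lemma bmeasurable_cst (c : R) : bmeasurable (fun=> c).
Proof. by split; [exact: measurable_cst|exists `|c|]. Qed.

Lemma bmeasurableD f g : bmeasurable f -> bmeasurable g ->
  bmeasurable (fun x => f x + g x).
Proof.
move=> [mf [M hM]] [mg [N hN]]; split; first exact: measurable_funD.
by exists (M + N) => x; rewrite (le_trans (ler_normD _ _))// lerD.
Qed.

Lemma bmeasurableM f g : bmeasurable f -> bmeasurable g ->
  bmeasurable (fun x => f x * g x).
Proof.
move=> [mf [M hM]] [mg [N hN]]; split; first exact: measurable_funM.
by exists (M * N) => x; rewrite normrM ler_pM.
Qed.

Lemma bmeasurableN f : bmeasurable f ->
  bmeasurable (fun x => - f x).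
Proof.
move=> [mf [M hM]]; split; first exact: measurableT_comp.
by exists M => x; rewrite normrN.
Qed.

Lemma bmeasurableB f g : bmeasurable f -> bmeasurable g ->
  bmeasurable (fun x => f x - g x).
Proof.
by move=> ? ?; apply: bmeasurableD => //; exact: bmeasurableN.
Qed.

Lemma bmeasurable_norm f : bmeasurable f ->
  bmeasurable (fun x => `|f x|).
Proof.
move=> [mf [M hM]]; split; first exact: measurableT_comp.
by exists M => x; rewrite normr_id.
Qed.

Lemma bmeasurable_sum n (F : nat -> X -> R) :
  (forall i, bmeasurable (F i)) ->
  bmeasurable (fun x => \sum_(0 <= i < n) F i x).
Proof.
move=> mF; elim: n => [|n IH].
  under eq_fun do rewrite big_geq//.
  exact: bmeasurable_cst.
under eq_fun do rewrite big_nat_recr//=.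
exact: bmeasurableD.
Qed.

Lemma bmeasurable_comp f (S : X -> X) : measurable_fun setT S ->
  bmeasurable f -> bmeasurable (fun x => f (S x)).
Proof.
move=> mS [mf [M hM]]; split; first exact: (measurableT_comp mf mS).
by exists M.
Qed.

Lemma bmeasurable_bool (b : X -> bool) :
  measurable [set x | b x] -> bmeasurable (fun x => (b x)%:R).
Proof.
move=> mb; split; last by exists 1 => x; case: (b x); rewrite ?normr1 ?normr0.
rewrite (_ : (fun _ => _) = \1_[set x | b x]); first exact: measurable_indic.
by apply/funext => x; rewrite indicE mem_set_bool.
Qed.

End BoundedMeasurable.

#[global] Hint Resolve bmeasurable_cst : core.

Definition expect (R : realType) (d : measure_display) (X : measurableType d)
  (P : probability X R) (f : X -> R) : R := \int[P]_x f x.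

Section Expectation.
Context (R : realType) (d : measure_display) (X : measurableType d).
Variable P : probability X R.
Implicit Types f g : X -> R.
Local Notation E := (expect P).

Lemma integrable_bmeasurable f : bmeasurable f ->
  P.-integrable setT (EFin \o f).
Proof.
move=> [mf [M hM]]; apply: measurable_bounded_integrable => //.
  exact: le_lt_trans (probability_le1 P measurableT) (ltry 1).
by exists M; split; rewrite ?num_real// => N MN x _; apply: le_trans (hM x) (ltW MN).
Qed.
Let ibm := integrable_bmeasurable.

Lemma expectE f : bmeasurable f -> ((E f)%:E = \int[P]_x (f x)%:E)%E.
Proof.
move=> bf; rewrite /expect /Rintegral fineK //.
exact: (integrable_fin_num _ (integrable_bmeasurable bf)).
Qed.

Lemma expect_cst c : E (fun=> c) = c.
Proof. by rewrite /expect Rintegral_cst//= probability_setT mulr1. Qed.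

Lemma expectD f g : bmeasurable f -> bmeasurable g ->
  E (fun x => f x + g x) = E f + E g.
Proof. by move=> ? ?; rewrite /expect RintegralD//; exact: ibm. Qed.

Lemma expectB f g : bmeasurable f -> bmeasurable g ->
  E (fun x => f x - g x) = E f - E g.
Proof. by move=> ? ?; rewrite /expect RintegralB//; exact: ibm. Qed.

Lemma expectZ c f : bmeasurable f -> E (fun x => c * f x) = c * E f.
Proof. by move=> ?; rewrite /expect RintegralZl//; exact: ibm. Qed.

Lemma le_expect f g : bmeasurable f -> bmeasurable g ->
  (forall x, f x <= g x) -> E f <= E g.
Proof. by move=> ? ? fg; apply: le_Rintegral => //; exact: ibm. Qed.

Lemma expect_ge0 f : (forall x, 0 <= f x) -> 0 <= E f.
Proof. by move=> f0; apply: Rintegral_ge0. Qed.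

Lemma expect_norm f : bmeasurable f -> `|E f| <= E (fun x => `|f x|).
Proof. by move=> ?; apply: le_normr_Rintegral => //; exact: ibm. Qed.

Lemma expect_bool (b : X -> bool) : measurable [set x | b x] ->
  ((E (fun x => (b x)%:R))%:E = P [set x | b x])%E.
Proof.
move=> mb; rewrite expectE; last exact: bmeasurable_bool.
rewrite (eq_integral (fun x => (\1_[set x | b x] x)%:E)); last first.
  by move=> x _; rewrite indicE mem_set_bool.
by rewrite integral_indic// setIT.
Qed.

(** An inequality between two measures, checked on sets, passes to the integrals
    of nonnegative functions; the measures here are images of restrictions of P. *)
Lemma le_expect_pushforward (b1 b2 : X -> bool) (S1 S2 : X -> X) (c1 c2 : R) :
  measurable [set x | b1 x] -> measurable [set x | b2 x] ->
  measurable_fun setT S1 -> measurable_fun setT S2 -> 0 <= c1 -> 0 <= c2 ->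
  (forall B, measurable B ->
    (c1%:E * P ([set x | b1 x] `&` S1 @^-1` B)
     <= c2%:E * P ([set x | b2 x] `&` S2 @^-1` B))%E) ->
  forall g, bmeasurable g -> (forall x, 0 <= g x) ->
  c1 * E (fun x => (b1 x)%:R * g (S1 x))
    <= c2 * E (fun x => (b2 x)%:R * g (S2 x)).
Proof.
move=> mb1 mb2 mS1 mS2 c10 c20 le12 g bg g0.
have aux (b : X -> bool) (mb : measurable [set x | b x]) (S : X -> X)
    (mS : measurable_fun setT S) (c : R) (c0 : 0 <= c) :
    (c * E (fun x => (b x)%:R * g (S x)))%:E =
    (\int[pushforward (mscale (NngNum c0) (mrestr P mb)) S]_x (g x)%:E)%E.
  have mg : measurable_fun setT (EFin \o g).
    by apply: measurableT_comp => //; case: bg.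
  rewrite ge0_integral_pushforward//=; last by move=> x _; rewrite lee_fin.
  have mgS := measurableT_comp mg mS.
  rewrite preimage_setT ge0_integral_mscale//=; last first.
    by move=> x _; rewrite lee_fin.
  rewrite EFinM ge0_integral_mrestr//; last by move=> x; rewrite lee_fin.
  congr (_ * _)%E.
  rewrite expectE; last first.
    apply: bmeasurableM; first exact: bmeasurable_bool.
    exact: bmeasurable_comp.
  rewrite [RHS]integral_mkcond; apply: eq_integral => x _.
  rewrite patchE; case: ifPn; rewrite ?inE ?notin_setE/= => bx.
    by rewrite bx mul1r.
  by move/negP/negbTE: bx => ->; rewrite mul0r.
rewrite -lee_fin !aux.
apply: (@ge0_le_measure_integral _ _ _
  (pushforward (mscale (NngNum c10) (mrestr P mb1)) S1 : {measure set X -> \bar R})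
  (pushforward (mscale (NngNum c20) (mrestr P mb2)) S2 : {measure set X -> \bar R})) => //.
- move=> B mB; rewrite /= /pushforward /mscale /= /mrestr.
  by rewrite (setIC (S1 @^-1` B)) (setIC (S2 @^-1` B)) le12.
- by apply: measurableT_comp => //; case: bg.
- exact: mS2.
- exact: mS1.
Qed.

(** The sign of f is not prescribed: adding a constant reduces the statement to
    the comparison of nonnegative integrals. *)
Lemma expect_fibers_ge0 (I : countType) (g : X -> I) f :
  fiber_measurable g -> bmeasurable f ->
  (forall i, 0 <= E (fun x => (g x == i)%:R * f x)) -> 0 <= E f.
Proof.
move=> mg bf f0; have [mf [M fM]] := bf.
have M0 : 0 <= M := le_trans (normr_ge0 _) (fM point).
have bfM : bmeasurable (fun x => f x + M) by exact: bmeasurableD.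
have fM0 x : 0 <= f x + M.
  by rewrite -lerBlDr sub0r lerNl (le_trans (ler_norm _))// normrN.
suff : E (fun=> M) <= E (fun x => f x + M).
  by rewrite expectD// expect_cst lerDr.
have mb i : measurable [set x | g x == i].
  by rewrite (_ : [set _ | _] = g @^-1` [set i])//; apply/seteqP; split => x /eqP.
have fib h : bmeasurable h -> (forall x, 0 <= h x) -> forall i,
    (\int[P]_(x in g @^-1` [set i]) (h x)%:E =
     (E (fun x => (g x == i)%:R * h x))%:E)%E.
  move=> bh h0 i; rewrite expectE; last first.
    by apply: bmeasurableM => //; exact: bmeasurable_bool.
  rewrite integral_mkcond; apply: eq_integral => x _.
  rewrite patchE; case: ifPn; rewrite ?inE ?notin_setE/=.
    by move=> ->; rewrite eqxx mul1r.
  by move=> /eqP/negbTE ->; rewrite mul0r.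
rewrite -lee_fin !expectE//; apply: (ge0_integral_fibers_le mg).
- exact: measurable_cst.
- by apply: measurableT_comp => //; case: bfM.
- by move=> x; rewrite lee_fin.
- by move=> x; rewrite lee_fin.
move=> i; rewrite !fib//.
rewrite lee_fin; have bb := bmeasurable_bool R (mb i).
rewrite [leRHS](_ : _ = E (fun x => (g x == i)%:R * f x)
   + E (fun x => (g x == i)%:R * M)) ?lerDr//.
rewrite -expectD; [|exact: bmeasurableM..].
by congr expect; apply/funext => x; rewrite mulrDr.
Qed.

End Expectation.

(** * Gibbs-Markov maps and bounded distortion *)

(** The sets on which it is constant are the cylinders of length k. *)
Definition word (X A : Type) (S : X -> X) (col : X -> A) (k : nat) (x : X) :
  seq A := map col (traject S x k).

(** The last field is the full-branch property together with bounded distortion,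
    for one step: the inverse branch with symbol a multiplies the measures of
    all the subsets of a cylinder by almost the same positive factor k, the
    fluctuation being exponentially small in the length of the cylinder. *)
Record gibbs_markov (R : realType) (d : measure_display) (X : measurableType d)
    (A : countType) (P : probability X R) (S : X -> X) (col : X -> A)
    (K rho : R) : Prop := GibbsMarkov {
  gm_measurable : measurable_fun setT S;
  gm_preserving : forall B, measurable B -> P (S @^-1` B) = P B;
  gm_col : fiber_measurable col;
  gm_const : 0 <= K;
  gm_ratio : 0 < rho < 1;
  gm_distortion : forall a v, exists2 k : R, 0 < k &
    forall V, measurable V -> V `<=` [set x | word S col (size v) x = v] ->
      (k%:E * P V <= P (col @^-1` [set a] `&` S @^-1` V) /\
       P (col @^-1` [set a] `&` S @^-1` V)
         <= (expR (K * rho ^+ size v) * k)%:E * P V)%E }.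

Section Words.
Context (X : Type) (A : eqType) (S : X -> X) (col : X -> A).
Local Notation word := (word S col).

Lemma size_word k x : size (word k x) = k.
Proof. by rewrite size_map size_traject. Qed.

Lemma wordS k x : word k.+1 x = col x :: word k (S x).
Proof. by []. Qed.

Lemma word_add k l x : word (k + l) x = word k x ++ word l (iter k S x).
Proof. by elim: k x => //= k IH x; rewrite addSn !wordS IH/= -iterSr. Qed.

Lemma word_cat_eq w v x :
  (word (size w + size v) x == w ++ v) =
  (word (size w) x == w) && (word (size v) (iter (size w) S x) == v).
Proof. by rewrite word_add eqseq_cat// size_word. Qed.

End Words.

Section GibbsMarkov.
Context (R : realType) (d : measure_display) (X : measurableType d).
Context (A : countType) (P : probability X R) (S : X -> X) (col : X -> A).
Context (K rho : R) (gm : gibbs_markov P S col K rho).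
Local Notation word := (word S col).
Local Notation E := (expect P).
Local Notation bm := bmeasurable.

Let mS : measurable_fun setT S := gm_measurable gm.
Let rho0 : 0 < rho. Proof. by case/andP: (gm_ratio gm). Qed.
Let rho1 : rho < 1. Proof. by case/andP: (gm_ratio gm). Qed.

Definition cyl (w : seq A) (x : X) : R := (word (size w) x == w)%:R.

Lemma measurable_iter k : measurable_fun setT (iter k S).
Proof.
elim: k => [|k IH]; first exact: measurable_id.
exact: (measurableT_comp mS IH).
Qed.

Lemma fiber_measurable_word k : fiber_measurable (word k).
Proof.
elim: k => [|k IH] w.
  have [->|w0] := eqVneq w [::].
    by rewrite (_ : _ @^-1` _ = setT)//; apply/seteqP; split.
  rewrite (_ : _ @^-1` _ = set0)//; apply/seteqP; split => // x /= w0'.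
  by rewrite -w0' in w0.
case: w => [|a w].
  by rewrite (_ : _ @^-1` _ = set0)//; apply/seteqP; split.
rewrite (_ : _ @^-1` _ = col @^-1` [set a] `&` S @^-1` (word k @^-1` [set w])).
  apply: measurableI; first exact: (gm_col gm).
  by rewrite -[X in measurable X]setTI; apply: mS.
by apply/seteqP; split => x /= => [[-> <-]|[<- <-]].
Qed.

Lemma measurable_cylinder w : measurable [set x | word (size w) x == w].
Proof.
rewrite (_ : [set _ | _] = word (size w) @^-1` [set w]).
  exact: fiber_measurable_word.
by apply/seteqP; split => x /eqP.
Qed.

Lemma bmeasurable_cyl w : bm (cyl w).
Proof. exact: bmeasurable_bool (measurable_cylinder w). Qed.

Lemma bmeasurable_iter k (g : X -> R) : bm g -> bm (fun x => g (iter k S x)).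
Proof. by apply: bmeasurable_comp; exact: measurable_iter. Qed.

Lemma cyl_ge0 w x : 0 <= cyl w x. Proof. by rewrite ler0n. Qed.

Lemma cyl_cat w v x : cyl (w ++ v) x = cyl w x * cyl v (iter (size w) S x).
Proof. by rewrite /cyl size_cat word_cat_eq -mulnb natrM. Qed.

(** Invariance is given on sets; as in the comparison of measures, it passes to
    functions after the addition of a constant that makes them nonnegative. *)
Lemma expect_iter k (g : X -> R) : bm g -> E (fun x => g (iter k S x)) = E g.
Proof.
move=> bg; elim: k => //= k <-; set h := fun x => g (iter k S x).
have -> : (fun x => g (S (iter k S x))) = h \o S.
  by apply/funext => x; rewrite /h /= -iterS iterSr.
have bh : bm h by exact: bmeasurable_iter.
apply/eqP; rewrite eq_le.
have [M hM] := bh.2.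
have bhM : bm (fun x => h x + M) by apply: bmeasurableD.
have hM0 x : 0 <= h x + M.
  by rewrite -lerBlDr sub0r lerNl (le_trans (ler_norm _))// normrN.
have bhS : bm (h \o S) by exact: bmeasurable_comp.
have mT : measurable [set x : X | true].
  by rewrite (_ : [set _ | _] = setT)//; apply/seteqP; split.
have EM f : bm f -> E (fun x => true%:R * (f x + M)) = E f + M.
  move=> bf; rewrite -[X in _ = _ + X](expect_cst P) -expectD//.
  by congr expect; apply/funext => x; rewrite mul1r.
have PT B : (P ([set x : X | true] `&` B) = P B)%E.
  by congr (P _); apply/seteqP; split => [x []|].
have le1 : 1 * E (fun x => true%:R * (h (S x) + M)) <= 1 * E (fun x => true%:R * (h x + M)).
  apply: (@le_expect_pushforward _ _ _ _ xpredT xpredT S id 1 1 mT mT mS _ _ _ _ (fun x => h x + M)) => //.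
  by move=> B mB; rewrite !PT (gm_preserving gm).
have le2 : 1 * E (fun x => true%:R * (h x + M)) <= 1 * E (fun x => true%:R * (h (S x) + M)).
  apply: (@le_expect_pushforward _ _ _ _ xpredT xpredT id S 1 1 mT mT _ mS _ _ _ (fun x => h x + M)) => //.
  by move=> B mB; rewrite !PT (gm_preserving gm).
move: le1 le2; rewrite !mul1r (EM h bh) (EM (fun x => h (S x)) bhS) !lerD2r.
by move=> le1 le2; apply/andP.
Qed.

(** The functional form of the distortion hypothesis. *)
Lemma distortion_step a v : exists2 k : R, 0 < k &
  forall g, bm g -> (forall x, 0 <= g x) ->
    k * E (fun x => cyl v x * g x)
      <= E (fun x => cyl (a :: v) x * g (S x)) /\
    E (fun x => cyl (a :: v) x * g (S x))
      <= expR (K * rho ^+ size v) * k * E (fun x => cyl v x * g x).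
Proof.
have [k k0 kP] := gm_distortion gm a v; exists k => // g bg g0.
have mv := measurable_cylinder v; have mav := measurable_cylinder (a :: v).
have E1 B : [set x | word (size (a :: v)) x == a :: v] `&` S @^-1` B =
    col @^-1` [set a] `&` S @^-1` ([set x | word (size v) x == v] `&` B).
  apply/seteqP; split => x /=; rewrite wordS eqseq_cons.
    by move=> [/andP[/eqP -> ->] ?].
  by move=> [-> [-> ?]]; rewrite eqxx.
have sub B : [set x | word (size v) x == v] `&` B `<=` [set x | word (size v) x = v].
  by move=> x [/= /eqP].
have mB' B : measurable B -> measurable ([set x | word (size v) x == v] `&` B).
  by move=> mB; apply: measurableI.
rewrite -{1 2}[E (fun x => cyl (a :: v) x * _)]mul1r; split.
- apply: (@le_expect_pushforward _ _ _ _ _ _ id S k 1 mv mav _ mS _ _ _ g) => //.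
    exact: ltW.
  by move=> B mB; rewrite mul1e E1; exact: (kP _ (mB' B mB) (sub B)).1.
- apply: (@le_expect_pushforward _ _ _ _ _ _ S id 1 _ mav mv mS _ _ _ _ g) => //.
    by rewrite mulr_ge0 ?expR_ge0// ltW.
  by move=> B mB; rewrite mul1e E1; exact: (kP _ (mB' B mB) (sub B)).2.
Qed.

(** Each of the steps contributes a distortion that is exponentially small in
    the length of the cylinder it is applied to, hence a convergent geometric
    series: the bound does not depend on the word w. *)
Lemma distortion w v : exists2 k : R, 0 < k &
  forall g, bm g -> (forall x, 0 <= g x) ->
    k * E (fun x => cyl v x * g x)
      <= E (fun x => cyl (w ++ v) x * g (iter (size w) S x)) /\
    E (fun x => cyl (w ++ v) x * g (iter (size w) S x))
      <= expR (K / (1 - rho) * rho ^+ size v) * k * E (fun x => cyl v x * g x).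
Proof.
have rho10 : 0 < 1 - rho by rewrite subr_gt0.
have K0 := gm_const gm.
suff [k k0 kP] : exists2 k : R, 0 < k &
  forall g, bm g -> (forall x, 0 <= g x) ->
    k * E (fun x => cyl v x * g x)
      <= E (fun x => cyl (w ++ v) x * g (iter (size w) S x)) /\
    E (fun x => cyl (w ++ v) x * g (iter (size w) S x))
      <= expR (K / (1 - rho) * rho ^+ size v * (1 - rho ^+ size w))
         * k * E (fun x => cyl v x * g x).
  exists k => // g bg g0; have [? le] := kP g bg g0; split => //.
  apply: (le_trans le); rewrite ler_wpM2r//.
    by apply: expect_ge0 => x; rewrite mulr_ge0 ?cyl_ge0.
  rewrite ler_wpM2r ?(ltW k0)// ler_expR -[leRHS]mulr1 ler_wpM2l//.
    by rewrite mulr_ge0 ?exprn_ge0 ?(ltW rho0)// divr_ge0// ltW.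
  by rewrite lerBlDr lerDl exprn_ge0// ltW.
elim: w => [|a w [k k0 IH]].
  exists 1 => // g bg g0; rewrite subrr mulr0 expR0 !mul1r.
  by split; exact: lexx.
have [k' k'0 step] := distortion_step a (w ++ v).
exists (k' * k) => [|g bg g0]; first exact: mulr_gt0.
have [IH1 IH2] := IH g bg g0.
have bg' : bm (fun x => g (iter (size w) S x)) by exact: bmeasurable_iter.
have [st1 st2] := step _ bg' (fun x => g0 _).
rewrite cat_cons; have -> : (fun x => cyl (a :: w ++ v) x * g (iter (size (a :: w)) S x))
  = (fun x => cyl (a :: w ++ v) x * g (iter (size w) S (S x))).
  by apply/funext => x /=; rewrite -iterS iterSr.
split.
  by apply: le_trans st1; rewrite -mulrA ler_wpM2l// ltW.
apply: (le_trans st2).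
rewrite (_ : K / (1 - rho) * rho ^+ size v * (1 - rho ^+ size (a :: w)) =
  K * rho ^+ size (w ++ v) + K / (1 - rho) * rho ^+ size v * (1 - rho ^+ size w)).
  rewrite expRD.
  rewrite [leRHS](_ : _ = expR (K * rho ^+ size (w ++ v)) * k' *
    (expR (K / (1 - rho) * rho ^+ size v * (1 - rho ^+ size w)) * k *
       E (fun x => cyl v x * g x))); last by ring.
  by rewrite ler_wpM2l// mulr_ge0 ?expR_ge0// ltW.
rewrite /= size_cat exprS exprD; field; lra.
Qed.

End GibbsMarkov.

(** * Mixing by the Doeblin argument *)

Section Mixing.
Context (R : realType) (d : measure_display) (X : measurableType d).
Context (A : countType) (P : probability X R) (S : X -> X) (col : X -> A).
Context (K rho : R) (gm : gibbs_markov P S col K rho).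
Local Notation word := (word S col).
Local Notation cyl := (cyl R S col).
Local Notation E := (expect P).
Local Notation bm := bmeasurable.

Let rho0 : 0 < rho. Proof. by case/andP: (gm_ratio gm). Qed.
Let rho1 : rho < 1. Proof. by case/andP: (gm_ratio gm). Qed.

Let D n : R := expR (K / (1 - rho) * rho ^+ n).

Let Kge0 : 0 <= K / (1 - rho).
Proof. by rewrite divr_ge0 ?(gm_const gm)// subr_ge0 ltW. Qed.

Let D_ge1 n : 1 <= D n.
Proof. by rewrite -[leLHS]expR0 ler_expR mulr_ge0 ?exprn_ge0 ?(ltW rho0). Qed.

Let bmc w : bm (cyl w) := bmeasurable_cyl gm w.

Lemma bmeasurable_cylM w (g : X -> R) k : bm g ->
  bm (fun x => cyl w x * g (iter k S x)).
Proof. by move=> bg; apply: bmeasurableM => //; exact: (bmeasurable_iter gm). Qed.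

(** The factor k of the distortion is eliminated by comparing with g = 1. The
    law of what follows the word w ++ v is thus, up to a factor close to 1 when
    v is long, the law of what follows v: the distant past is forgotten. *)
Lemma distortion_ratio w v (g : X -> R) : bm g -> (forall x, 0 <= g x) ->
  E (cyl v) * E (fun x => cyl (w ++ v) x * g (iter (size w + size v) S x)) <=
    D (size v) * E (cyl (w ++ v)) * E (fun x => cyl v x * g (iter (size v) S x)) /\
  E (cyl (w ++ v)) * E (fun x => cyl v x * g (iter (size v) S x)) <=
    D (size v) * E (cyl v) *
      E (fun x => cyl (w ++ v) x * g (iter (size w + size v) S x)).
Proof.
move=> bg g0; have [k k0 kP] := distortion gm w v.
have [H1 H2] := kP _ (bmeasurable_iter gm (size v) bg) (fun x => g0 _).
have {kP} [H3 H4] := kP _ (bmeasurable_cst X 1) (fun x => ler01).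
rewrite -/(D _) in H2 H4.
have e1 u : E (fun x => cyl u x * 1) = E (cyl u).
  by congr expect; apply/funext => x; rewrite mulr1.
have e2 : E (fun x => cyl (w ++ v) x * g (iter (size v) S (iter (size w) S x))) =
    E (fun x => cyl (w ++ v) x * g (iter (size w + size v) S x)).
  by congr expect; apply/funext => x; rewrite addnC iterD.
rewrite !e1 in H3 H4; rewrite !e2 in H1 H2.
have Ege u : 0 <= E (cyl u) by apply: expect_ge0 => x; exact: cyl_ge0.
set B := E (fun x => cyl v x * _) in H1 H2 *.
have B0 : 0 <= B by apply: expect_ge0 => x; rewrite mulr_ge0 ?cyl_ge0.
set Y := E (fun x => cyl (w ++ v) x * _) in H1 H2 *.
have D0 : 0 < D (size v) by exact: expR_gt0.
split.
  apply: (le_trans (ler_wpM2l (Ege v) H2)).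
  rewrite [leLHS](_ : _ = D (size v) * (k * E (cyl v)) * B); last by ring.
  by rewrite ler_wpM2r// ler_wpM2l// ltW.
apply: (le_trans (ler_wpM2r B0 H4)).
rewrite [leLHS](_ : _ = D (size v) * E (cyl v) * (k * B)); last by ring.
by rewrite ler_wpM2l// mulr_ge0// ltW.
Qed.

Lemma expect_cyl_gt0 w : 0 < E (cyl w).
Proof.
have [k k0 kP] := distortion gm w [::].
have [+ _] := kP _ (bmeasurable_cst X 1) (fun x => ler01).
have -> : (fun x => cyl [::] x * 1) = fun=> 1 by apply/funext => x; rewrite mulr1.
rewrite expect_cst mulr1 cats0 => le.
apply: (lt_le_trans k0); apply: (le_trans le); rewrite le_eqVlt; apply/orP; left.
by apply/eqP; congr expect; apply/funext => x; rewrite mulr1.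
Qed.

(** The case of an empty suffix in the comparison of laws. *)
Lemma quasi_independence w (g : X -> R) : bm g -> (forall x, 0 <= g x) ->
  E (fun x => cyl w x * g (iter (size w) S x)) <= D 0 * E (cyl w) * E g /\
  E (cyl w) * E g <= D 0 * E (fun x => cyl w x * g (iter (size w) S x)).
Proof.
move=> bg g0; have := distortion_ratio w [::] bg g0.
have -> : E (cyl [::]) = 1 by rewrite -[RHS](expect_cst P).
rewrite cats0 mul1r mulr1 addn0; have -> // : (fun x => cyl [::] x * g (iter 0 S x)) = g.
by apply/funext => x; rewrite /= mul1r.
Qed.

(** The law of the future of any word w is, after l more iterations, within a
    relative distance dlt of P. This is the psi-mixing property. *)
Definition mixes l (dlt : R) := forall w (g : X -> R), bm g ->
  (forall x, 0 <= g x) ->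
  (1 - dlt) * E (cyl w) * E g <= E (fun x => cyl w x * g (iter (size w + l) S x))
    <= (1 + dlt) * E (cyl w) * E g.

Lemma mixes_ge l l' dlt : (l <= l')%N -> mixes l dlt -> mixes l' dlt.
Proof.
move=> ll' ml w g bg g0; have := ml w _ (bmeasurable_iter gm (l' - l) bg) (fun x => g0 _).
rewrite (expect_iter gm)//.
have -> // : (fun x => cyl w x * g (iter (l' - l) S (iter (size w + l) S x))) =
  (fun x => cyl w x * g (iter (size w + l') S x)).
by apply/funext => x; rewrite -iterD addnCA subnK.
Qed.

Let D0_gt0 : 0 < D 0. Proof. exact: expR_gt0. Qed.

Lemma mixes0 : mixes 0 (D 0).
Proof.
move=> w g bg g0; have [H1 H2] := quasi_independence w bg g0.
rewrite addn0.
have Ew := ltW (expect_cyl_gt0 w).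
have Eg : 0 <= E g by exact: expect_ge0.
have Ewg : 0 <= E (cyl w) * E g by exact: mulr_ge0.
apply/andP; split.
  apply: (@le_trans _ _ 0).
    by rewrite -mulrA mulr_le0_ge0// subr_le0.
  by apply: expect_ge0 => x; rewrite mulr_ge0 ?cyl_ge0.
by apply: (le_trans H1); rewrite -!mulrA ler_wpM2r// lerDr.
Qed.

(** By quasi-independence a word u follows w with conditional probability at
    least c P(u), where c is the inverse of the distortion constant. So a
    proportion c of the mass already has the law P and stays there, while the
    remaining proportion 1 - c has relative error dlt after s further
    iterations. The price is to replace the past w ++ u by u, which costs the
    distortion D r of words of length r. *)
Lemma mixes_step r s dlt : 0 <= dlt -> mixes s dlt ->
  mixes (r + s) ((1 - (D 0)^-1) * dlt + (D r - 1) * (1 + dlt)).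
Proof.
move=> dlt0 ms w g bg g0; set c := (D 0)^-1.
have c0 : 0 < c by rewrite invr_gt0.
have c1 : c <= 1 by rewrite invf_le1.
pose gs x := g (iter s S x).
have bgs : bm gs := bmeasurable_iter gm s bg.
have gs0 x : 0 <= gs x by exact: g0.
pose N := size w.
pose part x := word r (iter N S x).
have mpart : fiber_measurable part.
  move=> u; rewrite (_ : _ @^-1` _ = iter N S @^-1` (word r @^-1` [set u]))//.
  rewrite -[X in measurable X]setTI; apply: (measurable_iter gm) => //.
  exact: (fiber_measurable_word gm).
have Ew0 := expect_cyl_gt0 w; set p := E (cyl w) in Ew0 *.
have Eg0 : 0 <= E g by exact: expect_ge0.
have EgsN : E (fun x => gs (iter (N + r) S x)) = E g.
  by rewrite (expect_iter gm)// (expect_iter gm).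
set Y := E (fun x => cyl w x * g (iter (N + (r + s)) S x)).
have YE : Y = E (fun x => cyl w x * gs (iter (N + r) S x)).
  by rewrite /Y addnA addnC; congr expect; apply/funext => x; rewrite /gs -iterD.
have Y0 : 0 <= Y by rewrite YE; apply: expect_ge0 => x; rewrite mulr_ge0 ?cyl_ge0.
(* The fibres of part are the sets where u follows w. By invariance, all the
   terms can be moved to time N, where this partition lives. *)
have loc u : size u = r ->
  [/\ E (fun x => (part x == u)%:R * (cyl w x * gs (iter (N + r) S x))) =
      E (fun x => cyl (w ++ u) x * gs (iter (N + r) S x)),
      E (fun x => (part x == u)%:R * gs (iter (N + r) S x)) =
      E (fun x => cyl u x * gs (iter r S x)),
      E (fun x => (part x == u)%:R * cyl w x) = E (cyl (w ++ u)) &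
      E (fun x => (part x == u)%:R) = E (cyl u)].
  move=> ur; have cE x : (part x == u)%:R = cyl u (iter N S x).
    by rewrite /part /cyl ur.
  split.
  - by congr expect; apply/funext => x; rewrite cE cyl_cat; ring.
  - rewrite -(expect_iter gm N (bmeasurable_cylM u r bgs)).
    by congr expect; apply/funext => x; rewrite cE -iterD addnC.
  - by congr expect; apply/funext => x; rewrite cE cyl_cat mulrC.
  - rewrite -(expect_iter gm N (bmc u)).
    by congr expect; apply/funext => x; rewrite cE.
have bpart u : bm (fun x => (part x == u)%:R : R).
  apply: bmeasurable_bool.
  rewrite (_ : [set _ | _] = part @^-1` [set u])//.
  by apply/seteqP; split => x /eqP.
have bgN : bm (fun x => gs (iter (N + r) S x)) := bmeasurable_iter gm (N + r) bgs.
have bw := bmc w.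
have sum_u (al be ga ka : R) :
    (forall u, size u = r ->
      0 <= al * E (fun x => cyl (w ++ u) x * gs (iter (N + r) S x)) +
         be * E (fun x => cyl u x * gs (iter r S x)) +
         ga * E (cyl (w ++ u)) + ka * E (cyl u)) ->
    0 <= al * Y + be * E g + ga * p + ka.
  move=> H.
  (* one function whose integrals over the fibres of part are the given sums *)
  pose f x := al * (cyl w x * gs (iter (N + r) S x)) +
     be * gs (iter (N + r) S x) + ga * cyl w x + ka.
  have b1 : bm (fun x => cyl w x * gs (iter (N + r) S x)).
    exact: bmeasurableM.
  have bc h (c' : R) : bm h -> bm (fun x => c' * h x).
    by move=> bh; apply: bmeasurableM.
  have bf : bm f by repeat apply: bmeasurableD => //; exact: bc.
  have lin (q : X -> R) : bm q ->
      E (fun x => q x * f x) =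
      al * E (fun x => q x * (cyl w x * gs (iter (N + r) S x))) +
      be * E (fun x => q x * gs (iter (N + r) S x)) +
      ga * E (fun x => q x * cyl w x) + ka * E q.
    move=> bq; rewrite -!expectZ; [|by repeat apply: bmeasurableM..].
    rewrite -!expectD;
      [|by repeat (first [apply: bmeasurableD|apply: bmeasurableM])..].
    by congr expect; apply/funext => x; rewrite /f; ring.
  have -> : al * Y + be * E g + ga * p + ka = E f.
    have := lin (fun=> 1) (bmeasurable_cst X 1).
    rewrite expect_cst mulr1 YE -EgsN.
    under [X in E X = _]eq_fun do rewrite mul1r.
    under [X in _ = _ * E X + _ * _ + _ * _ + _]eq_fun do rewrite mul1r.
    under [X in _ = _ * _ + _ * E X + _ * _ + _]eq_fun do rewrite mul1r.
    by under [X in _ = _ * _ + _ * _ + _ * E X + _]eq_fun do rewrite mul1r.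
  apply: (expect_fibers_ge0 mpart bf) => u; rewrite lin//.
  have [ur|ur] := eqVneq (size u) r.
    by have [-> -> -> ->] := loc u ur; exact: H.
  have z x : (part x == u)%:R = 0 :> R.
    by case: eqP => // pu; rewrite -pu size_word eqxx in ur.
  have z' (h : X -> R) : E (fun x => (part x == u)%:R * h x) = 0.
    by rewrite -[RHS](expect_cst P); congr expect; apply/funext => x; rewrite z mul0r.
  have -> : E (fun x => (part x == u)%:R) = 0.
    by rewrite -[RHS](expect_cst P); congr expect; apply/funext => x; rewrite z.
  by rewrite !z' !mulr0 !addr0.
have De := D_ge1 r; set e := D r in De *.
have e0 : 0 < e := lt_le_trans ltr01 De.
(* The weight of u is split into its Doeblin part c p P(u) and the rest q. *)
have locb u : size u = r ->
  let Yu := E (fun x => cyl (w ++ u) x * gs (iter (N + r) S x)) in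
  let Au := E (fun x => cyl u x * gs (iter r S x)) in
  let pu := E (cyl u) in let q := E (cyl (w ++ u)) - c * p * pu in
  Yu <= e * (c * p * Au + q * ((1 + dlt) * E g)) /\
  c * p * Au + q * ((1 - dlt) * E g) <= e * Yu.
  move=> ur Yu Au pu q.
  have := distortion_ratio w u bgs gs0; rewrite -/N ur -/e -/Yu -/Au -/pu.
  move=> [r1 r2].
  have /andP[a1 a2] := ms u g bg g0.
  have AuE : Au = E (fun x => cyl u x * g (iter (size u + s) S x)).
    by congr expect; apply/funext => x; rewrite /gs -iterD addnC ur.
  rewrite -AuE -/pu in a1 a2.
  have pu0 : 0 < pu := expect_cyl_gt0 u.
  have q0 : 0 <= q.
    rewrite subr_ge0.
    have [_] := quasi_independence w (bmc u) (fun x => cyl_ge0 _ _ _ _ x).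
    have -> : (fun x => cyl w x * cyl u (iter (size w) S x)) = cyl (w ++ u).
      by apply/funext => x; rewrite cyl_cat.
    by move=> h; rewrite -mulrA /c mulrC ler_pdivrMr// [leRHS]mulrC.
  rewrite (_ : E (cyl (w ++ u)) = q + c * p * pu) in r1 r2; last by rewrite /q subrK.
  have cp : 0 <= c * p by rewrite mulr_ge0// ltW.
  split; rewrite -(ler_pM2l pu0).
    apply: (le_trans r1).
    rewrite -subr_ge0 (_ : _ - _ = e * (q * ((1 + dlt) * pu * E g - Au))); last by ring.
    by rewrite mulr_ge0 ?(ltW e0)// mulr_ge0// subr_ge0.
  rewrite [leRHS](_ : _ = e * pu * Yu); last by ring.
  apply: le_trans r2.
  rewrite -subr_ge0 (_ : _ - _ = q * (Au - (1 - dlt) * pu * E g)); last by ring.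
  by rewrite mulr_ge0// subr_ge0.
have U : Y <= e * (1 + (1 - c) * dlt) * (p * E g).
  rewrite -subr_ge0 (_ : _ - _ = -1 * Y + e * (c * p) * E g +
    e * ((1 + dlt) * E g) * p - e * (c * p * ((1 + dlt) * E g))); last by ring.
  apply: sum_u => u ur; have [+ _] := locb u ur; rewrite -subr_ge0 => h.
  by apply: (le_trans h); apply: le_of_eq; ring.
have L : (1 - (1 - c) * dlt) * (p * E g) <= e * Y.
  rewrite -subr_ge0 (_ : _ - _ = e * Y + - (c * p) * E g +
    - ((1 - dlt) * E g) * p + c * p * ((1 - dlt) * E g)); last by ring.
  apply: sum_u => u ur; have [_] := locb u ur; rewrite -subr_ge0 => h.
  by apply: (le_trans h); apply: le_of_eq; ring.
have pE : 0 <= p * E g by rewrite mulr_ge0// ltW.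
have cd : 0 <= (1 - c) * dlt <= dlt.
  by rewrite mulr_ge0 ?subr_ge0//= ler_piMl// lerBlDr lerDl ltW.
have /andP[cd0 cd1] := cd.
set dl := _ + (e - 1) * _.
rewrite -!mulrA; apply/andP; split; last first.
  apply: (le_trans U); rewrite ler_wpM2r// -subr_ge0.
  rewrite (_ : _ - _ = (e - 1) * (dlt - (1 - c) * dlt)); last by rewrite /dl; ring.
  by rewrite mulr_ge0 ?subr_ge0.
have dl0 : 0 <= dl.
  by rewrite addr_ge0// mulr_ge0 ?subr_ge0// addr_ge0.
have [d1|d1] := leP (1 - dl) 0.
  by apply: le_trans Y0; rewrite mulr_le0_ge0.
rewrite -(ler_pM2l e0); apply: le_trans L.
rewrite [leLHS]mulrA; apply: ler_wpM2r => //; rewrite -subr_ge0.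
rewrite (_ : _ - _ = (e - 1) * (dlt + dl)); last by rewrite /dl; ring.
by rewrite mulr_ge0 ?subr_ge0// addr_ge0.
Qed.
End Mixing.

(** * Decay of covariances *)

Section GeometricSums.
Context (R : realType).

Lemma sum_arith_geom (t : R) n : 0 < t < 1 ->
  \sum_(0 <= i < n) (i.+1)%:R * t ^+ i <= (1 - t) ^- 2.
Proof.
move=> /andP[t0 t1].
have t10 : 0 < 1 - t by rewrite subr_gt0.
suff -> : \sum_(0 <= i < n) (i.+1)%:R * t ^+ i =
    (1 - (n.+1)%:R * t ^+ n + n%:R * t ^+ n.+1) * (1 - t) ^- 2.
  rewrite -[leRHS]mul1r ler_pM2r ?invr_gt0 ?exprn_gt0//.
  rewrite -addrA gerDl addrC subr_le0 exprS mulrA ler_pM2r ?exprn_gt0//.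
  rewrite -natr1; have : 0 <= n%:R * (1 - t) by rewrite mulr_ge0// ltW.
  by rewrite mulrBr mulr1 subr_ge0 => h; rewrite (le_trans h)// lerDl.
elim: n => [|n IH]; first by rewrite big_geq// (_ : 1 - _ + _ = 0) ?mul0r//; ring.
rewrite big_nat_recr//= IH !exprS -!natr1; field; lra.
Qed.

(** There are 2 (i + 1) indices l for which i is the largest integer with i (i +
    1) <= l. *)
Lemma sum_sqrt_geom (t C : R) (a : nat -> R) n : 0 < t < 1 -> 0 <= C ->
  (forall l, 0 <= a l) -> (forall i l, (i * i.+1 <= l)%N -> a l <= C * t ^+ i) ->
  \sum_(0 <= l < n) a l <= 2 * C * (1 - t) ^- 2.
Proof.
move=> t01 C0 a0 aC.
have nn : (n <= n * n.+1)%N by case: n => // n; rewrite leq_pmulr.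
apply: (@le_trans _ _ (\sum_(0 <= l < n * n.+1) a l)).
  by rewrite (@big_cat_nat _ _ _ n 0 (n * n.+1))//= lerDl sumr_ge0.
apply: (@le_trans _ _ (2 * C * \sum_(0 <= i < n) (i.+1)%:R * t ^+ i)); last first.
  by rewrite ler_wpM2l ?mulr_ge0// sum_arith_geom.
elim: n {nn} => [|n IH]; first by rewrite !big_geq ?mulr0.
have le : (n * n.+1 <= n.+1 * n.+2)%N by apply: leq_mul; exact: leqnSn.
rewrite (@big_cat_nat _ _ _ (n * n.+1))//= [in leRHS]big_nat_recr//= mulrDr lerD//.
apply: (@le_trans _ _ (\sum_(n * n.+1 <= l < n.+1 * n.+2) C * t ^+ n)).
  by apply: ler_sum_nat => i /andP[ni _]; exact: aC.
rewrite sumr_const_nat (_ : (_ - _ = 2 * n.+1)%N).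
  rewrite -[leLHS]mulr_natl natrM; apply: le_of_eq; ring.
by rewrite (mulnC n) -mulnBr -addn2 addKn mulnC.
Qed.

End GeometricSums.

Section Covariance.
Context (R : realType) (d : measure_display) (X : measurableType d).
Context (A : countType) (P : probability X R) (S : X -> X) (col : X -> A).
Context (K rho : R) (gm : gibbs_markov P S col K rho).
Local Notation word := (word S col).
Local Notation cyl := (cyl R S col).
Local Notation E := (expect P).
Local Notation bm := bmeasurable.
Local Notation mixes := (mixes P S col).

Let rho0 : 0 < rho. Proof. by case/andP: (gm_ratio gm). Qed.
Let rho1 : rho < 1. Proof. by case/andP: (gm_ratio gm). Qed.

Lemma mixes_le l d1 d2 : d1 <= d2 -> mixes l d1 -> mixes l d2.
Proof.
move=> d12 m w g bg g0; have /andP[h1 h2] := m w g bg g0.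
have p : 0 <= E (cyl w) * E g.
  rewrite mulr_ge0//; last exact: expect_ge0.
  exact: ltW (expect_cyl_gt0 gm w).
apply/andP; split; [apply: le_trans h1|apply: (le_trans h2)];
  rewrite -!mulrA ler_wpM2r//; lra.
Qed.

(** The recursion given by the Doeblin argument has the additive error rho^r,
    where r is the length of the steps. Taking i steps of length i makes both
    errors exponentially small in i, hence the rate exp (- c sqrt l). *)
Lemma mixing_rate : exists C t : R, [/\ 0 <= C, 0 < t < 1, rho <= t &
  forall i l, (i * i <= l)%N -> mixes l (C * t ^+ i)].
Proof.
pose K' := K / (1 - rho).
have K'0 : 0 <= K' by rewrite divr_ge0 ?(gm_const gm)// subr_ge0 ltW.
pose D n : R := expR (K' * rho ^+ n).
have D1 n : 1 <= D n.
  by rewrite -[leLHS]expR0 ler_expR mulr_ge0 ?exprn_ge0 ?(ltW rho0).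
have DB r : D r - 1 <= K' * D 0%N * rho ^+ r.
  set x := K' * rho ^+ r.
  have x0 : 0 <= x by rewrite mulr_ge0 ?exprn_ge0 ?(ltW rho0).
  have : 1 - x <= expR (- x) by rewrite (le_trans _ (expR_ge1Dx _)).
  rewrite expRN -(ler_pM2r (expR_gt0 x)) mulVf ?gt_eqF ?expR_gt0//.
  rewrite mulrBl mul1r lerBlDr -lerBlDl => /le_trans; apply.
  rewrite [leRHS]mulrAC -/x; apply: ler_wpM2l => //; rewrite ler_expR ler_wpM2l// expr0.
  by rewrite exprn_ile1 ?(ltW rho0)// ltW.
set D0 := D 0%N in DB; have D01 : 1 <= D0 := D1 0%N.
have D00 : 0 < D0 := lt_le_trans ltr01 D01.
set c := D0^-1; have c0 : 0 < c by rewrite invr_gt0.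
have c1 : c <= 1 by rewrite invf_le1.
have mD0 l : mixes l D0 by apply: (mixes_ge gm (leq0n l)); exact: mixes0 gm.
have it k r : mixes (k * r) ((1 - c) ^+ k * D0 + (D r - 1) * (1 + D0) / c).
  set b := (D r - 1) * (1 + D0).
  have b0 : 0 <= b by rewrite mulr_ge0 ?subr_ge0// addr_ge0// ltW.
  elim: k => [|k IH].
    apply: (mixes_le _ (mD0 _)).
    by rewrite mul1r lerDl divr_ge0 ?(ltW c0).
  set x := _ + _ in IH.
  (* the previous error may exceed the trivial bound D0: use the smaller one *)
  have x0 : 0 <= x.
    by rewrite addr_ge0 ?divr_ge0 ?(ltW c0)// mulr_ge0 ?exprn_ge0 ?subr_ge0 ?(ltW D00).
  have mx : mixes (k * r) (Num.min x D0) by rewrite minElt; case: ifP.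
  have m0 : 0 <= Num.min x D0 by rewrite le_min x0 ltW.
  have := mixes_step gm r m0 mx; rewrite mulSn; apply: mixes_le.
  rewrite -/K' -/(D _) -/D0 -/c -/(D r).
  apply: (@le_trans _ _ ((1 - c) * x + b)).
    apply: lerD; first by rewrite ler_wpM2l ?subr_ge0// ge_min lexx.
    by rewrite /b ler_wpM2l ?subr_ge0// lerD2l ge_min lexx orbT.
  apply: le_of_eq.
  by rewrite /x exprS; field; rewrite gt_eqF.
pose t := Num.max rho (1 - c / 2).
pose C := D0 + K' * D0 * (1 + D0) / c.
have t0 : 0 < t by rewrite lt_max rho0.
exists C, t; split.
- apply: addr_ge0; first exact: ltW.
  apply: divr_ge0; last exact: ltW.
  by apply: mulr_ge0; [apply: mulr_ge0|apply: addr_ge0] => //; exact: ltW.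
- by rewrite t0/= gt_max rho1/= gtrBl divr_gt0.
- by rewrite le_max lexx.
move=> i l il; apply: (mixes_ge gm il); apply: mixes_le (it i i).
rewrite /C [leRHS]mulrDl; apply: lerD.
  rewrite mulrC ler_wpM2l ?(ltW D00)// lerXn2r ?nnegrE ?subr_ge0 ?(ltW t0)//.
  by rewrite le_max; apply/orP; right; lra.
rewrite [leRHS]mulrAC; apply: ler_wpM2r; first by rewrite invr_ge0 ltW.
rewrite [leRHS]mulrAC; apply: ler_wpM2r; first by rewrite addr_ge0// ltW.
apply: (le_trans (DB i)); apply: ler_wpM2l; first by rewrite mulr_ge0// ltW.
by rewrite lerXn2r ?nnegrE ?(ltW rho0) ?(ltW t0)// le_max lexx.
Qed.

(** psi, a function of the current symbol, controls both the size of G and its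
    oscillation on cylinders. For the induced observable it is the truncated
    height of the column: it has a bounded mean but is not bounded uniformly in
    the truncation, which is why the estimates below distinguish m from the
    supremum of psi. *)
Record observable (G : X -> R) (psi : A -> R) (m : R) : Prop := Observable {
  obs_bounded : bm G;
  obs_mean : E G = 0;
  obs_psi_ge0 : forall a, 0 <= psi a;
  obs_psi_bm : bm (fun x => psi (col x));
  obs_psi_mean : E (fun x => psi (col x)) <= m;
  obs_size : forall x, `|G x| <= psi (col x) + m;
  obs_var : forall k x y, word k.+1 x = word k.+1 y ->
    `|G x - G y| <= psi (col x) * rho ^+ k }.

(** The positive and negative parts of a centred function have the same mean;
    the main terms cancel and the relative errors remain. *)
Lemma mixes_signed l dlt w (G : X -> R) : 0 <= dlt -> mixes l dlt -> bm G -> E G = 0 ->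
  `|E (fun x => cyl w x * G (iter (size w + l) S x))|
    <= dlt * E (cyl w) * E (fun x => `|G x|).
Proof.
move=> dlt0 ml bG EG.
pose Gp x := 2^-1 * (`|G x| + G x); pose Gn x := 2^-1 * (`|G x| - G x).
have bN := bmeasurable_norm bG.
have bp : bm Gp by apply: bmeasurableM => //; exact: bmeasurableD.
have bn : bm Gn by apply: bmeasurableM => //; exact: bmeasurableB.
have p0 x : 0 <= Gp x by rewrite mulr_ge0 ?invr_ge0// -lerBlDr sub0r -normrN ler_norm.
have n0 x : 0 <= Gn x by rewrite mulr_ge0 ?invr_ge0// subr_ge0 ler_norm.
have Ep : E Gp = 2^-1 * E (fun x => `|G x|).
  rewrite expectZ; last exact: bmeasurableD.
  by rewrite expectD// EG addr0.
have En : E Gn = 2^-1 * E (fun x => `|G x|).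
  rewrite expectZ; last exact: bmeasurableB.
  by rewrite expectB// EG subr0.
have /andP[p1 p2] := ml w _ bp p0; have /andP[n1 n2] := ml w _ bn n0.
have -> : E (fun x => cyl w x * G (iter (size w + l) S x)) =
    E (fun x => cyl w x * Gp (iter (size w + l) S x)) -
    E (fun x => cyl w x * Gn (iter (size w + l) S x)).
  rewrite -expectB; [|exact: bmeasurable_cylM gm _ _ _ _..].
  by congr expect; apply/funext => x; rewrite /Gp /Gn; field.
rewrite Ep in p1 p2; rewrite En in n1 n2.
set EN := E (fun x => `|G x|) in p1 p2 n1 n2 *.
by rewrite ler_norml; apply/andP; split; lra.
Qed.

Lemma observable_norm_mean G psi m : observable G psi m ->
  E (fun x => `|G x|) <= 2 * m.
Proof.
move=> o; have bp := obs_psi_bm o.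
apply: (@le_trans _ _ (E (fun x => psi (col x) + m))).
  apply: le_expect; [exact: bmeasurable_norm (obs_bounded o)| |exact: obs_size o].
  exact: bmeasurableD.
rewrite expectD// expect_cst; have := obs_psi_mean o; lra.
Qed.

(** Take i + 1 for i. On a cylinder of length i + 1 the function G is constant
    up to psi rho^i. For the constant part mixing applies, with l - i - 1 >= (i
    + 1)^2 iterations left. For the oscillating part quasi-independence
    suffices. Both errors are multiplied by the means of psi and of |G|, never
    by their suprema. The case i = 0 is the Cauchy-Schwarz inequality. *)
Lemma covariance_decay : exists C t : R, [/\ 0 <= C, 0 < t < 1 &
  forall G psi m, observable G psi m ->
  forall i l, (i * i.+1 <= l)%N ->
  `|E (fun x => G x * G (iter l S x))|
     <= C * (m ^+ 2 + E (fun x => G x ^+ 2)) * t ^+ i].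
Proof.
have [C [t [C0 t01 rt mix]]] := mixing_rate.
have /andP[t0 t1] := t01.
pose C' := C + (1 + C) / rho.
have C'0 : 0 <= C' by rewrite addr_ge0// divr_ge0 ?addr_ge0// ltW.
exists (1 + 4 * C'), t; split => //; first by rewrite addr_ge0 ?mulr_ge0.
move=> G psi m o [|i] l il.
  have bG := obs_bounded o.
  have bG2 : bm (fun x => G x ^+ 2).
    by under eq_fun do rewrite expr2; exact: bmeasurableM.
  have bGl := bmeasurable_iter gm l bG.
  rewrite expr0 mulr1.
  apply: (@le_trans _ _ (E (fun x => G x ^+ 2))); last first.
    have q2 : 0 <= m ^+ 2 + E (fun x => G x ^+ 2).
      by rewrite addr_ge0 ?sqr_ge0//; apply: expect_ge0 => x; rewrite sqr_ge0.
    rewrite mulrDl mul1r -addrA [leRHS]addrCA lerDl.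
    by rewrite addr_ge0 ?sqr_ge0// mulr_ge0// mulr_ge0.
  apply: (le_trans (expect_norm _ _)); first exact: bmeasurableM.
  have bG2l := bmeasurable_iter gm l bG2.
  rewrite [leRHS](_ : _ = E (fun x => 2^-1 * (G x ^+ 2 + G (iter l S x) ^+ 2))).
    apply: le_expect.
    - by apply: bmeasurable_norm; exact: bmeasurableM.
    - by apply: bmeasurableM => //; exact: bmeasurableD.
    - move=> x; rewrite normrM -(real_normK (num_real (G x))).
      rewrite -(real_normK (num_real (G (iter l S x)))).
      have := sqr_ge0 (`|G x| - `|G (iter l S x)|).
      by rewrite sqrrB; lra.
  rewrite expectZ; last exact: bmeasurableD.
  rewrite (expectD _ bG2 bG2l) (expect_iter gm l bG2). lra.
have [bG EG psi0 bpsi psim Gpsi Gvar] := o.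
have EN := observable_norm_mean o.
set N := E (fun x => `|G x|) in EN.
have N0 : 0 <= N by apply: expect_ge0.
have m0 : 0 <= m.
  by apply: le_trans psim; apply: expect_ge0 => x; exact: psi0.
pose dl := C * t ^+ i.+1.
have dl0 : 0 <= dl by rewrite mulr_ge0// exprn_ge0// ltW.
have il' : (i.+1 * i.+1 <= l - i.+1)%N by rewrite leq_subRL ?(leq_trans _ il) -?mulnS// leq_pmulr.
have li : (i.+1 <= l)%N by rewrite (leq_trans _ il)// leq_pmulr.
have ml : mixes (l - i.+1) dl := mix i.+1 _ il'.
pose B := N * (dl + rho ^+ i * (1 + dl)).
have B0 : 0 <= B.
  by rewrite mulr_ge0// addr_ge0// mulr_ge0 ?exprn_ge0 ?addr_ge0// ltW.
have bGl := bmeasurable_iter gm l bG.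
have bGG : bm (fun x => G x * G (iter l S x)) by exact: bmeasurableM.
have b1 : bm (fun x => B * (psi (col x) + m)).
  by apply: bmeasurableM => //; exact: bmeasurableD.
have loc w : size w = i.+1 ->
    `|E (fun x => cyl w x * (G x * G (iter l S x)))|
      <= E (fun x => cyl w x * (B * (psi (col x) + m))).
  move=> wi; have [y yw] : exists y, word (size w) y = w.
    apply: contrapT => /forallNP nw; have := expect_cyl_gt0 gm w.
    suff -> : E (cyl w) = 0 by rewrite ltxx.
    rewrite -[RHS](expect_cst P); congr expect; apply/funext => x.
    by rewrite /cyl; case: eqP => // /nw.
  have bw := bmeasurable_cyl gm w.
  have cylE x : cyl w x != 0 -> word i.+1 x = word i.+1 y.
    by rewrite /cyl -wi yw; case: (word _ x =P w) => // _; rewrite eqxx.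
  have colE x : cyl w x * psi (col x) = cyl w x * psi (col y).
    have [->|/cylE] := eqVneq (cyl w x) 0; first by rewrite !mul0r.
    by rewrite !wordS => -[->].
  have -> : E (fun x => cyl w x * (B * (psi (col x) + m))) =
      B * (psi (col y) + m) * E (cyl w).
    rewrite -expectZ//; congr expect; apply/funext => x.
    by rewrite mulrCA mulrDr colE; ring.
  have lE : (size w + (l - i.+1) = l)%N by rewrite wi subnKC.
  have m1 := mixes_signed w dl0 ml bG EG; rewrite lE -/N in m1.
  have /andP[_ m2] := ml w _ (bmeasurable_norm bG) (fun x => normr_ge0 _).
  rewrite lE -/N in m2.
  have bd : bm (fun x => cyl w x * ((G x - G y) * G (iter l S x))).
    apply: bmeasurableM => //; apply: bmeasurableM => //.
    exact: bmeasurableB.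
  have bcG : bm (fun x => cyl w x * G (iter l S x)) by exact: bmeasurableM.
  have -> : E (fun x => cyl w x * (G x * G (iter l S x))) =
      G y * E (fun x => cyl w x * G (iter l S x)) +
      E (fun x => cyl w x * ((G x - G y) * G (iter l S x))).
    rewrite -expectZ// -expectD//; last exact: bmeasurableM.
    by congr expect; apply/funext => x; ring.
  apply: (le_trans (ler_normD _ _)).
  have p0 := ltW (expect_cyl_gt0 gm w); set p := E (cyl w) in p0 m1 m2 *.
  apply: (@le_trans _ _ ((psi (col y) + m) * (dl * p * N) +
      psi (col y) * rho ^+ i * ((1 + dl) * p * N))); last first.
    rewrite -subr_ge0 (_ : _ - _ = m * (rho ^+ i * ((1 + dl) * p * N))); last first.
      by rewrite /B; ring.
    rewrite mulr_ge0// mulr_ge0 ?exprn_ge0 ?(ltW rho0)// mulr_ge0// mulr_ge0//.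
    exact: addr_ge0.
  apply: lerD; first by rewrite normrM ler_pM.
  apply: (le_trans (expect_norm _ bd)).
  apply: (@le_trans _ _ (E (fun x => psi (col y) * rho ^+ i * (cyl w x * `|G (iter l S x)|)))).
    apply: le_expect.
    - exact: bmeasurable_norm.
    - apply: bmeasurableM => //; apply: bmeasurableM => //.
      exact: bmeasurable_norm.
    move=> x; rewrite !normrM (ger0_norm (cyl_ge0 _ _ _ _ _)).
    have [->|/cylE wx] := eqVneq (cyl w x) 0; first by rewrite !mul0r mulr0.
    rewrite [leRHS]mulrCA ler_wpM2l ?cyl_ge0// ler_wpM2r//.
    have := Gvar _ _ _ wx; move: wx; rewrite !wordS => -[-> _]; exact.
  rewrite expectZ; last by apply: bmeasurableM => //; exact: bmeasurable_norm.
  by rewrite ler_wpM2l// mulr_ge0// exprn_ge0// ltW.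
have fib w : `|E (fun x => (word i.+1 x == w)%:R * (G x * G (iter l S x)))|
      <= E (fun x => (word i.+1 x == w)%:R * (B * (psi (col x) + m))).
  have [wi|wi] := eqVneq (size w) i.+1; first by rewrite -wi; exact: loc.
  have z x : (word i.+1 x == w)%:R = 0 :> R.
    by case: eqP => // xw; rewrite -xw size_word eqxx in wi.
  have zE h : E (fun x => (word i.+1 x == w)%:R * h x) = 0.
    by rewrite -[RHS](expect_cst P); congr expect; apply/funext => x; rewrite z mul0r.
  by rewrite !zE normr0.
have bfib w : bm (fun x => (word i.+1 x == w)%:R : R).
  apply: bmeasurable_bool.
  rewrite (_ : [set _ | _] = word i.+1 @^-1` [set w]).
    exact: (fiber_measurable_word gm).
  by apply/seteqP; split => x /eqP.
have glob : `|E (fun x => G x * G (iter l S x))| <= E (fun x => B * (psi (col x) + m)).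
  rewrite ler_norml; apply/andP; split.
    rewrite -subr_ge0 opprK -expectD//.
    apply: (expect_fibers_ge0 (fiber_measurable_word gm i.+1)) => [|w].
      exact: bmeasurableD.
    under eq_fun do rewrite mulrDr.
    rewrite expectD; [|exact: bmeasurableM..].
    rewrite -[X in 0 <= _ + X]opprK subr_ge0.
    by have := fib w; rewrite ler_norml => /andP[].
  rewrite -subr_ge0 -expectB//.
  apply: (expect_fibers_ge0 (fiber_measurable_word gm i.+1)) => [|w].
    exact: bmeasurableB.
  under eq_fun do rewrite mulrBr.
  rewrite expectB; [|exact: bmeasurableM..].
  rewrite subr_ge0.
  by have := fib w; rewrite ler_norml => /andP[].
apply: (le_trans glob); rewrite expectZ; last exact: bmeasurableD.
rewrite expectD// expect_cst.
apply: (@le_trans _ _ (B * (2 * m))).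
  by rewrite ler_wpM2l//; move: psim; lra.
have BC : B <= 2 * m * C' * t ^+ i.+1.
  rewrite /B -mulrA; apply: ler_pM => //.
    by rewrite addr_ge0// mulr_ge0 ?exprn_ge0 ?addr_ge0// ltW.
  rewrite /C' mulrDl lerD//.
  rewrite [leRHS](_ : _ = (rho^-1 * t ^+ i.+1) * (1 + C)); last by ring.
  apply: ler_pM => //.
  - by rewrite exprn_ge0// ltW.
  - by rewrite addr_ge0.
  - rewrite mulrC ler_pdivlMr// -exprSr.
    by rewrite lerXn2r ?nnegrE ?(ltW rho0) ?(ltW t0).
  - by rewrite lerD2l /dl ler_piMr// exprn_ile1 ?(ltW t0)// ltW.
apply: (@le_trans _ _ (2 * m * C' * t ^+ i.+1 * (2 * m))).
  by rewrite ler_wpM2r// mulr_ge0.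
have EG2 : 0 <= E (fun x => G x ^+ 2) by apply: expect_ge0 => x; rewrite sqr_ge0.
rewrite -subr_ge0 (_ : _ - _ = t ^+ i.+1 *
  (m ^+ 2 + (1 + 4 * C') * E (fun x => G x ^+ 2))); last by ring.
rewrite mulr_ge0 ?exprn_ge0 ?(ltW t0)// addr_ge0 ?sqr_ge0// mulr_ge0//.
by rewrite addr_ge0 ?mulr_ge0.
Qed.
End Covariance.

(** * Second moments and stopping times *)

Section Maximal.
Context (R : realType) (d : measure_display) (X : measurableType d).
Context (A : countType) (P : probability X R) (S : X -> X) (col : X -> A).
Context (K rho : R) (gm : gibbs_markov P S col K rho).
Local Notation word := (word S col).
Local Notation cyl := (cyl R S col).
Local Notation E := (expect P).
Local Notation bm := bmeasurable.
Local Notation observable := (observable P S col rho).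

Let rho0 : 0 < rho. Proof. by case/andP: (gm_ratio gm). Qed.
Let rho1 : rho < 1. Proof. by case/andP: (gm_ratio gm). Qed.

Local Notation U := (birkhoff_sum S).

Lemma birkhoff_sum0 (G : X -> R) x : U G 0 x = 0.
Proof. by rewrite /birkhoff_sum big_geq. Qed.

Lemma birkhoff_sumS (G : X -> R) n x : U G n.+1 x = U G n x + G (iter n S x).
Proof. by rewrite /birkhoff_sum big_nat_recr. Qed.

Lemma birkhoff_sum_add (G : X -> R) k l x :
  U G (k + l) x = U G k x + U G l (iter k S x).
Proof.
rewrite /birkhoff_sum (@big_cat_nat _ _ _ k)//= ?leq_addr//; congr (_ + _).
rewrite -{1}[k]add0n big_addn addKn; apply: eq_bigr => i _.
by rewrite iterD.
Qed.

Lemma bmeasurable_birkhoff_sum (G : X -> R) n : bm G -> bm (U G n).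
Proof.
move=> bG; rewrite /birkhoff_sum; apply: bmeasurable_sum => i.
exact: (bmeasurable_iter gm).
Qed.

Lemma expect_sum n (F : nat -> X -> R) : (forall i, bm (F i)) ->
  E (fun x => \sum_(0 <= i < n) F i x) = \sum_(0 <= i < n) E (F i).
Proof.
move=> bF; elim: n => [|n IH].
  by rewrite big_geq// -[RHS](expect_cst P); congr expect; apply/funext => x; rewrite big_geq.
rewrite big_nat_recr//= -IH -expectD//; last exact: bmeasurable_sum.
by congr expect; apply/funext => x; rewrite big_nat_recr.
Qed.

(** Expanding the square, the covariances sum to a constant multiple of m^2 + E
    G^2, uniformly in the position. *)
Lemma second_moment : exists2 C : R, 0 <= C &
  forall G psi m, observable G psi m -> forall n,
    E (fun x => U G n x ^+ 2) <= C * n%:R * (m ^+ 2 + E (fun x => G x ^+ 2)).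
Proof.
have [C [t [C0 t01 cov]]] := covariance_decay gm.
exists (1 + 2 * (2 * C * (1 - t) ^- 2)).
  have : 0 <= (1 - t) ^- 2 by rewrite invr_ge0 sqr_ge0.
  by move=> ?; rewrite addr_ge0// !mulr_ge0.
move=> G psi m o; have bG := obs_bounded o.
set V := m ^+ 2 + _; have EG2 : 0 <= E (fun x => G x ^+ 2).
  by apply: expect_ge0 => x; rewrite sqr_ge0.
have V0 : 0 <= V by rewrite addr_ge0 ?sqr_ge0.
have bsq (h : X -> R) : bm h -> bm (fun x => h x ^+ 2).
  by move=> bh; under eq_fun do rewrite expr2; exact: bmeasurableM.
elim=> [|n IH].
  rewrite mulr0 mul0r -(expect_cst P 0); apply: le_of_eq.
  by congr expect; apply/funext => x; rewrite birkhoff_sum0 expr2 mulr0.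
have bUn := bmeasurable_birkhoff_sum n bG.
have bGn := bmeasurable_iter gm n bG.
have bGi i := bmeasurable_iter gm i bG.
have -> : E (fun x => U G n.+1 x ^+ 2) = E (fun x => U G n x ^+ 2) +
    2 * E (fun x => U G n x * G (iter n S x)) + E (fun x => G x ^+ 2).
  rewrite -(expect_iter gm n (bsq _ bG)) -expectZ; last exact: bmeasurableM.
  have b2 : bm (fun x => 2 * (U G n x * G (iter n S x))).
    by repeat apply: bmeasurableM.
  rewrite -expectD; [|exact: bsq|exact: b2].
  rewrite -expectD; [|apply: bmeasurableD => //; exact: bsq|exact: bsq].
  by congr expect; apply/funext => x; rewrite birkhoff_sumS; ring.
have -> : E (fun x => U G n x * G (iter n S x)) =
    \sum_(0 <= j < n) E (fun x => G x * G (iter (n - j) S x)).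
  rewrite (_ : (fun x => U G n x * G (iter n S x)) =
    (fun x => \sum_(0 <= j < n) G (iter j S x) * G (iter n S x))); last first.
    by apply/funext => x; rewrite /birkhoff_sum mulr_suml.
  rewrite expect_sum; last by move=> i; exact: bmeasurableM.
  rewrite !big_nat; apply: eq_bigr => j /andP[_ jn].
  have bGG : bm (fun x => G x * G (iter (n - j) S x)) by exact: bmeasurableM.
  rewrite -(expect_iter gm j bGG).
  by congr expect; apply/funext => x; rewrite -iterD subnK// ltnW.
pose a l := `|E (fun x => G x * G (iter l S x))|.
have sumV : \sum_(0 <= j < n) E (fun x => G x * G (iter (n - j) S x)) <=
    2 * (C * V) * (1 - t) ^- 2.
  apply: (@le_trans _ _ (\sum_(0 <= j < n.+1) a j)).
    rewrite big_nat_recl// big_nat_rev/= add0n.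
    rewrite -[leLHS]add0r lerD ?normr_ge0//.
    rewrite !big_nat; apply: ler_sum => j /andP[_ jn].
    by rewrite subKn//; exact: ler_norm.
  apply: sum_sqrt_geom => //; first exact: mulr_ge0.
    by move=> l; exact: normr_ge0.
  by move=> i l il; exact: (cov _ _ _ o).
rewrite -natr1.
apply: (@le_trans _ _ ((1 + 2 * (2 * C * (1 - t) ^- 2)) * n%:R * V +
   2 * (2 * (C * V) * (1 - t) ^- 2) + V)).
  apply: lerD; last by rewrite lerDr sqr_ge0.
  by apply: lerD => //; rewrite ler_pM2l.
by apply: le_of_eq; ring.
Qed.

(** The predicate is read on words, so that the time at which it is first
    satisfied is a stopping time for the symbols. *)
Definition first_hit (D : seq A -> bool) (w : seq A) : bool :=
  D w && all (fun j => ~~ D (take j w)) (iota 0 (size w)).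

Definition hit (D : seq A -> bool) (n : nat) (x : X) : bool :=
  has (fun l => D (word l x)) (iota 0 n.+1).

Lemma take_word j l x : (j <= l)%N -> take j (word l x) = word j x.
Proof. by move=> jl; rewrite -(subnKC jl) word_add take_size_cat ?size_word. Qed.

Lemma first_hitP D l x : first_hit D (word l x) =
  D (word l x) && all (fun j => ~~ D (word j x)) (iota 0 l).
Proof.
rewrite /first_hit size_word; congr (_ && _); apply: eq_in_all => j.
by rewrite mem_iota add0n => /andP[_ jl]; rewrite take_word// ltnW.
Qed.

Lemma hit_first D n x : hit D n x ->
  exists2 l, (l <= n)%N & first_hit D (word l x).
Proof.
move=> /hasP[l0]; rewrite mem_iota add0n ltnS => /andP[_ l0n] Dl0.
have ex : exists l, D (word l x) by exists l0.
exists (ex_minn ex); case: ex_minnP => l Dl lmin.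
  by rewrite (leq_trans (lmin _ Dl0)).
rewrite first_hitP Dl/=; apply/allP => j; rewrite mem_iota add0n => /andP[_ jl].
by apply/negP => /lmin; rewrite leqNgt jl.
Qed.

Lemma sum_first_hit D n x :
  \sum_(0 <= l < n.+1) (first_hit D (word l x))%:R <= (hit D n x)%:R :> R.
Proof.
have [h|h] := boolP (hit D n x); last first.
  rewrite big_nat big1// => l ln; case: (boolP (first_hit _ _)) => //.
  rewrite first_hitP => /andP[Dl _]; case/negP: h; apply/hasP; exists l => //.
  by rewrite mem_iota.
have [l0 l0n f0] := hit_first h.
rewrite (bigD1_seq l0) ?mem_index_iota ?iota_uniq//= f0.
rewrite big1_seq ?addr0// => l /andP[ll0]; rewrite mem_index_iota => ln.
case: (boolP (first_hit _ _)) => // fl.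
have [lt|lt|eq] := ltngtP l l0.
- move: f0; rewrite first_hitP => /andP[_ /allP/(_ l)].
  rewrite mem_iota lt => /(_ isT); move: fl; rewrite first_hitP => /andP[->] //.
- move: fl; rewrite first_hitP => /andP[_ /allP/(_ l0)].
  rewrite mem_iota lt => /(_ isT); move: f0; rewrite first_hitP => /andP[->] //.
- by rewrite eq eqxx in ll0.
Qed.

Lemma measurable_word_pred (D : seq A -> bool) l :
  measurable [set x | D (word l x)].
Proof.
exact: (fiber_measurable_preimage [set w | D w] (fiber_measurable_word gm l)).
Qed.

Lemma measurable_has (b : nat -> X -> bool) n :
  (forall l, measurable [set x | b l x]) ->
  measurable [set x | has (fun l => b l x) (iota 0 n)].
Proof.
move=> mb; elim: (iota 0 n) => [|l s IH].
  by rewrite (_ : [set _ | _] = set0)//; apply/seteqP; split.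
rewrite (_ : [set _ | _] = [set x | b l x] `|` [set x | has (fun l => b l x) s]).
  exact: measurableU.
by apply/seteqP; split => x /= /orP.
Qed.

Definition quasi_const : R := expR (K / (1 - rho) * rho ^+ 0).
Local Notation M0 := quasi_const.

Lemma quasi_const_ge1 : 1 <= M0.
Proof.
rewrite -[leLHS]expR0 ler_expR mulr_ge0//.
by rewrite divr_ge0 ?(gm_const gm)// subr_ge0 ltW.
Qed.

Lemma preimage_iter_measurable (b : X -> bool) l : measurable [set x | b x] ->
  measurable [set x | b (iter l S x)].
Proof.
move=> mb; rewrite -[X in measurable X]setTI.
by have := @measurable_iter _ _ _ _ _ _ _ _ _ gm l measurableT _ mb.
Qed.

(** Decompose according to the stopping time l and the word of length l: what
    happens after time l is quasi-independent of the word. *)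
Lemma stopping D (B : nat -> X -> bool) n (beta : R) (Q : X -> bool) :
  (forall l, measurable [set x | B l x]) -> measurable [set x | Q x] ->
  (forall l, (l <= n)%N -> E (fun x => (B l x)%:R) <= beta) ->
  (forall x, Q x ->
    exists2 l, (l <= n)%N & first_hit D (word l x) /\ B l (iter l S x)) ->
  E (fun x => (Q x)%:R) <= M0 * beta * E (fun x => (hit D n x)%:R).
Proof.
move=> mB mQ Bb QP.
have mH l := measurable_word_pred (first_hit D) l.
have bH l := bmeasurable_bool R (mH l).
have bB l := bmeasurable_bool R (mB l).
have bBl l := bmeasurable_iter gm l (bB l).
have bHB l : bm (fun x => (first_hit D (word l x))%:R * (B l (iter l S x))%:R : R).
  exact: bmeasurableM.
have mhit : measurable [set x | hit D n x].
  by apply: measurable_has => l; exact: measurable_word_pred.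
have bhit := bmeasurable_bool R mhit.
have beta0 : 0 <= beta.
  by apply: le_trans (Bb 0%N _) => //; apply: expect_ge0.
have M00 : 0 <= M0 := le_trans ler01 quasi_const_ge1.
have one l : (l <= n)%N ->
    E (fun x => (first_hit D (word l x))%:R * (B l (iter l S x))%:R) <=
    M0 * beta * E (fun x => (first_hit D (word l x))%:R).
  move=> ln; rewrite -subr_ge0 -expectZ// -expectB//; last exact: bmeasurableM.
  apply: (expect_fibers_ge0 (fiber_measurable_word gm l)) => [|w].
    by apply: bmeasurableB => //; exact: bmeasurableM.
  have [wl|wl] := eqVneq (size w) l; last first.
    apply: expect_ge0 => x; case: eqP => [xw|]; last by rewrite mul0r.
    by rewrite -xw size_word eqxx in wl.
  have bw := bmeasurable_cyl gm w.
  have -> : E (fun x => (word l x == w)%:R * (M0 * beta * (first_hit D (word l x))%:R -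
      (first_hit D (word l x))%:R * (B l (iter l S x))%:R)) =
     (first_hit D w)%:R * (M0 * beta * E (cyl w) -
        E (fun x => cyl w x * (B l (iter (size w) S x))%:R)).
    rewrite -expectZ// -expectB; [|exact: bmeasurableM|]; last first.
      by rewrite wl; exact: bmeasurableM.
    rewrite -expectZ; last first.
      apply: bmeasurableB; first exact: bmeasurableM.
      by rewrite wl; exact: bmeasurableM.
    congr expect; apply/funext => x; rewrite /cyl wl.
    have [->|_] := eqVneq (word l x) w; first by ring.
    by rewrite !mul0r mulr0 subrr mulr0.
  rewrite mulr_ge0// subr_ge0.
  have [+ _] := quasi_independence gm w (bB l) (fun x => ler0n _ _).
  move=> /le_trans; apply; rewrite mulrAC ler_wpM2r//.
    by apply: expect_ge0 => x; exact: cyl_ge0.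
  by rewrite ler_wpM2l// Bb.
apply: (@le_trans _ _ (E (fun x => \sum_(0 <= l < n.+1)
    (first_hit D (word l x))%:R * (B l (iter l S x))%:R))).
  apply: le_expect; [exact: bmeasurable_bool|exact: bmeasurable_sum|].
  move=> x; have [/QP[l ln [Hl Bl]]|_] := boolP (Q x); last first.
    by apply: sumr_ge0 => l _; rewrite mulr_ge0.
  rewrite (bigD1_seq l) ?mem_index_iota ?iota_uniq//= Hl Bl mulr1 lerDl.
  by apply: sumr_ge0 => j _; rewrite mulr_ge0.
rewrite expect_sum//.
apply: (@le_trans _ _ (M0 * beta * \sum_(0 <= l < n.+1) E (fun x => (first_hit D (word l x))%:R))).
  rewrite mulr_sumr big_nat [leRHS]big_nat; apply: ler_sum => l ln; exact: one.
rewrite ler_wpM2l ?mulr_ge0// -expect_sum//.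
apply: le_expect => //; first exact: bmeasurable_sum.
by move=> x; exact: sum_first_hit.
Qed.

End Maximal.

(** * Deviations of the maximal sums *)

Section MaximalTail.
Context (R : realType) (d : measure_display) (X : measurableType d).
Context (A : countType) (P : probability X R) (S : X -> X) (col : X -> A).
Context (K rho : R) (gm : gibbs_markov P S col K rho).
Local Notation word := (word S col).
Local Notation E := (expect P).
Local Notation bm := bmeasurable.
Local Notation observable := (observable P S col rho).
Local Notation U := (birkhoff_sum S).
Local Notation M0 := (quasi_const K rho).

Let rho0 : 0 < rho. Proof. by case/andP: (gm_ratio gm). Qed.
Let rho1 : rho < 1. Proof. by case/andP: (gm_ratio gm). Qed.
Let M01 : 1 <= M0 := quasi_const_ge1 gm.
Let M00 : 0 <= M0 := le_trans ler01 M01.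

Definition max_ge (G : X -> R) (n : nat) (s : R) (x : X) : bool :=
  has (fun k => s <= `|U G k x|) (iota 0 n.+1).

Lemma max_geP G n s x : reflect (exists2 k, (k <= n)%N & s <= `|U G k x|)
  (max_ge G n s x).
Proof.
by apply: (iffP hasP) => -[k]; rewrite ?mem_iota => kn h; exists k; rewrite ?mem_iota.
Qed.

Lemma measurable_ge_norm (h : X -> R) s : measurable_fun setT h ->
  measurable [set x | s <= `|h x|].
Proof.
move=> mh; have mn : measurable_fun setT (fun x => `|h x|) by exact: measurableT_comp.
rewrite (_ : [set _ | _] = (fun x => `|h x|) @^-1` `[s, +oo[); last first.
  by apply/seteqP; split => x /=; rewrite in_itv/= andbT.
by rewrite -[X in measurable X]setTI; exact: mn.
Qed.

Lemma measurable_max_ge G n s : measurable_fun setT G ->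
  measurable [set x | max_ge G n s x].
Proof.
move=> mG; apply: measurable_has => l; apply: measurable_ge_norm.
rewrite /birkhoff_sum; apply: measurable_sum => i.
exact: (measurableT_comp mG (measurable_iter gm i)).
Qed.

Lemma le_expect_bool (b c : X -> bool) : measurable [set x | b x] ->
  measurable [set x | c x] -> (forall x, b x -> c x) ->
  E (fun x => (b x)%:R) <= E (fun x => (c x)%:R).
Proof.
move=> mb mc bc; apply: le_expect; [exact: bmeasurable_bool..|move=> x].
by rewrite ler_nat; have := bc x; case: (b x) => // ->.
Qed.

Section Observable.
Variables (G : X -> R) (psi : A -> R) (m L u : R).
Hypothesis o : observable G psi m.
Hypothesis psiL : forall a, psi a <= L.
Hypothesis Lu : L / (1 - rho) <= u.
Hypothesis Gu : forall x, `|G x| <= u.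
Hypothesis u0 : 0 < u.

Let mG : measurable_fun setT G. Proof. by case: (obs_bounded o). Qed.

(** The variations of the successive terms form a geometric series, since the
    words on which the points agree get shorter. *)
Lemma birkhoff_sum_variation k x y : word k x = word k y ->
  `|U G k x - U G k y| <= u.
Proof.
move=> kxy; apply: le_trans Lu.
have rho10 : 0 < 1 - rho by rewrite subr_gt0.
have L0 : 0 <= L by apply: le_trans (psiL (col x)); exact: (obs_psi_ge0 o).
suff le : `|U G k x - U G k y| <= L * (1 - rho ^+ k) / (1 - rho).
  apply: (le_trans le); rewrite ler_pM2r ?invr_gt0// ler_piMr//.
  by rewrite lerBlDr lerDl exprn_ge0// ltW.
elim: k x y kxy => [|k IH] x y kxy.
  by rewrite !birkhoff_sum0 subrr normr0 expr0 subrr mulr0 mul0r.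
have e z : U G k.+1 z = G z + U G k (S z).
  by rewrite -[k.+1]add1n birkhoff_sum_add birkhoff_sumS birkhoff_sum0 add0r.
rewrite !e opprD addrACA; apply: (le_trans (ler_normD _ _)).
have := obs_var o kxy; move: kxy; rewrite !wordS => -[cxy kxy] Gxy.
have le1 : psi (col x) * rho ^+ k <= L * rho ^+ k.
  by rewrite ler_wpM2r// exprn_ge0// ltW.
apply: (le_trans (lerD (le_trans Gxy le1) (IH _ _ kxy))).
by apply: le_of_eq; rewrite exprS; field; lra.
Qed.

Let D (a : R) (w : seq A) : bool :=
  `[< exists2 y, word (size w) y = w & a <= `|U G (size w) y| >].

Let DE (a : R) l x : D a (word l x) -> a - u <= `|U G l x|.
Proof.
move=> /asboolP[y]; rewrite size_word => yx ay.
rewrite lerBlDr; apply: (le_trans ay).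
rewrite -[U G l y](subrK (U G l x)); apply: (le_trans (ler_normD _ _)).
by rewrite addrC lerD2l birkhoff_sum_variation.
Qed.

Let DI (a : R) l x : a <= `|U G l x| -> D a (word l x).
Proof. by move=> ax; apply/asboolP; exists x; rewrite size_word. Qed.

Let mhit a n : measurable [set x | hit S col (D a) n x].
Proof. by apply: measurable_has => l; exact: (measurable_word_pred gm). Qed.

(** To exceed s + 4 u, the sums first have to pass 2 u; as a term is at most u,
    they then are at most 3 u, and it remains to gain s from there on. These two
    events are quasi-independent. The level 2 u is tested on whole cylinders,
    where the sums vary by u: the stopping event still forces a sum larger than
    u. *)
Lemma hoffmann_jorgensen n s : 0 <= s ->
  E (fun x => (max_ge G n (s + 4 * u) x)%:R) <=
  M0 * E (fun x => (max_ge G n s x)%:R) * E (fun x => (max_ge G n u x)%:R).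
Proof.
move=> s0; have ms t := measurable_max_ge n t mG.
apply: (@le_trans _ _ (M0 * E (fun x => (max_ge G n s x)%:R) *
    E (fun x => (hit S col (D (2 * u)) n x)%:R))); last first.
  apply: ler_wpM2l; first by rewrite mulr_ge0// expect_ge0.
  apply: le_expect_bool => // x /hasP[l ln /DE h].
  by apply/hasP; exists l => //; apply: le_trans h; lra.
apply: (stopping gm (B := fun _ => max_ge G n s)) => //.
move=> x /max_geP[k kn sk].
have hk : hit S col (D (2 * u)) n x.
  apply/hasP; exists k; first by rewrite mem_iota.
  by apply: DI; apply: le_trans sk; have := u0; lra.
have [l ln fl] := hit_first hk; exists l => //; split => //.
have low j : (j < l)%N -> `|U G j x| < 2 * u.
  move=> jl; rewrite ltNge; apply/negP => /DI Dj.
  move: fl; rewrite first_hitP => /andP[_ /allP/(_ j)].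
  by rewrite mem_iota jl => /(_ isT); rewrite Dj.
have lk : (l <= k)%N.
  rewrite leqNgt; apply/negP => /low; rewrite ltNge => /negP; apply.
  by apply: le_trans sk; have := u0; lra.
(* the jump at the stopping time is at most u *)
have Ul : `|U G l x| <= 3 * u.
  case: l low {ln fl lk} => [_|l low].
    by rewrite birkhoff_sum0 normr0 mulr_ge0// ltW.
  rewrite birkhoff_sumS; apply: (le_trans (ler_normD _ _)).
  by have := Gu (iter l S x); have := low l (ltnSn l); lra.
apply/max_geP; exists (k - l)%N; first by rewrite (leq_trans (leq_subr _ _)).
have := birkhoff_sum_add S G l (k - l) x; rewrite subnKC// => Uk.
have := ler_normD (U G l x) (U G (k - l) (iter l S x)); rewrite -Uk.
by have := u0; lra.
Qed.

Lemma hoffmann_jorgensen_iter n r :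
  E (fun x => (max_ge G n (r%:R * (4 * u)) x)%:R) <=
  M0 ^+ r * E (fun x => (max_ge G n u x)%:R) ^+ r.
Proof.
have E0 t : 0 <= E (fun x => (max_ge G n t x)%:R) by exact: expect_ge0.
elim: r => [|r IH].
  rewrite !expr0 mulr1 -[leRHS](expect_cst P); apply: le_expect => //.
    exact: bmeasurable_bool (measurable_max_ge _ _ mG).
  by move=> x; case: (max_ge _ _ _ _).
rewrite -natr1 mulrDl mul1r.
have s0 : 0 <= r%:R * (4 * u) by rewrite !mulr_ge0// ltW.
apply: (le_trans (hoffmann_jorgensen n s0)).
rewrite [leRHS](_ : _ = M0 * (M0 ^+ r * E (fun x => (max_ge G n u x)%:R) ^+ r) *
  E (fun x => (max_ge G n u x)%:R)); last by rewrite !exprS; ring.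
by rewrite ler_wpM2r// ler_wpM2l.
Qed.

(** Once the sums have passed 3 u, either the last one is larger than u, or the
    sum of the subsequent terms is; the latter has probability at most 1/2 given
    the past, and can be absorbed. *)
Lemma ottaviani n (beta : R) : 0 <= beta -> M0 * beta <= 2^-1 ->
  (forall k, (k <= n)%N -> E (fun x => (u <= `|U G k x|)%R%:R) <= beta) ->
  E (fun x => (max_ge G n (3 * u) x)%:R) <= 2 * beta.
Proof.
move=> beta0 Mb Eb.
have ms t := measurable_max_ge n t mG.
have mU k : measurable [set x | u <= `|U G k x|].
  apply: measurable_ge_norm; apply: (bmeasurable_birkhoff_sum gm k (obs_bounded o)).1.
set H := hit S col (D (3 * u)) n.
apply: (@le_trans _ _ (E (fun x => (H x)%:R))).
  apply: le_expect_bool; [exact: ms|exact: mhit|move=> x /max_geP[k kn ku]].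
  by apply/hasP; exists k; rewrite ?mem_iota//; exact: DI.
pose Q x := H x && ~~ (u <= `|U G n x|).
have mQ : measurable [set x | Q x].
  rewrite (_ : [set _ | _] = [set x | H x] `\` [set x | u <= `|U G n x|]).
    by apply: measurableD; [exact: mhit|exact: mU].
  apply/seteqP; split => x /=; first by move=> /andP[? /negP].
  by move=> [? /negP ?]; apply/andP.
have bH : bm (fun x => (H x)%:R : R) := bmeasurable_bool R (mhit _ _).
have bQ := bmeasurable_bool R mQ.
have bU := bmeasurable_bool R (mU n).
have HQ : E (fun x => (H x)%:R) <= E (fun x => (u <= `|U G n x|)%R%:R) + E (fun x => (Q x)%:R).
  rewrite -expectD//; apply: le_expect => //; first exact: bmeasurableD.
  move=> x; rewrite /Q; case: (H x); case: (u <= _) => //=; lra.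
suff : E (fun x => (Q x)%:R) <= M0 * beta * E (fun x => (H x)%:R).
  have EH : 0 <= E (fun x => (H x)%:R) by exact: expect_ge0.
  have := ler_wpM2r EH Mb; have := Eb n (leqnn n); move: HQ; lra.
apply: (stopping gm (B := fun l x => u <= `|U G (n - l) x|)) => //.
  by move=> l ln; apply: Eb; exact: leq_subr.
move=> x /andP[/hit_first[l ln fl]] nU; exists l => //; split => //.
have := fl; rewrite first_hitP => /andP[/DE h _].
have := birkhoff_sum_add S G l (n - l) x; rewrite subnKC// => Un.
have := ler_normB (U G n x) (U G (n - l) (iter l S x)).
rewrite {1}Un addrK; move: nU; rewrite -ltNge; lra.
Qed.

End Observable.
(** Chebyshev and Ottaviani bound the probability of exceeding 3 u by a multiple
    of n V / u^2, and the Hoffmann-Jorgensen inequality takes the power r of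
    this bound. When n V / u^2 is not small the bound is trivial. *)
Lemma maximal_tail (r : nat) : exists2 C : R, 0 <= C &
  forall G psi m L u, observable G psi m -> (forall a, psi a <= L) ->
    L / (1 - rho) <= u -> (forall x, `|G x| <= u) -> 0 < u ->
  forall n, E (fun x => (max_ge G n (12 * r%:R * u) x)%:R) <=
    C * (n%:R * (m ^+ 2 + E (fun x => G x ^+ 2)) / u ^+ 2) ^+ r.
Proof.
have [C0 C00 mom] := second_moment gm.
exists ((2 * M0 ^+ 2 * C0) ^+ r); first by rewrite exprn_ge0// !mulr_ge0.
move=> G psi m L u o psiL Lu Gu u0 n.
set V := m ^+ 2 + _.
have bG := obs_bounded o; have mG : measurable_fun setT G := bG.1.
have V0 : 0 <= V.
  by rewrite addr_ge0 ?sqr_ge0//; apply: expect_ge0 => x; rewrite sqr_ge0.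
pose beta := C0 * (n%:R * V / u ^+ 2).
have beta0 : 0 <= beta by rewrite mulr_ge0// divr_ge0 ?sqr_ge0// mulr_ge0.
have cheb k : (k <= n)%N -> E (fun x => (u <= `|U G k x|)%R%:R) <= beta.
  move=> kn; have bU := bmeasurable_birkhoff_sum gm k bG.
  have bU2 : bm (fun x => U G k x ^+ 2).
    by under eq_fun do rewrite expr2; exact: bmeasurableM.
  apply: (@le_trans _ _ (E (fun x => u ^- 2 * U G k x ^+ 2))).
    apply: le_expect; [|exact: bmeasurableM|].
      by apply: bmeasurable_bool; apply: measurable_ge_norm; exact: bU.1.
    move=> x; case: (leP u `|U G k x|) => [ux|_]; last first.
      by rewrite mulr_ge0 ?sqr_ge0// invr_ge0 sqr_ge0.
    rewrite mulrC ler_pdivlMr ?exprn_gt0// mul1r -[leRHS]real_normK ?num_real//.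
    by rewrite lerXn2r ?nnegrE ?(ltW u0).
  rewrite expectZ// /beta mulrA mulrC ler_pM2r ?invr_gt0 ?exprn_gt0// mulrA.
  apply: (le_trans (mom _ _ _ o k)); rewrite ler_wpM2r// ler_wpM2l// ler_nat //.
have Q3 : E (fun x => (max_ge G n (3 * u) x)%:R) <= 2 * M0 * beta.
  have [small|big] := leP (M0 * beta) 2^-1.
    apply: (le_trans (ottaviani o psiL Lu beta0 small cheb)).
    by rewrite ler_wpM2r// ler_peMr.
  apply: (@le_trans _ _ 1); last by lra.
  rewrite -[leRHS](expect_cst P); apply: le_expect => //.
    exact: bmeasurable_bool (measurable_max_ge _ _ mG).
  by move=> x; case: (max_ge _ _ _ _).
have u3 : 0 < 3 * u by rewrite mulr_gt0.
have Lu3 : L / (1 - rho) <= 3 * u by apply: (le_trans Lu); lra.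
have Gu3 x : `|G x| <= 3 * u by apply: (le_trans (Gu x)); lra.
have := hoffmann_jorgensen_iter o psiL Lu3 Gu3 u3 n r.
rewrite (_ : r%:R * (4 * (3 * u)) = 12 * r%:R * u); last by ring.
move=> /le_trans; apply.
rewrite -[leLHS]exprMn -[leRHS]exprMn.
rewrite (_ : 2 * M0 ^+ 2 * C0 * (n%:R * V / u ^+ 2) = M0 * (2 * M0 * beta)); last first.
  by rewrite /beta; ring.
have Q0 : 0 <= E (fun x => (max_ge G n (3 * u) x)%:R) by exact: expect_ge0.
have M2b : 0 <= 2 * M0 * beta by apply: mulr_ge0 => //; exact: mulr_ge0.
apply: lerXn2r; rewrite ?nnegrE; [exact: mulr_ge0|exact: mulr_ge0|].
exact: ler_wpM2l.
Qed.

End MaximalTail.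

(** * Combinatorics of the tower *)

Section Tower.
Context (R : realType) (d : measure_display) (X : measurableType d).
Context (mu : probability X R) (A : countType) (h : A -> nat).
Context (Delta : A -> nat -> set X) (T : X -> X) (rho : R).
Hypothesis hT : young_tower mu h Delta T rho.

Let position_ex x : exists ai : A * nat, (ai.2 < h ai.1)%N /\ Delta ai.1 ai.2 x.
Proof. by have [a [i H]] := yt_cover hT x; exists (a, i). Qed.

Definition tower_position x : A * nat := sval (cid (position_ex x)).
Definition column x := (tower_position x).1.
Definition tower_level x := (tower_position x).2.

Lemma positionP x : (tower_level x < h (column x))%N /\ Delta (column x) (tower_level x) x.
Proof. exact: svalP (cid (position_ex x)). Qed.

Lemma position_unique a i x : (i < h a)%N -> Delta a i x ->
  column x = a /\ tower_level x = i.
Proof.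
move=> ia Dx; have [lx Dx'] := positionP x.
have := yt_disjoint hT; move=> /(_ (tower_position x) (a, i) lx ia) H.
have e : tower_position x = (a, i) by apply: H; exists x.
by rewrite /column /tower_level e.
Qed.

Lemma in_Delta a i x : (i < h a)%N -> (Delta a i x <-> tower_position x = (a, i)).
Proof.
move=> ia; split => [Dx|px].
  by have [] := position_unique ia Dx; rewrite /column /tower_level; case: (tower_position x) => ? ? /= -> ->.
by have [_] := positionP x; rewrite /column /tower_level px.
Qed.

Lemma DeltaE a i : (i < h a)%N -> Delta a i = tower_position @^-1` [set (a, i)].
Proof. by move=> ia; apply/seteqP; split => x /(in_Delta _ ia). Qed.

Lemma baseE x : base Delta x <-> tower_level x = 0%N.
Proof.
split => [[a _ Dx]|lx].
  by have [] := position_unique (yt_height_gt0 hT a) Dx.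
by exists (column x) => //; have [_] := positionP x; rewrite lx.
Qed.

Lemma fiber_measurable_position : fiber_measurable tower_position.
Proof.
move=> [a i]; have [ia|ia] := ltnP i (h a).
  by rewrite -DeltaE//; exact: (yt_measurable hT).
rewrite (_ : _ @^-1` _ = set0)//; apply/seteqP; split => // x /= px.
by have [+ _] := positionP x; rewrite /column /tower_level px ltnNge ia.
Qed.

Lemma fiber_measurable_column : fiber_measurable column.
Proof.
move=> a; exact: (fiber_measurable_preimage [set ai | ai.1 = a] fiber_measurable_position).
Qed.

Let mT : measurable_fun setT T := (yt_preserving hT).1.

Lemma measurable_iterT k : measurable_fun setT (iter k T).
Proof.
elim: k => [|k IH]; first exact: measurable_id.
exact: (measurableT_comp mT IH).
Qed.

Lemma measurable_base : measurable (base Delta).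
Proof.
apply: countable_bigcupT_measurable => // a.
exact: yt_measurable hT _ _ (yt_height_gt0 hT a).
Qed.

Lemma step_up x : ((tower_level x).+1 < h (column x))%N ->
  column (T x) = column x /\ tower_level (T x) = (tower_level x).+1.
Proof.
move=> lx; apply: position_unique => //.
have [f _ _] := yt_up hT lx; apply: f.
by have [] := positionP x.
Qed.

Lemma step_top x : (tower_level x).+1 = h (column x) -> tower_level (T x) = 0%N.
Proof.
move=> lx; apply/baseE; have [f _ _] := yt_return hT (column x); apply: f.
by rewrite -lx /=; have [] := positionP x.
Qed.

Definition time_left x := (h (column x) - tower_level x)%N.
(** For a point that is not in the basis this is the first entrance to the
    basis. Being defined everywhere makes the return map a total function, and
    points of the same column share their future words. *)
Definition tower_return x := iter (time_left x) T x.

Lemma time_left_gt0 x : (0 < time_left x)%N.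
Proof. by rewrite subn_gt0; have [] := positionP x. Qed.

Lemma iter_up j x : (j < time_left x)%N ->
  column (iter j T x) = column x /\ tower_level (iter j T x) = (tower_level x + j)%N.
Proof.
elim: j => [|j IH] jx; first by rewrite addn0.
have [c l] := IH (ltnW jx); rewrite iterS.
have [|-> ->] := @step_up (iter j T x); last by rewrite c l addnS.
by rewrite c l -addnS -ltn_subRL.
Qed.

Lemma lev_ret x : tower_level (tower_return x) = 0%N.
Proof.
have t0 := time_left_gt0 x; rewrite /tower_return.
have [c l] := @iter_up (time_left x).-1 x (ltac:(by rewrite prednK)).
rewrite -(prednK t0) iterS; apply: step_top.
rewrite c l -addnS prednK// /time_left subnKC//.
by apply: ltnW; have [] := positionP x.
Qed.

Lemma time_left_up j x : (j < time_left x)%N ->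
  time_left (iter j T x) = (time_left x - j)%N.
Proof. by move=> /iter_up[c l]; rewrite /time_left c l subnDA. Qed.

Lemma ret_up j x : (j < time_left x)%N -> tower_return (iter j T x) = tower_return x.
Proof. by move=> jx; rewrite /tower_return time_left_up// -iterD subnK// ltnW. Qed.

Lemma measurable_ret : measurable_fun setT tower_return.
Proof.
apply: (measurable_piecewise (G := fun ai => iter (h ai.1 - ai.2)%N T)
  fiber_measurable_position) => ai.
exact: measurable_iterT.
Qed.

Local Notation word := (word tower_return column).

Lemma word_up k j x : (j < time_left x)%N -> word k (iter j T x) = word k x.
Proof.
case: k => // k jx; rewrite !wordS ret_up//.
by have [-> _] := iter_up jx.
Qed.

(** Counted in iterations of T. *)
Definition ret_time (k : nat) (x : X) : nat :=
  \sum_(0 <= j < k) time_left (iter j tower_return x).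

Lemma ret_timeS k x : ret_time k.+1 x = (time_left x + ret_time k (tower_return x))%N.
Proof.
rewrite /ret_time big_nat_recl//=; congr addn.
by apply: eq_bigr => j _; rewrite -iterS iterSr.
Qed.

Lemma iter_ret_time k x : iter (ret_time k x) T x = iter k tower_return x.
Proof.
elim: k x => [|k IH] x; first by rewrite /ret_time big_geq.
by rewrite ret_timeS addnC iterD -/(tower_return x) IH -iterSr.
Qed.

Lemma ret_time_mono k l x : (k < l)%N -> (ret_time k x < ret_time l x)%N.
Proof.
elim: l => // l IH; rewrite ltnS leq_eqVlt /ret_time big_nat_recr//= => /orP[/eqP ->|/IH lt].
  by rewrite -addn1 leq_add2l time_left_gt0.
exact: ltn_addr.
Qed.

(** Points of the same level climb together; their words say that they enter the
    same columns. *)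
Lemma position_iter k x y t : tower_level x = tower_level y -> word k.+1 x = word k.+1 y ->
  (t <= ret_time k x)%N -> tower_position (iter t T x) = tower_position (iter t T y).
Proof.
have pE z : tower_position z = (column z, tower_level z) by rewrite /column /tower_level; case: (tower_position z).
elim: k x y t => [|k IH] x y t lxy; rewrite wordS [in RHS]wordS;
  move/eqP; rewrite eqseq_cons => /andP[/eqP cxy /eqP wxy].
  by rewrite /ret_time big_geq// leqn0 => /eqP ->; rewrite /= !pE lxy cxy.
have txy : time_left x = time_left y by rewrite /time_left lxy cxy.
rewrite ret_timeS; have [tx|tx] := ltnP t (time_left x).
  move=> _; rewrite !pE; have [-> ->] := iter_up tx.
  by rewrite txy in tx; have [-> ->] := iter_up tx; rewrite lxy cxy.
rewrite -leq_subLR => tk; rewrite -(subnK tx) !iterD -/(tower_return x) txy -/(tower_return y).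
rewrite -txy; apply: IH => //; by rewrite !lev_ret.
Qed.

Lemma same_eltP x y : tower_position x = tower_position y -> same_elt h Delta x y.
Proof.
move=> pxy; exists (column x), (tower_level x); have [lx Dx] := positionP x; split => //.
by rewrite /column /tower_level pxy; have [] := positionP y.
Qed.

Let rho0 : 0 < rho. Proof. by case/andP: (yt_ratio hT). Qed.
Let rho1 : rho < 1. Proof. by case/andP: (yt_ratio hT). Qed.

(** The first k return times are distinct joint returns of the two points. *)
Lemma tower_dist_word k x y : tower_level x = tower_level y -> word k.+1 x = word k.+1 y ->
  tower_dist h Delta T rho x y <= rho ^+ k.
Proof.
move=> lxy wxy; rewrite /tower_dist; case: asboolP => [fS|_]; last first.
  by rewrite exprn_ge0// ltW.
set J := joint_returns _ _ _ _ _ in fS *.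
apply: ler_wiXn2l; [exact: ltW|exact: ltW|].
have inJ j : (0 < j <= k)%N -> J (ret_time j x).
  move=> /andP[j0 jk]; split.
  - by apply: leq_ltn_trans (ret_time_mono x j0).
  - by apply/baseE; rewrite iter_ret_time -(prednK j0) iterS lev_ret.
  - move=> t tj; apply: same_eltP; apply: (position_iter (k := k)) => //.
    apply: (leq_trans tj); move: jk; rewrite leq_eqVlt => /orP[/eqP -> //|jk].
    exact/ltnW/ret_time_mono.
pose s := [seq ret_time j x | j <- iota 1 k].
have us : uniq s.
  rewrite map_inj_in_uniq ?iota_uniq// => i j _ _ eij.
  by have [/(ret_time_mono x)|/(ret_time_mono x)|//] := ltngtP i j; rewrite eij ltnn.
have <- : size s = k by rewrite size_map size_iota.
apply: uniq_leq_size => // t /mapP[j]; rewrite mem_iota => jk ->.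
by rewrite in_fset_set// inE; apply: inJ; rewrite add1n ltnS in jk.
Qed.

Lemma tower_dist_le1 x y : tower_dist h Delta T rho x y <= 1.
Proof.
rewrite /tower_dist; case: ifP => _; last exact: ler01.
by rewrite exprn_ile1// ltW.
Qed.

Lemma tower_dist_ge0 x y : 0 <= tower_dist h Delta T rho x y.
Proof. by rewrite /tower_dist; case: ifP => // _; rewrite exprn_ge0// ltW. Qed.

End Tower.

(** * The first return map is Gibbs-Markov *)

Section TowerMeasure.
Context (R : realType) (d : measure_display) (X : measurableType d).
Context (mu : probability X R) (A : countType) (h : A -> nat).
Context (Delta : A -> nat -> set X) (T : X -> X) (rho : R).
Hypothesis hT : young_tower mu h Delta T rho.
Local Notation col := (column hT).
Local Notation lev := (tower_level hT).
Local Notation ret := (tower_return hT).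
Local Notation word := (word ret col).

Let mD a i (ia : (i < h a)%N) : measurable (Delta a i) := yt_measurable hT ia.
Let mT : measurable_fun setT T := (yt_preserving hT).1.
Let h0 a : (0 < h a)%N := yt_height_gt0 hT a.
Let mB0 : measurable (base Delta) := measurable_base hT.

Lemma measurable_preT B : measurable B -> measurable (T @^-1` B).
Proof. by move=> mB; rewrite -[X in measurable X]setTI; exact: mT. Qed.

(** The only preimages of a level above the basis lie in the level below, so
    that the invariance of mu amounts to T preserving mu between the two. *)
Lemma mu_level_up a i B : (i.+1 < h a)%N -> measurable B ->
  mu (Delta a i.+1 `&` B) = mu (Delta a i `&` T @^-1` B).
Proof.
move=> ia mB; rewrite -((yt_preserving hT).2 (Delta a i.+1 `&` B)); last first.
  by apply: measurableI => //; exact: mD.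
congr (mu _); apply/seteqP; split => x /= [Dx Bx]; split => //.
  have [ct lt] := position_unique hT ia Dx.
  have [lx Dx'] := positionP hT x.
  have [lx1|lx1] := ltnP (lev x).+1 (h (col x)).
    have [c l] := step_up lx1.
    by move: l; rewrite lt => -[->]; rewrite -ct c.
  have /step_top : (lev x).+1 = h (col x) by apply/eqP; rewrite eqn_leq lx.
  by rewrite lt.
by have [f _ _] := yt_up hT ia; exact: f.
Qed.

Lemma mu_level a i B : (i < h a)%N -> measurable B ->
  mu (Delta a i `&` B) = mu (Delta a 0%N `&` iter i T @^-1` B).
Proof.
elim: i B => // i IH B ia mB; rewrite mu_level_up// IH//.
- exact: ltnW.
- exact: measurable_preT.
Qed.

(** All the levels have at most the measure of the basis, and they cover the
    space. *)
Lemma mu_base_gt0 : (0 < mu (base Delta))%E.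
Proof.
rewrite lt0e measure_ge0 andbT; apply/negP => /eqP mu0.
suff : (mu setT <= mu set0)%E.
  by rewrite measure0 (@probability_setT _ _ _ mu) lee_fin ler10.
apply: (measure_fibers_le (fiber_measurable_position hT)) => //.
move=> [a i]; rewrite setTI set0I measure0.
have [ia|ia] := ltnP i (h a); last first.
  rewrite (_ : _ @^-1` _ = set0) ?measure0//; apply/seteqP; split => // x /= px.
  by have [+ _] := positionP hT x; rewrite /column /tower_level px ltnNge ia.
rewrite -(DeltaE hT ia); have e := mu_level ia measurableT; rewrite setIT in e.
rewrite [X in (X <= _)%E]e.
rewrite -mu0; apply: le_measure; rewrite ?inE//.
  by rewrite preimage_setT setIT; exact: mD.
by move=> x [Dx _]; exists a.
Qed.

Definition base_mass : R := fine (mu (base Delta)).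

Lemma base_massE : (base_mass%:E = mu (base Delta))%E.
Proof. by rewrite fineK// fin_num_measure. Qed.

Lemma base_mass_gt0 : 0 < base_mass.
Proof. by rewrite -lte_fin base_massE mu_base_gt0. Qed.

Definition base_prob : probability X R := mnormalize (mrestr mu mB0) mu.

Lemma base_probE B : (base_prob B = base_mass^-1%:E * mu (base Delta `&` B))%E.
Proof.
rewrite /base_prob /= /mnormalize /= /mrestr setTI -base_massE /=.
by rewrite eqe gt_eqF ?base_mass_gt0//= muleC setIC.
Qed.

Lemma base_mass_prob B : (base_mass%:E * base_prob B = mu (base Delta `&` B))%E.
Proof.
by rewrite base_probE muleA -EFinM divff ?gt_eqF ?base_mass_gt0// mul1e.
Qed.

Let mret_preimage B : measurable B -> measurable (ret @^-1` B).
Proof.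
by move=> mB; rewrite -[X in measurable X]setTI; exact: (measurable_ret hT).
Qed.

Lemma mu_column_ret a B : measurable B ->
  mu (Delta a 0%N `&` ret @^-1` B) = mu (Delta a (h a).-1 `&` T @^-1` B).
Proof.
move=> mB; rewrite [RHS]mu_level; [|by rewrite prednK|exact: measurable_preT].
congr (mu _); apply/seteqP; split => x /= [Dx Bx]; split => //;
  have [ct lt] := position_unique hT (h0 a) Dx;
  move: Bx; rewrite /tower_return /time_left ct lt subn0 -{1 2}(prednK (h0 a)) //.
Qed.

(** The preimage of the basis under T is the union of the top levels, and T
    preserves mu up to there. *)
Lemma mu_ret B : measurable B ->
  mu (base Delta `&` ret @^-1` B) = mu (base Delta `&` B).
Proof.
move=> mB; rewrite -[RHS](yt_preserving hT).2; last exact: measurableI.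
have mBB : measurable (base Delta `&` B) by exact: measurableI.
apply: (measure_fibers_eq (fiber_measurable_column hT)).
- by apply: measurableI => //; exact: mret_preimage.
- exact: measurable_preT.
move=> a; transitivity (mu (Delta a 0%N `&` ret @^-1` B)).
  congr (mu _); apply/seteqP; split => x /=.
    move=> [[/(baseE hT) lx Bx] cx]; split => //.
    by have [_] := positionP hT x; rewrite lx cx.
  move=> [Dx Bx]; have [cx lx] := position_unique hT (h0 a) Dx.
  by split => //; split => //; apply/(baseE hT).
rewrite mu_column_ret//; congr (mu _); apply/seteqP; split => x /=.
  move=> [Dx Bx]; have pa : ((h a).-1 < h a)%N by rewrite prednK.
  have [cx lx] := position_unique hT pa Dx.
  split => //; split => //; apply/(baseE hT); apply: step_top.
  by rewrite lx cx prednK.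
move=> [[/(baseE hT) lT Bx] cx]; split => //.
have [lx Dx] := positionP hT x.
have [lx1|lx1] := ltnP (lev x).+1 (h (col x)).
  by have [_] := step_up lx1; rewrite lT.
have <- : lev x = (h a).-1.
  by rewrite -cx; apply/eqP; rewrite -eqSS prednK ?(leq_ltn_trans _ lx)// eqn_leq lx.
by rewrite -cx.
Qed.

Lemma base_prob_ret B : measurable B -> base_prob (ret @^-1` B) = base_prob B.
Proof. by move=> mB; rewrite !base_probE mu_ret. Qed.

Let rho0 : 0 < rho. Proof. by case/andP: (yt_ratio hT). Qed.
Let rho1 : rho < 1. Proof. by case/andP: (yt_ratio hT). Qed.

Lemma column_base a B :
  base Delta `&` (col @^-1` [set a] `&` B) = Delta a 0%N `&` B.
Proof.
apply/seteqP; split => x /=.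
  move=> [/(baseE hT) lx [cx Bx]]; split => //.
  by have [_] := positionP hT x; rewrite lx cx.
move=> [Dx Bx]; have [cx lx] := position_unique hT (h0 a) Dx.
by split => //; apply/(baseE hT).
Qed.

Lemma image_top a V :
  T @` (Delta a (h a).-1 `&` T @^-1` V) = base Delta `&` V.
Proof.
have [f _ g] := yt_return hT a.
apply/seteqP; split => [_ [x [Dx Vx] <-]|y [By Vy]]; first by split => //; exact: f.
by have [x Dx xy] := g _ By; exists x => //; split => //; rewrite /preimage/= xy.
Qed.

(** As mu is preserved up to the top of the columns, only the last step of a
    column contributes to the jacobian of the return map. It is nearly constant
    on cylinders, with a fluctuation of the order of the distance of the points
    after the return. *)
Lemma tower_gibbs_markov : exists K, gibbs_markov base_prob ret col K rho.
Proof.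
have [J [mJ J0 Jmu] [C Jdist]] := yt_distortion hT.
exists (2 * `|C| / rho); split.
- exact: (measurable_ret hT).
- exact: base_prob_ret.
- exact: (fiber_measurable_column hT).
- by rewrite divr_ge0 ?(ltW rho0)// mulr_ge0.
- exact: (yt_ratio hT).
move=> a v; pose top := Delta a (h a).-1.
have pa : ((h a).-1 < h a)%N by rewrite prednK.
pose W := [set x | word (size v) x = v].
pose delta := `|C| / rho * rho ^+ size v.
have JJ x y : top x -> top y -> W (T x) -> W (T y) -> J x <= expR delta * J y.
  move=> tx ty Wx Wy.
  have se : same_elt h Delta x y by exists a, (h a).-1.
  have lT z : top z -> lev (T z) = 0%N.
    move=> tz; have [cz lz] := position_unique hT pa tz.
    by apply: step_top; rewrite lz cz prednK.
  have dist : tower_dist h Delta T rho (T x) (T y) <= rho^-1 * rho ^+ size v.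
    have [v0|v0] := posnP (size v).
      rewrite v0 expr0 mulr1; apply: (le_trans (tower_dist_le1 hT _ _)).
      by rewrite invf_ge1// ltW.
    rewrite -(prednK v0) exprS mulrA mulVf ?gt_eqF// mul1r.
    apply: (tower_dist_word (hT := hT)); first by rewrite !lT.
    by rewrite prednK// Wx Wy.
  have := Jdist x y se; rewrite !lnV ?posrE// => le.
  have le' : ln (J x) - ln (J y) <= delta.
    have d0 := tower_dist_ge0 hT (T x) (T y).
    apply: (@le_trans _ _ (C * tower_dist h Delta T rho (T x) (T y))).
      by move: le; rewrite ler_norml => /andP[]; lra.
    apply: (le_trans (ler_wpM2r d0 (ler_norm C))).
    by rewrite /delta -mulrA ler_wpM2l.
  rewrite -[J x]lnK ?posrE// -[J y]lnK ?posrE// -expRD ler_expR.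
  by rewrite -lerBlDr.
have Dmu V : measurable V -> measurable (top `&` T @^-1` V) /\
    mu (base Delta `&` V) = (\int[mu]_(x in top `&` T @^-1` V) (J x)%:E)%E.
  move=> mV; have mTV : measurable (top `&` T @^-1` V).
    by apply: measurableI; [exact: mD|exact: measurable_preT].
  split => //; rewrite -(image_top a V).
  by have [] := Jmu a _ _ pa mTV (@subIsetl _ _ _).
have Pcol V : measurable V -> base_prob (col @^-1` [set a] `&` ret @^-1` V) =
    (base_mass^-1%:E * mu (top `&` T @^-1` V))%E.
  by move=> mV; rewrite base_probE column_base mu_column_ret.
have b0 : 0 < base_mass^-1 by rewrite invr_gt0 base_mass_gt0.
have [[y0 [ty0 Wy0]]|ny] := pselect (exists y, top y /\ W (T y)); last first.
  exists 1 => // V mV VW.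
  have e : top `&` T @^-1` V = set0.
    apply/seteqP; split => // x [tx Vx]; apply: ny; exists x; split => //.
    exact: VW.
  rewrite Pcol// base_probE -(image_top a) -/top e image_set0 measure0.
  by rewrite !mule0.
have k0 : 0 < expR (- delta) / J y0 by rewrite divr_gt0 ?expR_gt0.
exists (expR (- delta) / J y0) => // V mV VW.
have [mtV muV] := Dmu V mV.
have fD : mu (top `&` T @^-1` V) \is a fin_num by rewrite fin_num_measure.
have fV : mu (base Delta `&` V) \is a fin_num.
  by rewrite fin_num_measure//; exact: measurableI.
have mJE : measurable_fun (top `&` T @^-1` V) (fun x => (J x)%:E).
  by apply/measurable_EFinP; exact: measurable_funTS.
have JW x : (top `&` T @^-1` V) x -> top x /\ W (T x).
  by move=> [tx Vx]; split => //; exact: VW.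
have up : (mu (base Delta `&` V) <=
    (expR delta * J y0)%:E * mu (top `&` T @^-1` V))%E.
  rewrite muV -integral_cst//; apply: ge0_le_integral => //.
  - by move=> x _; rewrite lee_fin ltW.
  - by move=> x /JW[tx Wx]; rewrite lee_fin; exact: JJ.
have lo : ((expR (- delta) * J y0)%:E * mu (top `&` T @^-1` V) <=
    mu (base Delta `&` V))%E.
  rewrite muV -integral_cst//; apply: ge0_le_integral => //.
  - by move=> x _; rewrite lee_fin mulr_ge0 ?expR_ge0// ltW.
  - move=> x /JW[tx Wx]; rewrite lee_fin expRN mulrC ler_pdivrMr ?expR_gt0//.
    by rewrite mulrC; exact: JJ.
rewrite Pcol// base_probE -(fineK fD) -(fineK fV) in up lo *.
set x := fine (mu (top `&` _)) in up lo *.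
set y := fine (mu (base Delta `&` V)) in up lo *.
rewrite -!EFinM !lee_fin in up lo *.
have eK : expR (2 * `|C| / rho * rho ^+ size v) = expR delta * expR delta.
  by rewrite -expRD; congr expR; rewrite /delta; field; rewrite gt_eqF.
have Jy := J0 y0; have e0 := expR_gt0 delta.
rewrite expRN in k0 lo *; rewrite eK; split.
  rewrite [leLHS](_ : _ = base_mass^-1 * (y / (expR delta * J y0))); last first.
    by field; rewrite !gt_eqF// base_mass_gt0.
  by rewrite ler_wpM2l ?(ltW b0)// ler_pdivrMr ?mulr_gt0// mulrC.
rewrite [leLHS](_ : _ = base_mass^-1 *
    (expR delta / J y0 * ((expR delta)^-1 * J y0 * x))); last first.
  by field; rewrite !gt_eqF// base_mass_gt0.
rewrite [leRHS](_ : _ = base_mass^-1 * (expR delta / J y0 * y)); last first.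
  by field; rewrite !gt_eqF// base_mass_gt0.
by rewrite ler_wpM2l ?(ltW b0)// ler_wpM2l// divr_ge0 ?(ltW e0)// ltW.
Qed.

End TowerMeasure.

(** * The induced observable *)

Section InducedObservable.
Context (R : realType) (d : measure_display) (X : measurableType d).
Context (mu : probability X R) (A : countType) (h : A -> nat).
Context (Delta : A -> nat -> set X) (T : X -> X) (rho : R).
Hypothesis hT : young_tower mu h Delta T rho.
Local Notation col := (column hT).
Local Notation lev := (tower_level hT).
Local Notation position := (tower_position hT).
Local Notation ret := (tower_return hT).
Local Notation word := (word ret col).
Local Notation P := (base_prob hT).
Local Notation E := (expect P).
Local Notation bm := bmeasurable.

Let h0 a : (0 < h a)%N := yt_height_gt0 hT a.

Definition tower_lipschitz (f : X -> R) := (forall x, `|f x| <= 1) /\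
  (forall x y, same_elt h Delta x y -> `|f x - f y| <= tower_dist h Delta T rho x y).

Lemma lip_norm_le1 f : (lip_norm h Delta T rho f <= 1)%E -> tower_lipschitz f.
Proof.
rewrite /lip_norm; set s1 := ereal_sup _; set s2 := ereal_sup _ => le1.
have s20 : (0 <= s2)%E by apply: ereal_sup_ubound; left.
have s1f x : (`|f x|%:E <= s1)%E by apply: ereal_sup_ubound; exists x.
have s10 : (0 <= s1)%E.
  by apply: le_trans (s1f point); rewrite lee_fin.
split.
  move=> x; rewrite -lee_fin; apply: (le_trans (s1f x)).
  by apply: le_trans le1; rewrite leeDl.
move=> x y xy; have [->|nxy] := pselect (x = y).
  by rewrite subrr normr0 (tower_dist_ge0 hT).
have d0 : 0 < tower_dist h Delta T rho x y.
  rewrite lt0r (tower_dist_ge0 hT) andbT; apply/eqP => /(yt_dist hT).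
  exact: nxy.
have : ((`|f x - f y| / tower_dist h Delta T rho x y)%:E <= 1)%E.
  apply: le_trans le1; apply: le_trans (leeDr _ s10).
  by apply: ereal_sup_ubound; right; exists x, y.
by rewrite lee_fin ler_pdivrMr// mul1r.
Qed.

(** The set where f > c is the union of the cylinders it contains, because f
    oscillates by at most rho^k on cylinders of length k + 1. *)
Lemma tower_lipschitz_measurable f : tower_lipschitz f -> measurable_fun setT f.
Proof.
move=> [_ fl]; have [K gm] := tower_gibbs_markov hT.
pose g k x := (position x, word k.+1 x).
have mg k : fiber_measurable (g k).
  apply: fiber_measurable_pair; first exact: fiber_measurable_position.
  exact: (fiber_measurable_word gm).
have /andP[rho0 rho1] := yt_ratio hT.
apply: (@measurability _ _ _ _ _ _ (@RGenOInfty.G R)); first exact: RGenOInfty.measurableE.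
move=> _ [_ [c ->] <-]; rewrite setTI.
rewrite (_ : _ @^-1` _ = \bigcup_k (g k @^-1`
    [set j | forall x, g k x = j -> c < f x])).
  apply: bigcupT_measurable => k; exact: fiber_measurable_preimage.
apply/seteqP; split => [x /=|x [k _ /=]]; last by rewrite in_itv/= andbT; exact.
rewrite in_itv/= andbT => cf.
have : (fun k => rho ^+ k) @ \oo --> (0 : R).
  by apply: cvg_expr; rewrite ger0_norm// ltW.
move=> /cvgrPdist_lt /(_ (f x - c)); rewrite subr_gt0 => /(_ cf)[k _ kP].
exists k => //= y e.
have pxy : position x = position y := esym (congr1 fst e).
have wxy : word k.+1 x = word k.+1 y := esym (congr1 snd e).
have := kP k (leqnn k); rewrite /= sub0r normrN ger0_norm ?exprn_ge0 ?(ltW rho0)// => rk.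
have lxy : lev x = lev y by rewrite /tower_level pxy.
have := fl x y (same_eltP pxy).
have := tower_dist_word lxy wxy.
move=> le1 /(fun le => le_trans le le1); rewrite ler_norml => /andP[_]; lra.
Qed.

Lemma iter_level a i : (i < h a)%N ->
  set_inj (Delta a 0%N) (iter i T) /\ iter i T @` (Delta a 0%N) = Delta a i.
Proof.
elim: i => [|i IH] ia.
  by split => [x y _ _ //|]; rewrite image_id.
have [inj im] := IH (ltnW ia); have [f finj g] := yt_up hT ia.
have iD x : Delta a 0%N x -> Delta a i (iter i T x) by move=> Dx; rewrite -im; exists x.
split.
  move=> x y /[!inE] Dx Dy /= e; apply: inj; rewrite ?inE//.
  by apply: finj => //; rewrite inE; exact: iD.
apply/seteqP; split => [_ [x Dx <-]|y /g[z Dz <-]]; first exact/f/iD.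
by move: Dz; rewrite -im => -[x Dx <-]; exists x.
Qed.

(** The measurability of images comes from the jacobian. *)
Lemma measurable_image_iter a i B : (i < h a)%N -> measurable B ->
  B `<=` Delta a 0%N -> measurable (iter i T @` B).
Proof.
have [J [_ _ JT] _] := yt_distortion hT.
move=> + mB BD; elim: i => [|i IH] ia; first by rewrite image_id.
have ia' := ltnW ia.
rewrite (_ : _ @` B = T @` (iter i T @` B)); last first.
  by rewrite -image_comp.
apply: (JT a i _ ia' (IH ia') _).1.
by rewrite -(iter_level ia').2; exact: image_subset.
Qed.

Let base_point_ex x : exists2 z, Delta (col x) 0%N z & iter (lev x) T z = x.
Proof. by have [lx Dx] := positionP hT x; move: Dx; rewrite -(iter_level lx).2. Qed.

(** Serves to define column sums for all the points of the space, in such a way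
    that they depend only on the future word up to a small error. The cylinders
    of future words contain points of all the levels, not only of the basis. *)
Definition base_point x := sval (cid2 (base_point_ex x)).

Lemma base_pointP x : Delta (col x) 0%N (base_point x) /\
  iter (lev x) T (base_point x) = x.
Proof. by rewrite /base_point; case: cid2. Qed.

Lemma position_base_point x : col (base_point x) = col x /\ lev (base_point x) = 0%N.
Proof. by have [Dx _] := base_pointP x; exact: (position_unique hT (h0 _) Dx). Qed.

Lemma base_point_id x : lev x = 0%N -> base_point x = x.
Proof. by move=> lx; have [_] := base_pointP x; rewrite lx. Qed.

Lemma word_base_point k x : word k (base_point x) = word k x.
Proof.
have [_ <-] := base_pointP x; have [c l] := position_base_point x.
rewrite {1}(base_pointP x).2 word_up// /time_left c l subn0.
by have [] := positionP hT x.
Qed.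

(** Its preimages are unions of images of measurable sets under iterates of T. *)
Lemma measurable_base_point : measurable_fun setT base_point.
Proof.
move=> _ B mB; rewrite setTI.
pose g (ai : A * nat) := if (ai.2 < h ai.1)%N
  then iter ai.2 T @` (B `&` Delta ai.1 0%N) else set0.
rewrite (_ : _ @^-1` B = \bigcup_ai g ai).
  apply: countable_bigcupT_measurable => // -[a i]; rewrite /g /=.
  case: ifPn => // ia; apply: (measurable_image_iter ia) => //.
  by apply: measurableI => //; exact: (yt_measurable hT).
apply/seteqP; split => [x /= Bx|x [[a i] _]].
  have [lx _] := positionP hT x; have [Dx ix] := base_pointP x.
  exists (position x) => //; rewrite /g.
  have -> : ((position x).2 < h (position x).1)%N by exact: lx.
  by exists (base_point x).
rewrite /g/=; case: ifPn => // ia [z [Bz Dz] zx].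
have [inj im] := iter_level ia.
have Dx : Delta a i x by rewrite -im; exists z.
have [cx lx] := position_unique hT ia Dx.
have [] := base_pointP x; rewrite cx lx => Dbx ibx.
rewrite /preimage/=; suff -> : base_point x = z by [].
by apply: inj; rewrite ?inE//= ibx zx.
Qed.

Definition column_height x := h (col x).

Definition column_sum (f : X -> R) x := birkhoff_sum T f (column_height x) (base_point x).

Lemma measurable_column_sum (f : X -> R) : measurable_fun setT f ->
  measurable_fun setT (column_sum f).
Proof.
move=> mf; have mF : measurable_fun setT (fun y => birkhoff_sum T f (column_height y) y).
  apply: (measurable_piecewise (G := fun a y => birkhoff_sum T f (h a) y)
    (fiber_measurable_column hT)) => a.
  rewrite /birkhoff_sum; apply: measurable_sum => i.
  exact: (measurableT_comp mf (measurable_iterT hT i)).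
have := measurableT_comp mF measurable_base_point.
congr measurable_fun; apply/funext => x.
by rewrite /= /column_sum /column_height (position_base_point x).1.
Qed.

Lemma norm_birkhoff_sum_le (f : X -> R) n x : (forall x, `|f x| <= 1) ->
  `|birkhoff_sum T f n x| <= n%:R.
Proof.
move=> f1; rewrite /birkhoff_sum; apply: (le_trans (ler_norm_sum _ _ _)).
apply: (@le_trans _ _ (\sum_(0 <= i < n) 1)); first exact: ler_sum.
by rewrite sumr_const_nat subn0.
Qed.

Lemma column_sum_size f x : tower_lipschitz f -> `|column_sum f x| <= (column_height x)%:R.
Proof. by move=> [f1 _]; exact: norm_birkhoff_sum_le. Qed.

(** Both orbits climb through the same column, at a distance of at most rho^k. *)
Lemma column_sum_variation f k x y : tower_lipschitz f ->
  word k.+1 x = word k.+1 y ->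
  `|column_sum f x - column_sum f y| <= (column_height x)%:R * rho ^+ k.
Proof.
move=> [_ fl] wxy; have := wxy; rewrite wordS [in RHS]wordS => /eqP.
rewrite eqseq_cons => /andP[/eqP cxy _].
rewrite /column_sum /column_height -cxy /birkhoff_sum -sumrB.
apply: (le_trans (ler_norm_sum _ _ _)).
apply: (@le_trans _ _ (\sum_(0 <= i < h (col x)) rho ^+ k)); last first.
  by rewrite sumr_const_nat subn0 mulr_natl.
rewrite !big_nat; apply: ler_sum => i /andP[_ ih].
have [cx lx] := position_base_point x; have [cy ly] := position_base_point y.
have tx : (i < time_left hT (base_point x))%N by rewrite /time_left cx lx subn0.
have ty : (i < time_left hT (base_point y))%N by rewrite /time_left cy ly subn0 -cxy.
have [cix lix] := iter_up tx; have [ciy liy] := iter_up ty.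
have lxy : lev (iter i T (base_point x)) = lev (iter i T (base_point y)).
  by rewrite lix liy lx ly.
have pxy : position (iter i T (base_point x)) = position (iter i T (base_point y)).
  move: cix ciy lxy; rewrite cx cy -cxy /column /tower_level => <-.
  by case: (position _) => ? ?; case: (position _) => ? ? /= -> ->.
apply: (le_trans (fl _ _ (same_eltP pxy))).
by apply: (tower_dist_word lxy); rewrite !word_up// !word_base_point.
Qed.

Definition short (L : R) x : R := ((column_height x)%:R <= L)%R%:R.

(** Serves as the function psi of the induced observable. *)
Definition weight (L : R) (a : A) : R := if (h a)%:R <= L then (h a)%:R else 0.

Lemma weight_ge0 L a : 0 <= weight L a.
Proof. by rewrite /weight; case: ifP. Qed.

Lemma weight_le L a : 0 <= L -> weight L a <= L.
Proof. by move=> L0; rewrite /weight; case: ifP. Qed.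

Lemma bmeasurable_weight L : bm (fun x => weight L (col x)).
Proof.
split; first exact: (fiber_measurable_comp _ (fiber_measurable_column hT)).
exists `|L| => x; rewrite /weight; case: ifP => hL; last by rewrite normr0.
by rewrite ger0_norm// (le_trans hL)// ler_norm.
Qed.

Lemma bmeasurable_short L : bm (short L).
Proof.
apply: bmeasurable_bool.
exact: (fiber_measurable_preimage [set a | (h a)%:R <= L] (fiber_measurable_column hT)).
Qed.

Definition truncated_sum (f : X -> R) L x := short L x * column_sum f x.

Lemma truncated_sum_size f L x : tower_lipschitz f ->
  `|truncated_sum f L x| <= weight L (col x).
Proof.
move=> fl; rewrite /truncated_sum /short /weight -/(column_height x) normrM.
case: ifP => _; last by rewrite normr0 mul0r.
by rewrite normr1 mul1r column_sum_size.
Qed.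

Lemma bmeasurable_truncated_sum f L : tower_lipschitz f -> bm (truncated_sum f L).
Proof.
move=> fl; split.
  apply: measurable_funM; first exact: (bmeasurable_short L).1.
  by apply: measurable_column_sum; exact: tower_lipschitz_measurable.
have [_ [M wM]] := bmeasurable_weight L; exists M => x.
apply: (le_trans (truncated_sum_size L x fl)).
by apply: le_trans (wM x); exact: ler_norm.
Qed.

Definition centered_sum (f : X -> R) L x := truncated_sum f L x - E (truncated_sum f L).

(** The mean of the truncated sum is bounded by that of the weights. *)
Lemma centered_sum_observable f L m : tower_lipschitz f ->
  E (fun x => weight L (col x)) <= m ->
  observable P ret col rho (centered_sum f L) (weight L) m.
Proof.
move=> fl wm; have bF := bmeasurable_truncated_sum L fl.
split.
- exact: bmeasurableB.
- by rewrite /centered_sum expectB// expect_cst subrr.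
- exact: weight_ge0.
- exact: bmeasurable_weight.
- exact: wm.
- move=> x; apply: (le_trans (ler_normB _ _)); apply: lerD.
    exact: truncated_sum_size.
  apply: le_trans wm; apply: (le_trans (expect_norm _ bF)).
  apply: le_expect; [exact: bmeasurable_norm|exact: bmeasurable_weight|].
  by move=> x'; exact: truncated_sum_size.
move=> k x y wxy; rewrite /centered_sum opprB addrA subrK.
have cxy : col x = col y.
  by move: wxy; rewrite !wordS => /eqP; rewrite eqseq_cons => /andP[/eqP].
rewrite /truncated_sum /short /weight /column_height -cxy.
case: ifP => _; last by rewrite !mul0r subrr normr0.
by rewrite !mul1r; exact: column_sum_variation.
Qed.

Lemma centered_sum_le f L x : tower_lipschitz f -> 0 <= L ->
  `|centered_sum f L x| <= 2 * L.
Proof.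
move=> fl L0; have bF := bmeasurable_truncated_sum L fl.
have le y : `|truncated_sum f L y| <= L.
  by apply: (le_trans (truncated_sum_size L y fl)); exact: weight_le.
apply: (le_trans (ler_normB _ _)); rewrite mulr_natl mulr2n lerD//.
apply: (le_trans (expect_norm _ bF)); rewrite -[leRHS](expect_cst P).
by apply: le_expect => //; exact: bmeasurable_norm.
Qed.

Lemma centered_sum_variance f L : tower_lipschitz f ->
  E (fun x => centered_sum f L x ^+ 2) <= E (fun x => weight L (col x) ^+ 2).
Proof.
move=> fl; have bF := bmeasurable_truncated_sum L fl; set c := E (truncated_sum f L).
have bF2 : bm (fun x => truncated_sum f L x ^+ 2).
  by under eq_fun do rewrite expr2; exact: bmeasurableM.
have bw := bmeasurable_weight L.
have bw2 : bm (fun x => weight L (col x) ^+ 2).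
  by under eq_fun do rewrite expr2; exact: bmeasurableM.
have -> : (fun x => centered_sum f L x ^+ 2) =
    (fun x => truncated_sum f L x ^+ 2 + (- (2 * c) * truncated_sum f L x + c ^+ 2)).
  by apply/funext => x; rewrite /centered_sum -/c; ring.
have b1 : bm (fun x => - (2 * c) * truncated_sum f L x) by exact: bmeasurableM.
rewrite expectD//; last exact: bmeasurableD.
rewrite expectD// expect_cst expectZ// -/c.
apply: (@le_trans _ _ (E (fun x => truncated_sum f L x ^+ 2))).
  by have := sqr_ge0 c; lra.
apply: le_expect => // x; rewrite -real_normK ?num_real//.
by rewrite lerXn2r ?nnegrE ?weight_ge0//; exact: truncated_sum_size.
Qed.

End InducedObservable.

(** * From the basis to the tower *)

Section Kac.
Context (R : realType) (d : measure_display) (X : measurableType d).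
Context (mu : probability X R) (A : countType) (h : A -> nat).
Context (Delta : A -> nat -> set X) (T : X -> X) (rho : R).
Hypothesis hT : young_tower mu h Delta T rho.
Local Notation col := (column hT).
Local Notation lev := (tower_level hT).
Local Notation position := (tower_position hT).
Local Notation height := (column_height hT).
Local Notation b := (base_mass mu Delta).
Local Notation P := (base_prob hT).
Local Notation E := (expect P).
Local Notation bm := bmeasurable.

Let h0 a : (0 < h a)%N := yt_height_gt0 hT a.
Let mD a i (ia : (i < h a)%N) : measurable (Delta a i) := yt_measurable hT ia.
Let mB0 : measurable (base Delta) := measurable_base hT.

Lemma ge0_integral_level a i (psi : X -> \bar R) : (i < h a)%N ->
  measurable_fun setT psi -> (forall x, 0 <= psi x)%E ->
  (\int[mu]_(x in Delta a i) psi x =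
   \int[mu]_(x in Delta a 0%N) psi (iter i T x))%E.
Proof.
move=> ia mpsi psi0; have mi := measurable_iterT hT i.
rewrite -(ge0_integral_mrestr mu (mD ia))//.
have := ge0_integral_mrestr mu (mD (h0 a)) (measurableT_comp mpsi mi) (fun x => psi0 _).
move=> <-.
rewrite -[RHS](@ge0_integral_pushforward _ _ _ _ _ _ mi
  (mrestr mu (mD (h0 a))) setT)//.
apply: (@eq_measure_integral _ _ _ _
  (pushforward (mrestr mu (mD (h0 a))) (iter i T) : {measure set X -> \bar R})).
  move=> B mB _; rewrite /= /pushforward /mrestr setIC (mu_level hT ia mB).
  by rewrite setIC.
Qed.

Lemma birkhoff_sum_column (psi : A -> R) x : lev x = 0%N ->
  birkhoff_sum T (fun y => psi (col y)) (height x) x = (height x)%:R * psi (col x).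
Proof.
move=> lx; rewrite /birkhoff_sum big_nat.
rewrite (eq_bigr (fun=> psi (col x))); last first.
  move=> i /andP[_ ih]; have ix : (i < time_left hT x)%N by rewrite /time_left lx subn0.
  by have [-> _] := iter_up ix.
by rewrite -big_nat sumr_const_nat subn0 mulr_natl.
Qed.

Lemma measurable_height_sum (psi : X -> R) : measurable_fun setT psi ->
  measurable_fun setT (fun x => birkhoff_sum T psi (height x) x).
Proof.
move=> mpsi; apply: (measurable_piecewise (G := fun a y => birkhoff_sum T psi (h a) y)
  (fiber_measurable_column hT)) => a.
rewrite /birkhoff_sum; apply: measurable_sum => i.
exact: (measurableT_comp mpsi (measurable_iterT hT i)).
Qed.

(** The integral over the i-th level of a column equals the integral of the i-th
    iterate over its lowest level, since T preserves mu between levels. *)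
Lemma kac (psi : X -> R) : measurable_fun setT psi -> (forall x, 0 <= psi x) ->
  (\int[mu]_x (psi x)%:E =
   \int[mu]_(x in base Delta) (birkhoff_sum T psi (height x) x)%:E)%E.
Proof.
move=> mpsi psi0; have ms := measurable_height_sum mpsi.
have s0 n x : 0 <= birkhoff_sum T psi n x by apply: sumr_ge0.
rewrite [RHS]integral_mkcond.
apply: (ge0_integral_fibers_eq (fiber_measurable_column hT)).
- exact/measurable_EFinP.
- apply/(measurable_restrictT _ mB0); apply: measurable_funTS.
  exact/measurable_EFinP.
- by move=> x; rewrite lee_fin.
- by move=> x; rewrite patchE; case: ifP => // _; rewrite lee_fin.
move=> a; rewrite -integral_mkcondr.
rewrite (_ : _ `&` base Delta = Delta a 0%N); last first.
  by rewrite setIC -[_ @^-1` _]setIT column_base setIT.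
pose F i := position @^-1` [set (a, i)].
rewrite (_ : _ @^-1` [set a] = \big[setU/set0]_(i <- iota 0 (h a)) F i); last first.
  rewrite -bigcup_seq; apply/seteqP; split => [x /= cx|x [i /=]].
    have [lx _] := positionP hT x.
    exists (lev x); first by rewrite /= mem_iota -cx.
    by rewrite /F /= -cx /column /tower_level; case: (position x).
  by rewrite /F /column => _ ->.
rewrite ge0_integral_bigsetU//; first last.
- by move=> x _; rewrite lee_fin.
- by apply: measurable_funTS; exact/measurable_EFinP.
- by move=> i j _ _ [x [pi pj]]; have [] : (a, i) = (a, j) := etrans (esym pi) pj.
- exact: iota_uniq.
- by move=> i; exact: fiber_measurable_position.
transitivity (\int[mu]_(x in Delta a 0%N) \sum_(i <- iota 0 (h a)) (psi (iter i T x))%:E)%E.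
  rewrite ge0_integral_sum//; [|exact: mD| |by move=> i x _; rewrite lee_fin].
  - rewrite big_seq [RHS]big_seq; apply: eq_bigr => i; rewrite mem_iota => ih.
    rewrite -(@ge0_integral_level a i (EFin \o psi))//; last exact/measurable_EFinP.
    by rewrite /F -DeltaE.
  - move=> i; apply: measurable_funTS; apply/measurable_EFinP.
    exact: (measurableT_comp mpsi (measurable_iterT hT i)).
apply: eq_integral => x; rewrite inE => Dx.
have [cx _] := position_unique hT (h0 a) Dx.
by rewrite sumEFin /birkhoff_sum /column_height cx /index_iota subn0.
Qed.

Lemma base_expect g : bm g -> (forall x, 0 <= g x) ->
  ((b * E g)%:E = \int[mu]_(x in base Delta) (g x)%:E)%E.
Proof.
move=> bg g0; have mg : measurable_fun setT (EFin \o g).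
  by apply/measurable_EFinP; case: bg.
have b0 := base_mass_gt0 hT; have bi0 : 0 <= b^-1 by rewrite invr_ge0 ltW.
rewrite EFinM expectE// (@eq_measure_integral _ _ _ setT
  (mscale (NngNum bi0) (mrestr mu mB0))); last first.
  move=> B mB _; have := base_probE hT B; rewrite setIC; exact.
rewrite ge0_integral_mscale//=; last by move=> x _; rewrite lee_fin.
rewrite muleA -EFinM divff ?gt_eqF// mul1e ge0_integral_mrestr//.
Qed.

Lemma kac_expect (psi g : X -> R) : bm psi -> (forall x, 0 <= psi x) ->
  bm g -> (forall x, 0 <= g x) ->
  (forall x, lev x = 0%N -> g x = birkhoff_sum T psi (height x) x) ->
  expect mu psi = b * E g.
Proof.
move=> bpsi psi0 bg g0 gE; apply/EFin_inj.
rewrite expectE// kac//; last by case: bpsi.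
rewrite base_expect//; apply: eq_integral => x; rewrite inE => /(baseE hT) lx.
by rewrite gE.
Qed.

Lemma base_expect_le (f g : X -> R) : bm f -> bm g -> (forall x, 0 <= f x) ->
  (forall x, 0 <= g x) -> (forall x, lev x = 0%N -> f x <= g x) -> E f <= E g.
Proof.
move=> bf bg f0 g0 fg; have b0 := base_mass_gt0 hT.
rewrite -(ler_pM2l b0) -lee_fin !base_expect//.
apply: ge0_le_integral => //.
- by move=> x _; rewrite lee_fin.
- by apply: measurable_funTS; apply/measurable_EFinP; case: bf.
- by apply: measurable_funTS; apply/measurable_EFinP; case: bg.
- by move=> x /(baseE hT) lx; rewrite lee_fin fg.
Qed.

Lemma measurable_height_pred (Q : nat -> bool) : measurable [set x | Q (height x)].
Proof.
exact: (fiber_measurable_preimage [set a | Q (h a)] (fiber_measurable_column hT)).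
Qed.

(** Kac's formula for a function of the height; the bound M makes it a statement
    on bounded functions. *)
Lemma kac_columns (Q : nat -> bool) (M : R) :
  (forall n, Q n -> n%:R <= M) ->
  expect mu (fun x => (Q (height x))%:R) =
  b * E (fun x => (height x)%:R * (Q (height x))%:R).
Proof.
move=> QM; have mQ := measurable_height_pred Q.
apply: kac_expect => //.
- exact: bmeasurable_bool.
- split.
    exact: (fiber_measurable_comp (fun a => (h a)%:R * (Q (h a))%:R : R) (fiber_measurable_column hT)).
  exists `|M| => x; case: (boolP (Q (height x))) => [/QM hM|_]; last first.
    by rewrite mulr0 normr0.
  by rewrite mulr1 ger0_norm// (le_trans hM)// ler_norm.
- move=> x lx; exact/esym/(birkhoff_sum_column (fun a => (Q (h a))%:R : R) lx).
Qed.

Lemma expect_weight L : b * E (fun x => weight h L (col x)) = expect mu (short hT L).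
Proof.
rewrite /short (@kac_columns (fun n => n%:R <= L) L)//; congr (_ * expect _ _).
by apply/funext => x; rewrite /weight -/(height x); case: ifP; rewrite ?mulr1 ?mulr0.
Qed.

Lemma expect_weight_le L : E (fun x => weight h L (col x)) <= b^-1.
Proof.
have b0 := base_mass_gt0 hT.
rewrite -(ler_pM2l b0) mulfV ?gt_eqF// expect_weight -[leRHS](expect_cst mu).
apply: le_expect; [exact: bmeasurable_short|by []|].
by move=> x; rewrite /short; case: (_ <= L).
Qed.

(** By Kac's formula the mean of the truncated sum is the integral of f over the
    short columns, that is, minus its integral over the tall ones. *)
Lemma truncated_sum_mean f L : tower_lipschitz h Delta T rho f ->
  (\int[mu]_x (f x)%:E = 0)%E ->
  b * `|E (truncated_sum hT f L)| <= expect mu (fun x => 1 - short hT L x).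
Proof.
move=> fl f0; have b0 := base_mass_gt0 hT.
have bf : bm f by split; [exact: (tower_lipschitz_measurable hT fl)|exists 1; exact: fl.1].
have bs := bmeasurable_short hT L; have bF := bmeasurable_truncated_sum hT L fl.
have bw := bmeasurable_weight hT L.
have bfs : bm (fun x => f x * short hT L x) by exact: bmeasurableM.
have k : expect mu (fun x => f x * short hT L x + short hT L x) =
    b * E (fun x => truncated_sum hT f L x + weight h L (col x)).
  have F0 x : 0 <= truncated_sum hT f L x + weight h L (col x).
    rewrite -lerBlDr sub0r lerNl; apply: le_trans (truncated_sum_size hT L x fl).
    by rewrite -normrN ler_norm.
  apply: kac_expect => //.
  - exact: bmeasurableD.
  - move=> x; rewrite -[X in _ + X]mul1r -mulrDl; apply: mulr_ge0; last exact: ler0n.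
    rewrite -lerBlDr sub0r lerNl; apply: le_trans (fl.1 x).
    by rewrite -normrN ler_norm.
  - exact: bmeasurableD.
  - move=> x lx; rewrite /birkhoff_sum big_split/=; congr (_ + _).
      rewrite /truncated_sum /column_sum base_point_id// /birkhoff_sum mulr_sumr.
      rewrite !big_nat; apply: eq_bigr => i /andP[_ ih].
      rewrite mulrC /short /column_height.
      have ix : (i < time_left hT x)%N by rewrite /time_left lx subn0.
      by have [-> _] := iter_up ix.
    have := birkhoff_sum_column (fun a => ((h a)%:R <= L)%R%:R : R) lx.
    rewrite {1}/birkhoff_sum => ->.
    by rewrite /weight -/(height x); case: ifP; rewrite ?mulr1 ?mulr0.
move: k; rewrite expectD// expectD// mulrDr expect_weight => /addIr k.
have e : expect mu (fun x => f x * (1 - short hT L x)) = - (b * E (truncated_sum hT f L)).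
  rewrite -k -[RHS]add0r -[X in _ = X + _](_ : expect mu f = 0); last first.
    by apply: EFin_inj; rewrite expectE.
  rewrite -expectB//; congr expect; apply/funext => x; ring.
rewrite -[X in X * _](gtr0_norm b0) -normrM -normrN -e.
have b1s : bm (fun x => 1 - short hT L x) by exact: bmeasurableB.
apply: (le_trans (expect_norm _ _)); first exact: bmeasurableM.
apply: le_expect => //.
  by apply: bmeasurable_norm; exact: bmeasurableM.
have s1 x : 0 <= 1 - short hT L x by rewrite subr_ge0 /short; case: (_ <= L).
by move=> x; rewrite normrM (ger0_norm (s1 x)) ler_piMl//; exact: fl.1.
Qed.

End Kac.

(** * Moments by dyadic decomposition *)

Section Dyadic.
Context (R : realType).
Implicit Types p q t M : R.

Lemma powR_dyadic k (s : R) : (2 ^+ k) `^ s = (2 `^ s) ^+ k.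
Proof.
by rewrite -[in LHS]powR_mulrn// -powRrM mulrC powRrM powR_mulrn// powR_ge0.
Qed.

(** The p-th moment between t and 2^N t of a tail s^(-q), estimated scale by
    scale. *)
Definition dyadic_sum p q N t : R :=
  \sum_(0 <= k < N) (2 * (2 ^+ k * t)) `^ p * (2 ^+ k * t) `^ (- q).

Lemma powR_subN t p q : 0 < t -> t `^ p * t `^ (- q) = t `^ (p - q).
Proof. by move=> t0; rewrite -powRD//; apply/implyP => _; rewrite gt_eqF. Qed.

Lemma dyadic_sumE p q N t : 0 < t ->
  dyadic_sum p q N t =
  2 `^ p * t `^ (p - q) * \sum_(0 <= k < N) (2 `^ (p - q)) ^+ k.
Proof.
move=> t0; rewrite /dyadic_sum mulr_sumr; apply: eq_bigr => k _.
have k0 : 0 < 2 ^+ k * t by rewrite mulr_gt0// exprn_gt0.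
rewrite powRM// ?(ltW k0)// -mulrA powR_subN// powRM ?(ltW t0) ?exprn_ge0//.
by rewrite powR_dyadic; ring.
Qed.

Lemma sum_geom_le (r : R) N : 0 < r < 1 -> \sum_(0 <= k < N) r ^+ k <= (1 - r)^-1.
Proof.
move=> /andP[r0 r1]; have r10 : 0 < 1 - r by rewrite subr_gt0.
rewrite -[leRHS]mul1r ler_pdivlMr//.
suff -> : (\sum_(0 <= k < N) r ^+ k) * (1 - r) = 1 - r ^+ N.
  by rewrite lerBlDr lerDl exprn_ge0// ltW.
elim: N => [|N IH]; first by rewrite big_geq// mul0r expr0 subrr.
by rewrite big_nat_recr//= mulrDl IH exprS; ring.
Qed.

Lemma sum_geom_ge (r : R) N : 1 < r -> \sum_(0 <= k < N) r ^+ k <= r ^+ N / (r - 1).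
Proof.
move=> r1; have r10 : 0 < r - 1 by rewrite subr_gt0.
rewrite ler_pdivlMr//.
suff -> : (\sum_(0 <= k < N) r ^+ k) * (r - 1) = r ^+ N - 1.
  by rewrite lerBlDr lerDl.
elim: N => [|N IH]; first by rewrite big_geq// mul0r expr0 subrr.
by rewrite big_nat_recr//= mulrDl IH exprS; ring.
Qed.

Lemma powR2_gt1 (s : R) : 0 < s -> 1 < 2 `^ s.
Proof.
move=> s0; have := @gt0_ltr_powR R s s0 1 2; rewrite !nnegrE /= powR1.
by apply => //; rewrite ltr1n.
Qed.

Lemma powR2_lt1 (s : R) : s < 0 -> 0 < 2 `^ s < 1.
Proof.
move=> s0; rewrite powR_gt0//= -[s]opprK powRN invf_lt1 ?powR_gt0//.
by rewrite powR2_gt1// oppr_gt0.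
Qed.

Lemma dyadic_sum_lt p q : p < q -> exists2 C, 0 <= C &
  forall N t, 0 < t -> dyadic_sum p q N t <= C * t `^ (p - q).
Proof.
move=> pq; have /powR2_lt1 r01 : p - q < 0 by rewrite subr_lt0.
have /andP[r0 r1] := r01.
exists (2 `^ p * (1 - 2 `^ (p - q))^-1).
  by rewrite mulr_ge0 ?powR_ge0// invr_ge0 subr_ge0 ltW.
move=> N t t0; rewrite dyadic_sumE// mulrAC.
by rewrite ler_wpM2r ?powR_ge0// ler_wpM2l ?powR_ge0// sum_geom_le.
Qed.

(** Up to a constant, the p-th moment above t of a variable bounded by M whose
    tail is s^(-q). *)
Definition moment_size p q t M : R :=
  if p < q then t `^ (p - q)
  else if p == q then 1 + ln (M / t) else M `^ (p - q).

Lemma dyadic_sum_le p q : exists2 C, 0 <= C &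
  forall N t M, 0 < t -> t <= M -> 2 ^+ N * t <= 2 * M ->
    dyadic_sum p q N t <= C * moment_size p q t M.
Proof.
rewrite /moment_size; have [pq|qp|pq] := ltgtP p q.
- by have [C C0 H] := dyadic_sum_lt pq; exists C => // N t M t0 _ _; exact: H.
- have r1 : 1 < 2 `^ (p - q) by rewrite powR2_gt1// subr_gt0.
  have r10 : 0 < 2 `^ (p - q) - 1 by rewrite subr_gt0.
  exists (2 `^ p * 2 `^ (p - q) / (2 `^ (p - q) - 1)).
    by rewrite mulr_ge0 ?mulr_ge0 ?powR_ge0// invr_ge0 ltW.
  move=> N t M t0 tM NM; have M0 : 0 < M := lt_le_trans t0 tM.
  rewrite dyadic_sumE//.
  apply: le_trans (ler_wpM2l _ (sum_geom_ge N r1)) _.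
    by rewrite mulr_ge0 ?powR_ge0.
  rewrite -powR_dyadic.
  rewrite [leLHS](_ : _ = 2 `^ p / (2 `^ (p - q) - 1) *
    ((2 ^+ N) `^ (p - q) * t `^ (p - q))); last by ring.
  rewrite -powRM ?exprn_ge0 ?(ltW t0)//.
  rewrite [leRHS](_ : _ = 2 `^ p / (2 `^ (p - q) - 1) *
    (2 `^ (p - q) * M `^ (p - q))); last by ring.
  rewrite -powRM ?(ltW M0)// ler_wpM2l ?divr_ge0 ?powR_ge0 ?(ltW r10)//.
  apply: ge0_ler_powR => //; rewrite ?nnegrE ?subr_ge0 ?(ltW qp)//.
    by rewrite mulr_ge0 ?exprn_ge0// ltW.
  by rewrite mulr_ge0// ltW.
- have l2 : 0 < ln 2 :> R by rewrite ln_gt0// ltr1n.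
  exists (2 `^ p * (1 + (ln 2)^-1)).
    by rewrite mulr_ge0 ?powR_ge0// addr_ge0// invr_ge0 ltW.
  move=> N t M t0 tM NM; have M0 : 0 < M := lt_le_trans t0 tM.
  rewrite dyadic_sumE// -pq subrr powRr0 mulr1.
  under eq_bigr do rewrite powRr0 expr1n.
  rewrite sumr_const_nat subn0 -mulrA ler_wpM2l ?powR_ge0//.
  have lM : 0 <= ln (M / t) by rewrite ln_ge0// ler_pdivlMr// mul1r.
  have NL : N%:R * ln 2 <= ln 2 + ln (M / t).
    rewrite mulr_natl -lnXn// -lnM ?posrE ?divr_gt0// ler_ln ?posrE ?exprn_gt0//; last first.
      by rewrite mulr_gt0 ?divr_gt0.
    by rewrite mulrA ler_pdivlMr.
  have : N%:R <= 1 + ln (M / t) / ln 2.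
    by rewrite -(ler_pM2r l2) mulrDl mul1r divfK ?gt_eqF.
  have i2 : 0 <= (ln 2)^-1 :> R by rewrite invr_ge0 ltW.
  move=> /le_trans; apply.
  rewrite mulrDl mul1r mulrDr mulr1 [_^-1 * _]mulrC.
  by rewrite -addrA lerD2l; have := lM; have := i2; lra.
Qed.

Lemma exists_dyadic t M : 0 < t -> t <= M ->
  exists N, M < 2 ^+ N * t /\ 2 ^+ N * t <= 2 * M.
Proof.
move=> t0 tM.
have ex : exists N, M < 2 ^+ N * t.
  exists (Num.truncn (M / t)).+1; rewrite -ltr_pdivrMr//.
  apply: (@lt_le_trans _ _ (Num.truncn (M / t)).+1%:R).
    by rewrite -truncn_lt_nat// divr_ge0 ?(ltW t0)// (le_trans (ltW t0)).
  by rewrite -natrX ler_nat ltnW// ltn_expl.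
exists (ex_minn ex); case: ex_minnP => N MN Nmin; split => //.
case: N MN Nmin => [|N] MN Nmin; first by move: MN; rewrite mul1r ltNge tM.
rewrite exprS -mulrA ler_pM2l// leNgt; apply/negP => /Nmin.
by rewrite ltnn.
Qed.

Lemma dyadic_bound p t y N : 0 < p -> 0 < t -> 0 <= y -> y < 2 ^+ N * t ->
  (t <= y)%R%:R * y `^ p <=
  \sum_(0 <= k < N) (2 * (2 ^+ k * t)) `^ p * ((2 ^+ k * t <= y)%R)%:R.
Proof.
move=> p0 t0 y0; elim: N => [|N IH] yN.
  by move: yN; rewrite expr0 mul1r ltNge => /negbTE ->; rewrite mul0r big_geq.
have s0 n : 0 <= \sum_(0 <= k < n) (2 * (2 ^+ k * t)) `^ p * ((2 ^+ k * t <= y)%R)%:R.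
  by apply: sumr_ge0 => k _; rewrite mulr_ge0 ?powR_ge0.
rewrite big_nat_recr//=; have [Ny|yN'] := leP (2 ^+ N * t) y; last first.
  by rewrite mulr0 addr0 IH.
rewrite mulr1; apply: (@le_trans _ _ (y `^ p)).
  by rewrite ler_piMl ?powR_ge0//; case: (t <= y).
apply: (@le_trans _ _ ((2 * (2 ^+ N * t)) `^ p)); last by rewrite lerDr.
apply: ge0_ler_powR; rewrite ?nnegrE ?(ltW p0)//.
  by rewrite !mulr_ge0 ?exprn_ge0// ltW.
by rewrite mulrA -exprS ltW.
Qed.

Section Moment.
Context (d : measure_display) (X : measurableType d) (P : probability X R).
Local Notation E := (expect P).

Lemma measurable_ge (Y : X -> R) (s : R) : measurable_fun setT Y ->
  measurable [set x | s <= Y x].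
Proof.
move=> mY; rewrite (_ : [set _ | _] = Y @^-1` `[s, +oo[); last first.
  by apply/seteqP; split => x /=; rewrite in_itv/= andbT.
by rewrite -[X in measurable X]setTI; exact: mY.
Qed.

Lemma bmeasurable_powR (Y : X -> R) (M p : R) : measurable_fun setT Y ->
  0 <= p -> (forall x, 0 <= Y x <= M) -> bmeasurable (fun x => Y x `^ p).
Proof.
move=> mY p0 YM; split.
  exact: (measurableT_comp (measurable_powR p) mY).
exists (M `^ p) => x; have /andP[Y0 Yle] := YM x.
rewrite ger0_norm ?powR_ge0//; apply: ge0_ler_powR; rewrite ?nnegrE//.
exact: le_trans Yle.
Qed.

Lemma dyadic_expect (Y : X -> R) (M p t : R) N : measurable_fun setT Y ->
  0 < p -> 0 < t -> (forall x, 0 <= Y x <= M) -> M < 2 ^+ N * t ->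
  E (fun x => (t <= Y x)%R%:R * Y x `^ p) <=
  \sum_(0 <= k < N) (2 * (2 ^+ k * t)) `^ p * E (fun x => (2 ^+ k * t <= Y x)%R%:R).
Proof.
move=> mY p0 t0 YM MN.
have bY := bmeasurable_powR mY (ltW p0) YM.
have bi s : bmeasurable (fun x => (s <= Y x)%R%:R : R).
  by apply: bmeasurable_bool; exact: measurable_ge.
apply: (@le_trans _ _ (E (fun x => \sum_(0 <= k < N)
    (2 * (2 ^+ k * t)) `^ p * ((2 ^+ k * t <= Y x)%R)%:R))).
  apply: le_expect.
  - exact: bmeasurableM.
  - by apply: bmeasurable_sum => k; exact: bmeasurableM.
  move=> x; have /andP[Y0 Yle] := YM x.
  by apply: dyadic_bound => //; exact: le_lt_trans MN.
elim: N {MN} => [|N IH].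
  rewrite big_geq// -[leRHS](expect_cst P) le_eqVlt; apply/orP; left.
  by apply/eqP; congr expect; apply/funext => x; rewrite big_geq.
rewrite big_nat_recr//= -expectZ//.
under eq_fun do rewrite big_nat_recr//=.
rewrite expectD; first by rewrite lerD2r.
  by apply: bmeasurable_sum => k; exact: bmeasurableM.
exact: bmeasurableM.
Qed.

(** Each scale 2^k t contributes (2^(k+1) t)^p times the probability of
    exceeding it; the scales stop at M. As p < s the second term of the tail is
    dominated by the smallest scale. *)
Lemma truncated_moment p q s : 0 < p -> p < s -> exists2 C, 0 <= C &
  forall (Y : X -> R) (M t a c : R), measurable_fun setT Y ->
    (forall x, 0 <= Y x <= M) -> 0 < t -> t <= M -> 0 <= a -> 0 <= c ->
    (forall z, t <= z ->
      E (fun x => (z <= Y x)%R%:R) <= a * z `^ (- q) + c * z `^ (- s)) ->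
  E (fun x => Y x `^ p) <=
    t `^ p + C * (a * moment_size p q t M + c * t `^ (p - s)).
Proof.
move=> p0 ps; have [C1 C10 H1] := dyadic_sum_le p q.
have [C2 C20 H2] := dyadic_sum_lt ps.
exists (C1 + C2); first exact: addr_ge0.
move=> Y M t a c mY YM t0 tM a0 c0 tl.
have [N [MN NM]] := exists_dyadic t0 tM.
have bY := bmeasurable_powR mY (ltW p0) YM.
have bi z : bmeasurable (fun x => (z <= Y x)%R%:R : R).
  by apply: bmeasurable_bool; exact: measurable_ge.
apply: (@le_trans _ _ (t `^ p + E (fun x => (t <= Y x)%R%:R * Y x `^ p))).
  rewrite -[X in X + _](expect_cst P) -expectD//; last exact: bmeasurableM.
  apply: le_expect => //.
    by apply: bmeasurableD => //; exact: bmeasurableM.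
  move=> x; have [tY|Yt] := leP t (Y x); first by rewrite mul1r lerDr powR_ge0.
  rewrite mul0r addr0; have /andP[Y0 _] := YM x.
  by apply: ge0_ler_powR; rewrite ?nnegrE ?(ltW p0) ?(ltW t0)// ltW.
rewrite lerD2l; apply: (le_trans (dyadic_expect mY p0 t0 YM MN)).
have d1 := H1 N t M t0 tM NM; have d2 := H2 N t t0.
have d10 : 0 <= dyadic_sum p q N t.
  by apply: sumr_ge0 => k _; rewrite mulr_ge0 ?powR_ge0.
have d20 : 0 <= dyadic_sum p s N t.
  by apply: sumr_ge0 => k _; rewrite mulr_ge0 ?powR_ge0.
apply: (@le_trans _ _ (a * dyadic_sum p q N t + c * dyadic_sum p s N t)).
  rewrite /dyadic_sum !mulr_sumr -big_split/=; apply: ler_sum => k _.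
  have tk : t <= 2 ^+ k * t by rewrite ler_peMl ?(ltW t0)// exprn_ege1// ler1n.
  apply: (le_trans (ler_wpM2l (powR_ge0 _ _) (tl _ tk))).
  by apply: le_of_eq; ring.
have m0 : 0 <= moment_size p q t M.
  rewrite /moment_size; case: ifP => _; first exact: powR_ge0.
  case: ifP => _; last exact: powR_ge0.
  by rewrite addr_ge0// ln_ge0// ler_pdivlMr// mul1r.
rewrite mulrDr; apply: lerD.
  rewrite mulrCA; apply: ler_wpM2l => //; apply: (le_trans d1).
  by rewrite ler_wpM2r// lerDl.
rewrite mulrCA; apply: ler_wpM2l => //; apply: (le_trans d2).
by rewrite ler_wpM2r ?powR_ge0// lerDr.
Qed.

End Moment.
End Dyadic.

(** * Polynomial tails *)

Section Tails.
Context (R : realType) (d : measure_display) (X : measurableType d).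
Context (mu : probability X R) (A : countType) (h : A -> nat).
Context (Delta : A -> nat -> set X) (T : X -> X) (rho q : R).
Hypothesis hT : young_tower mu h Delta T rho.
Hypothesis hq : 1 < q.
Hypothesis htail : (tail mu h Delta : nat -> R^o) =O_\oo
             (fun n : nat => n%:R `^ (- q) : R^o).
Local Notation col := (column hT).
Local Notation height := (column_height hT).
Local Notation b := (base_mass mu Delta).
Local Notation P := (base_prob hT).
Local Notation E := (expect P).

Let b0 : 0 < b := base_mass_gt0 hT.
Let q0 : 0 < q := lt_trans ltr01 hq.

Lemma le1_powRN (x : R) : 0 < x -> x <= 1 -> 1 <= x `^ (- q).
Proof.
move=> x0 x1; rewrite powRN invf_ge1 ?powR_gt0//.
have := @ge0_ler_powR R q (ltW q0) x 1; rewrite !nnegrE powR1.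
by apply => //; exact: ltW.
Qed.

Lemma return_timeE x : base Delta x -> return_time h Delta x = height x.
Proof.
move=> Bx; have lx := (baseE hT x).1 Bx.
rewrite /return_time; case: xgetP => [n _ [a Dx ->]|ne].
  by have [<- _] := position_unique hT (yt_height_gt0 hT a) Dx.
exfalso; apply: (ne (height x)); exists (col x) => //.
by have [_] := positionP hT x; rewrite lx.
Qed.

Lemma tailE n : tail mu h Delta n = b * E (fun x => (n <= height x)%N%:R).
Proof.
apply: EFin_inj; have mh := measurable_height_pred hT (fun m => n <= m)%N.
have e : [set x | base Delta x /\ (n <= return_time h Delta x)%N] =
    base Delta `&` [set x | (n <= height x)%N].
  apply/seteqP; split => x /= [Bx]; first by rewrite return_timeE.
  by move=> ?; split => //; rewrite return_timeE.
rewrite /tail e fineK; last first.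
  by rewrite fin_num_measure//; apply: measurableI => //; exact: measurable_base hT.
by rewrite EFinM expect_bool// base_mass_prob.
Qed.

Lemma base_mass_le1 : b <= 1.
Proof.
rewrite -lee_fin (base_massE hT); apply: probability_le1.
exact: measurable_base hT.
Qed.

Lemma expect_bool_le1 d' (Y : measurableType d') (Q : probability Y R) (c : Y -> bool) :
  measurable [set x | c x] -> expect Q (fun x => (c x)%:R) <= 1.
Proof.
move=> mc; rewrite -[leRHS](expect_cst Q); apply: le_expect => //.
  exact: bmeasurable_bool.
by move=> x; case: (c x).
Qed.

(** The finitely many terms which the asymptotic bound does not control are at
    most 1. *)
Lemma tail_polynomial : exists2 K : R, 0 <= K &
  forall n, (0 < n)%N -> tail mu h Delta n <= K * n%:R `^ (- q).
Proof.
have [k k0 [N _ kN]] := (eqO_exP _ _ _).1 htail.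
exists (k + (N.+1)%:R `^ q); first by rewrite addr_ge0 ?powR_ge0// ltW.
move=> n n0; have nR0 : 0 < n%:R :> R by rewrite ltr0n.
have [Nn|nN] := leqP N n.
  have := kN n Nn; rewrite /= (ger0_norm (powR_ge0 _ _)) => le.
  apply: (le_trans (ler_norm _)); apply: (le_trans le).
  by rewrite ler_wpM2r ?powR_ge0// lerDl powR_ge0.
apply: (@le_trans _ _ 1).
  rewrite tailE mulr_ile1 ?(ltW b0) ?base_mass_le1 ?expect_ge0//.
  by apply: expect_bool_le1; exact: (measurable_height_pred hT (fun m => n <= m)%N).
apply: (@le_trans _ _ ((N.+1)%:R `^ q * n%:R `^ (- q))); last first.
  by rewrite ler_wpM2r ?powR_ge0// lerDr ltW.
rewrite powRN ler_pdivlMr ?powR_gt0// mul1r.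
apply: ge0_ler_powR; rewrite ?nnegrE ?(ltW q0)//.
by rewrite ler_nat ltnW// ltnW.
Qed.

Lemma measurable_height_ge (L : R) : measurable [set x | (L <= (height x)%:R)%R].
Proof. exact: (measurable_height_pred hT (fun m => (L <= m%:R)%R)). Qed.

Lemma height_tail : exists2 K : R, 0 <= K &
  forall L, 0 < L -> E (fun x => (L <= (height x)%:R)%R%:R) <= K * L `^ (- q).
Proof.
have [K K0 tK] := tail_polynomial.
exists (K * 2 `^ q / b + 1); first by rewrite addr_ge0// divr_ge0 ?(ltW b0)// mulr_ge0 ?powR_ge0.
move=> L L0; have mh := measurable_height_ge.
have p0 := powR_ge0 L (- q).
have [L1|L1] := ltP L 1.
  apply: (le_trans (expect_bool_le1 P (mh L))).
  apply: (le_trans (le1_powRN L0 (ltW L1))); rewrite ler_peMl// lerDr.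
  by rewrite divr_ge0 ?(ltW b0)// mulr_ge0 ?powR_ge0.
set n := Num.truncn L.
have n0 : (0 < n)%N by rewrite truncn_gt0.
have /andP[nL Ln] := truncn_itv (ltW L0).
have Ln2 : L <= 2 * n%:R.
  apply: (le_trans (ltW Ln)); rewrite -natr1 mulr_natl mulr2n lerD2l.
  by rewrite ler1n.
apply: (@le_trans _ _ (K * 2 `^ q / b * L `^ (- q))); last first.
  by rewrite ler_wpM2r// lerDl.
apply: (@le_trans _ _ (E (fun x => (n <= height x)%N%:R))).
  apply: le_expect_bool => //; first exact: (measurable_height_pred hT (fun m => n <= m)%N).
  by move=> x Lx; rewrite -(ler_nat R) (le_trans nL).
rewrite -(ler_pM2l b0) -tailE; apply: (le_trans (tK n n0)).
rewrite [leRHS](_ : _ = K * (2 `^ q * L `^ (- q))); last first.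
  by field; rewrite gt_eqF.
rewrite ler_wpM2l// !powRN ler_pdivlMr ?powR_gt0// mulrC ler_pdivrMr ?powR_gt0//; last first.
  by rewrite ltr0n.
rewrite -powRM//; apply: ge0_ler_powR; rewrite ?nnegrE ?(ltW q0) ?(ltW L0)//.
Qed.

(** By Kac's formula this is the integral of the height over the tall columns,
    and a dyadic decomposition of the heights applies. The columns lower than
    2^N L are treated first; then N tends to infinity. *)
Lemma tall_columns : exists2 C : R, 0 <= C &
  forall L, 0 < L -> expect mu (fun x => (L <= (height x)%:R)%R%:R) <= C * L `^ (1 - q).
Proof.
have [K K0 tK] := height_tail.
have [C C0 dC] := dyadic_sum_lt hq.
exists (b * (K * C)); first by rewrite !mulr_ge0// ltW.
move=> L L0; set B := _ * _.
have mh := measurable_height_ge.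
pose F N := [set x | (L <= (height x)%:R < 2 ^+ N * L)%R].
have mF N : measurable (F N) := measurable_height_pred hT (fun m => (L <= m%:R < 2 ^+ N * L)%R).
have bound N : (mu (F N) <= B%:E)%E.
  have := expect_bool mu (b := fun x => (L <= (height x)%:R < 2 ^+ N * L)%R) (mF N).
  rewrite -/(F N) => <-; rewrite lee_fin.
  rewrite (kac_columns hT (Q := fun m => (L <= m%:R < 2 ^+ N * L)%R) (M := 2 ^+ N * L)); last first.
    by move=> n /andP[_ /ltW].
  rewrite /B -!mulrA ler_wpM2l ?(ltW b0)//.
  have NL0 : 0 < 2 ^+ N * L by rewrite mulr_gt0 ?exprn_gt0.
  pose Y x : R := if (height x)%:R < 2 ^+ N * L then (height x)%:R else 0.
  have mY : measurable_fun setT Y.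
    exact: (fiber_measurable_comp (fun a => if (h a)%:R < 2 ^+ N * L then (h a)%:R else 0 : R)
      (fiber_measurable_column hT)).
  have YM x : 0 <= Y x <= 2 ^+ N * L.
    by rewrite /Y; case: ifP => [/ltW -> //|_]; rewrite ?ler0n// lexx ltW.
  have Yh x : Y x <= (height x)%:R by rewrite /Y; case: ifP.
  have NN : 2 ^+ N * L < 2 ^+ N.+1 * L by rewrite ltr_pM2r// exprS ltr_pMl ?exprn_gt0// ltr1n.
  have := dyadic_expect P mY ltr01 L0 YM NN.
  rewrite (_ : (fun x => _ * Y x `^ 1) =
     (fun x => (height x)%:R * (L <= (height x)%:R < 2 ^+ N * L)%R%:R)); last first.
    apply/funext => x; have /andP[Y0 _] := YM x; rewrite powRr1// /Y.
    case: ifP => _; first by rewrite andbT mulrC.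
    by rewrite andbF !mulr0.
  move=> /le_trans; apply.
  apply: (@le_trans _ _ (K * dyadic_sum 1 q N.+1 L)); last by rewrite ler_wpM2l// dC.
  rewrite /dyadic_sum mulr_sumr; apply: ler_sum => k _.
  rewrite [leRHS]mulrCA ler_wpM2l ?powR_ge0//.
  apply: le_trans (tK _ _); last by rewrite mulr_gt0// exprn_gt0.
  apply: le_expect_bool => //; first exact: measurable_ge.
  by move=> x /le_trans; apply.
have FT : [set x | (L <= (height x)%:R)%R] = \bigcup_N F N.
  apply/seteqP; split => x /=; last by move=> [N _ /andP[]].
  move=> Lx; have [N [xN _]] := exists_dyadic L0 Lx.
  by exists N => //; rewrite /F /= Lx xN.
have mono : {homo F : n m / (n <= m)%N >-> (n <= m)%O}.
  move=> n m nm; apply/subsetPset => x /andP[Lx xn]; apply/andP; split => //.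
  by apply: (lt_le_trans xn); rewrite ler_pM2r// ler_weXn2l// ler1n.
have cv := @nondecreasing_cvg_mu _ _ _ mu F mF (bigcupT_measurable _ mF) mono.
rewrite -lee_fin expect_bool// FT -(cvg_lim (@ereal_hausdorff R) cv).
apply: lime_le; first by apply/cvg_ex; exists (mu (\bigcup_n F n)).
by apply: nearW.
Qed.

End Tails.

(** * The deviation inequality on the basis *)

Section TowerTail.
Context (R : realType) (d : measure_display) (X : measurableType d).
Context (mu : probability X R) (A : countType) (h : A -> nat).
Context (Delta : A -> nat -> set X) (T : X -> X) (rho q : R).
Hypothesis hT : young_tower mu h Delta T rho.
Hypothesis hq : 1 < q.
Hypothesis htail : (tail mu h Delta : nat -> R^o) =O_\oo
             (fun n : nat => n%:R `^ (- q) : R^o).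
Local Notation col := (column hT).
Local Notation lev := (tower_level hT).
Local Notation ret := (tower_return hT).
Local Notation height := (column_height hT).
Local Notation b := (base_mass mu Delta).
Local Notation P := (base_prob hT).
Local Notation E := (expect P).
Local Notation bm := bmeasurable.

Let b0 : 0 < b := base_mass_gt0 hT.

(** The term 1 serves to dominate constants. *)
Definition variance_size (t : R) : R := 1 + E (fun x => weight h t (col x) ^+ 2).

Lemma bmeasurable_weight_sqr (L : R) : bm (fun x => weight h L (col x) ^+ 2).
Proof.
have bw := bmeasurable_weight hT L.
by under eq_fun do rewrite expr2; exact: bmeasurableM.
Qed.

Lemma variance_size_ge1 t : 1 <= variance_size t.
Proof. by rewrite lerDl expect_ge0// => x; rewrite sqr_ge0. Qed.

Lemma variance_size_mono s t : s <= t -> variance_size s <= variance_size t.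
Proof.
move=> st; rewrite lerD2l; apply: le_expect; [exact: bmeasurable_weight_sqr..|move=> x].
rewrite lerXn2r ?nnegrE ?weight_ge0// /weight; case: ifP => [hs|_].
  by rewrite (le_trans hs st).
by case: ifP.
Qed.

Lemma variance_size_le : exists2 C : R, 0 <= C &
  forall L, 1 <= L -> variance_size L <= C * (1 + moment_size 2 q 1 L).
Proof.
have [K K0 tK] := height_tail hT hq htail.
have [C C0 H] := truncated_moment P q (ltr0n R 2) (ltr_nat R 2 3).
exists (2 + C * K); first by rewrite addr_ge0// mulr_ge0.
move=> L L1; have L0 : 0 < L := lt_le_trans ltr01 L1.
have ms : 0 <= moment_size 2 q 1 L.
  rewrite /moment_size; case: ifP => _; first exact: powR_ge0.
  by case: ifP => _; [rewrite addr_ge0// divr1 ln_ge0|exact: powR_ge0].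
have := H (fun x => weight h L (col x)) L 1 K 0 (bmeasurable_weight hT L).1.
move=> /(_ _ ltr01 L1 K0 (lexx 0) _) le.
have {le} le : E (fun x => weight h L (col x) `^ 2) <=
    1 `^ 2 + C * (K * moment_size 2 q 1 L + 0 * 1 `^ (2 - 3)).
  apply: le => [x|z z1]; first by rewrite weight_ge0 weight_le// ltW.
  rewrite mul0r addr0; apply: le_trans (tK z (lt_le_trans ltr01 z1)).
  apply: le_expect_bool.
  - by apply: measurable_ge; exact: (bmeasurable_weight hT L).1.
  - exact: measurable_height_ge.
  - move=> x /le_trans; apply; rewrite /weight; case: ifP => //.
have e : (fun x => weight h L (col x) ^+ 2) = (fun x => weight h L (col x) `^ 2).
  by apply/funext => x; rewrite powR_mulrn// weight_ge0.
rewrite powR1 mul0r addr0 -e in le.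
have CK : 0 <= C * K by exact: mulr_ge0.
apply: (le_trans (_ : _ <= 1 + (1 + C * (K * moment_size 2 q 1 L)))); first by rewrite lerD2l.
by rewrite mulrDl mulrDr mulr1; lra.
Qed.

(** Cut the orbit segment at its returns to the basis: it consists of complete
    columns and of a last one that is left before the top. *)
Lemma block_decomposition (f : X -> R) m x : (forall x, `|f x| <= 1) -> lev x = 0%N ->
  exists2 k, (k <= m)%N &
    `|birkhoff_sum T f m x - birkhoff_sum ret (column_sum hT f) k x|
      <= (height (iter k ret x))%:R.
Proof.
move=> f1; have [n mn] := ubnP m; elim: n m x mn => // n IH m x mn lx.
have [hm|hm] := leqP (height x) m; last first.
  exists 0%N => //; rewrite birkhoff_sum0 subr0.
  by apply: (le_trans (norm_birkhoff_sum_le T _ _ f1)); rewrite ler_nat ltnW.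
have h0 : (0 < height x)%N by exact: yt_height_gt0 hT _.
have rE : ret x = iter (height x) T x by rewrite /tower_return /time_left lx subn0.
have mn' : (m - height x < n)%N.
  by apply: leq_trans (_ : m <= n)%N => //; rewrite ltn_subrL h0 (leq_trans h0).
have [k km le] := IH (m - height x)%N (ret x) mn' (lev_ret hT x).
exists k.+1.
  by rewrite -(subnKC hm) -add1n leq_add.
rewrite iterSr -(subnKC hm) birkhoff_sum_add -rE.
rewrite -[k.+1]add1n birkhoff_sum_add birkhoff_sumS birkhoff_sum0 add0r.
rewrite [iter 0 _ _]/= [iter 1 _ _]/= {1}/column_sum base_point_id//.
by rewrite opprD addrACA subrr add0r.
Qed.

Lemma measurable_max_birkhoff (f : X -> R) n t : measurable_fun setT f ->
  measurable [set x | max_ge T f n t x].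
Proof.
move=> mf; apply: measurable_has => l; apply: measurable_ge_norm.
rewrite /birkhoff_sum; apply: measurable_sum => i.
exact: (measurableT_comp mf (measurable_iterT hT i)).
Qed.

(** The two competing ways of making a large deviation: one tall column, or the
    accumulation of moderate ones. *)
Definition tail_size (r n : nat) (t : R) : R :=
  n%:R * t `^ (- q) + (n%:R * variance_size t / t ^+ 2) ^+ r.

Lemma tail_size_ge n t r : 0 < t -> n%:R * t `^ (- q) <= tail_size r n t.
Proof.
move=> t0; rewrite lerDl exprn_ge0// divr_ge0 ?sqr_ge0// mulr_ge0//.
exact: le_trans (variance_size_ge1 t).
Qed.

Lemma powR_1B (t : R) : 0 < t -> t `^ (1 - q) = t * t `^ (- q).
Proof. by move=> t0; rewrite -powR_subN// powRr1// ltW. Qed.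

(** Truncate at L = ka t with ka small. If none of the first n + 1 columns is
    higher than L, a sum of f over at most n iterates larger than t forces a sum
    of the centred truncated observable larger than t / 4: the incomplete column
    contributes at most L, and the centring at most n |c|. Up to a factor, c is
    the integral of f over the tall columns, of order t^(1-q). So n |c| <= t / 2
    as soon as n t^(-q) is small enough; otherwise the bound is trivial. *)
Lemma base_max_tail r : (0 < r)%N -> exists2 C : R, 0 <= C &
  forall f, tower_lipschitz h Delta T rho f -> (\int[mu]_x (f x)%:E = 0)%E ->
  forall n, (0 < n)%N -> forall t, 0 < t ->
    E (fun x => (max_ge T f n t x)%:R) <= C * tail_size r n t.
Proof.
move=> r0; have [K0 gm] := tower_gibbs_markov hT.
have [Cr Cr0 maxT] := maximal_tail gm r.
have [C1 C10 tall] := tall_columns hT hq htail.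
have [K K_ge0 hK] := height_tail hT hq htail.
have /andP[rho0 rho1] := yt_ratio hT.
have rho10 : 0 < 1 - rho by rewrite subr_gt0.
have rR : 1 <= r%:R :> R by rewrite ler1n.
have rR0 : 0 < r%:R :> R := lt_le_trans ltr01 rR.
(* so that L / (1 - rho) and 2 L are at most u = t / (48 r), and 12 r u = t / 4 *)
pose ka : R := (1 - rho) / (96 * r%:R).
have ka0 : 0 < ka by rewrite divr_gt0// mulr_gt0.
have ka1 : ka <= 96^-1.
  rewrite /ka ler_pdivrMr ?mulr_gt0// mulKf// (le_trans _ rR)//; lra.
pose C2 := C1 / b * ka `^ (1 - q).
have C20 : 0 <= C2 by rewrite mulr_ge0 ?powR_ge0// divr_ge0// ltW.
pose C3 := 2 * (K * ka `^ (- q)).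
have C30 : 0 <= C3 by rewrite !mulr_ge0// powR_ge0.
pose C4 := (b^-1 ^+ 2 + 1) * (48 * r%:R) ^+ 2.
have C40 : 0 <= C4 by rewrite mulr_ge0 ?sqr_ge0// addr_ge0// sqr_ge0.
exists (2 * C2 + C3 + Cr * C4 ^+ r).
  apply: addr_ge0; first by apply: addr_ge0 => //; exact: mulr_ge0.
  by apply: mulr_ge0 => //; exact: exprn_ge0.
move=> f fl f0 n n0 t t0.
have mf := tower_lipschitz_measurable hT fl.
have mM := measurable_max_birkhoff n t mf.
have tq := powR_ge0 t (- q).
have ntq : 0 <= n%:R * t `^ (- q) by rewrite mulr_ge0.
have ts := tail_size_ge n r t0.
have CC : 0 <= C3 + Cr * C4 ^+ r.
  by apply: addr_ge0 => //; apply: mulr_ge0 => //; exact: exprn_ge0.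
have ts0 : 0 <= tail_size r n t := le_trans ntq ts.
(* the trivial case: the centring alone could produce the deviation *)
have [big|small] := ltP 1 (2 * C2 * (n%:R * t `^ (- q))).
  apply: (le_trans (expect_bool_le1 P mM)); apply: (le_trans (ltW big)).
  apply: (@le_trans _ _ (2 * C2 * tail_size r n t)).
    by apply: ler_wpM2l => //; exact: mulr_ge0.
  by apply: ler_wpM2r => //; rewrite -addrA lerDl.
pose L := ka * t; have L0 : 0 < L by rewrite mulr_gt0.
pose u := t / (48 * r%:R); have u0 : 0 < u by rewrite divr_gt0// mulr_gt0.
pose c := E (truncated_sum hT f L).
have Lt : L <= t / 96 by rewrite /L mulrC ler_pM2l.
have Lu : L / (1 - rho) <= u.
  rewrite /L /ka /u [leLHS](_ : _ = 2^-1 * (t / (48 * r%:R))); last first.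
    by field; rewrite !gt_eqF.
  by have : 0 < t / (48 * r%:R) := u0; lra.
have L2u : 2 * L <= u.
  apply: le_trans (_ : (1 - rho) * u <= u); last first.
    by rewrite ler_piMl ?(ltW u0)// lerBlDr lerDl ltW.
  apply: le_of_eq.
  by rewrite /L /ka /u; field; rewrite gt_eqF.
have cb : `|c| <= C2 * (t * t `^ (- q)).
  have := truncated_sum_mean hT L fl f0; rewrite -/c -ler_pdivlMl// => /le_trans; apply.
  rewrite [leRHS](_ : _ = b^-1 * (C1 * L `^ (1 - q))); last first.
    by rewrite /C2 /L powRM ?(ltW t0) ?(ltW ka0)// (powR_1B t0); ring.
  rewrite ler_wpM2l ?invr_ge0 ?(ltW b0)//; apply: le_trans (tall L L0).
  apply: le_expect.
  - by apply: bmeasurableB => //; exact: bmeasurable_short.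
  - by apply: bmeasurable_bool; exact: measurable_height_ge.
  - move=> x; rewrite /short; have [hL|hL] := leP (height x)%:R L.
      by rewrite subrr ler0n.
    by rewrite subr0 (ltW hL).
have nc : n%:R * `|c| <= t / 2.
  apply: (le_trans (ler_wpM2l (ler0n _ n) cb)).
  rewrite [leLHS](_ : _ = t / 2 * (2 * C2 * (n%:R * t `^ (- q)))); last by field.
  by rewrite ler_piMr// divr_ge0// ltW.
pose G := centered_sum hT f L.
have o : observable P ret col rho G (weight h L) b^-1.
  exact: (centered_sum_observable fl (expect_weight_le hT L)).
have G2 x : `|G x| <= u by apply: le_trans L2u; exact: (centered_sum_le hT x fl (ltW L0)).
have psiL a : weight h L a <= L by apply: weight_le; exact: ltW.
have := maxT G _ _ _ u o psiL Lu G2 u0 n.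
have -> : 12 * r%:R * u = t / 4 by rewrite /u; field; rewrite gt_eqF.
have V : b^-1 ^+ 2 + E (fun x => G x ^+ 2) <= (b^-1 ^+ 2 + 1) * variance_size t.
  have le1 : E (fun x => G x ^+ 2) <= variance_size t.
    apply: (le_trans (centered_sum_variance hT L fl)).
    apply: (le_trans (_ : _ <= variance_size L)); first by rewrite lerDr.
    by apply: variance_size_mono; apply: (le_trans Lt); have := t0; lra.
  rewrite mulrDl mul1r lerD// ler_peMr ?sqr_ge0//.
  exact: variance_size_ge1.
have EG : 0 <= b^-1 ^+ 2 + E (fun x => G x ^+ 2).
  by rewrite addr_ge0 ?sqr_ge0// expect_ge0// => x; rewrite sqr_ge0.
have v1 : 0 <= variance_size t by exact: le_trans (variance_size_ge1 t).
have cmp : n%:R * (b^-1 ^+ 2 + E (fun x => G x ^+ 2)) / u ^+ 2 <=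
    C4 * (n%:R * variance_size t / t ^+ 2).
  rewrite [leRHS](_ : _ = n%:R * ((b^-1 ^+ 2 + 1) * variance_size t) / u ^+ 2); last first.
    by rewrite /C4 /u; field; rewrite !gt_eqF.
  by rewrite ler_wpM2r ?invr_ge0 ?sqr_ge0// ler_wpM2l.
move=> E1.
have {}E1 : E (fun x => (max_ge ret G n (t / 4) x)%:R) <=
    Cr * (C4 ^+ r * (n%:R * variance_size t / t ^+ 2) ^+ r).
  apply: (le_trans E1); rewrite ler_wpM2l// -exprMn lerXn2r ?nnegrE//.
    by rewrite divr_ge0 ?sqr_ge0// mulr_ge0.
  by rewrite mulr_ge0// divr_ge0 ?sqr_ge0// mulr_ge0.
pose bad x := has (fun j => (L <= (height (iter j ret x))%:R)%R) (iota 0 n.+1).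
have mbad1 j : measurable [set x | (L <= (height (iter j ret x))%:R)%R].
  exact: (preimage_iter_measurable gm j (measurable_height_ge hT L)).
have mbad : measurable [set x | bad x] by exact: measurable_has.
have bbad1 j : bm (fun x => ((L <= (height (iter j ret x))%:R)%R)%:R : R).
  exact: bmeasurable_bool.
have E2 : E (fun x => (bad x)%:R) <= C3 * (n%:R * t `^ (- q)).
  apply: (@le_trans _ _ (E (fun x => \sum_(0 <= j < n.+1)
      ((L <= (height (iter j ret x))%:R)%R)%:R))).
    apply: le_expect; [exact: bmeasurable_bool|exact: bmeasurable_sum|].
    move=> x; rewrite /bad; case: hasP => [[j jn Lj]|_]; last exact: sumr_ge0.
    by rewrite (bigD1_seq j) ?iota_uniq//= ?Lj ?lerDl ?sumr_ge0// /index_iota subn0.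
  rewrite expect_sum//.
  apply: (@le_trans _ _ (\sum_(0 <= j < n.+1) K * L `^ (- q))).
    apply: ler_sum => j _; apply: le_trans (hK L L0).
    apply: le_of_eq.
    apply: (expect_iter gm j (g := fun x => ((L <= (height x)%:R)%R)%:R)).
    by apply: bmeasurable_bool; exact: measurable_height_ge.
  rewrite sumr_const_nat subn0 -[leLHS]mulr_natl /L powRM ?(ltW ka0) ?(ltW t0)//.
  have n2 : (n.+1)%:R <= 2 * n%:R :> R.
    by rewrite -natrM ler_nat mul2n -addnn -addn1 leq_add2l.
  rewrite [leRHS](_ : _ = 2 * n%:R * (K * (ka `^ (- q) * t `^ (- q)))); last first.
    by rewrite /C3; ring.
  by rewrite ler_wpM2r// !mulr_ge0// powR_ge0.
have mG : measurable_fun setT G by case: (obs_bounded o).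
have mMG := measurable_max_ge gm n (t / 4) mG.
have bMG := bmeasurable_bool R mMG.
have bbad := bmeasurable_bool R mbad.
have cover : E (fun x => (max_ge T f n t x)%:R) <=
    E (fun x => (bad x)%:R + (max_ge ret G n (t / 4) x)%:R).
  apply: base_expect_le => //.
  - exact: bmeasurable_bool.
  - exact: bmeasurableD.
  move=> x lx; case: max_geP => [[m mn tm]|_]; last by rewrite addr_ge0.
  have [nb|nb] := boolP (bad x); first by rewrite lerDl.
  have good j : (j <= n)%N -> (height (iter j ret x))%:R <= L.
    move=> jn; rewrite leNgt; apply: contra nb => /ltW Lj; apply/hasP.
    by exists j => //; rewrite mem_iota.
  rewrite add0r; case: max_geP => // nM; case: nM.
  have [k km le] := block_decomposition m fl.1 lx.
  have kn := leq_trans km mn.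
  exists k => //.
  have UE : birkhoff_sum ret (column_sum hT f) k x = birkhoff_sum ret G k x + k%:R * c.
    have -> : k%:R * c = \sum_(0 <= j < k) c by rewrite sumr_const_nat subn0 mulr_natl.
    rewrite /birkhoff_sum -big_split/=.
    rewrite !big_nat; apply: eq_bigr => j /andP[_ jk].
    rewrite /G /centered_sum -/c subrK /truncated_sum /short good ?mul1r//.
    exact: leq_trans (ltnW jk) kn.
  rewrite UE in le; have hk := good k kn.
  have kc : `|k%:R * c| <= t / 2.
    rewrite normrM ger0_norm//; apply: le_trans nc; rewrite ler_wpM2r// ler_nat//.
  set Um := birkhoff_sum T f m x in tm le; set Uk := birkhoff_sum ret G k x in le *.
  have t1 := ler_normD (Um - (Uk + k%:R * c)) (Uk + k%:R * c).
  rewrite subrK in t1; have t2 := ler_normD Uk (k%:R * c).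
  by have := t0; lra.
apply: (le_trans cover); rewrite expectD//.
apply: (le_trans (lerD E2 E1)).
apply: (@le_trans _ _ ((C3 + Cr * C4 ^+ r) * tail_size r n t)).
  rewrite [leRHS]mulrDl; apply: lerD; first exact: ler_wpM2l.
  rewrite mulrA; apply: ler_wpM2l; first by apply: mulr_ge0 => //; exact: exprn_ge0.
  by rewrite lerDr.
by apply: ler_wpM2r => //; rewrite -addrA lerDr mulr_ge0.
Qed.

End TowerTail.

(** * The deviation inequality on the tower *)

Section TowerTailAll.
Context (R : realType) (d : measure_display) (X : measurableType d).
Context (mu : probability X R) (A : countType) (h : A -> nat).
Context (Delta : A -> nat -> set X) (T : X -> X) (rho q : R).
Hypothesis hT : young_tower mu h Delta T rho.
Hypothesis hq : 1 < q.
Hypothesis htail : (tail mu h Delta : nat -> R^o) =O_\oo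
             (fun n : nat => n%:R `^ (- q) : R^o).
Local Notation col := (column hT).
Local Notation ret := (tower_return hT).
Local Notation height := (column_height hT).
Local Notation b := (base_mass mu Delta).
Local Notation P := (base_prob hT).
Local Notation E := (expect P).
Local Notation bm := bmeasurable.

Let b0 : 0 < b := base_mass_gt0 hT.
Let mB0 : measurable (base Delta) := measurable_base hT.

Lemma measurable_height : measurable_fun setT (fun x => (height x)%:R : R).
Proof.
exact: (fiber_measurable_comp (fun a => (h a)%:R : R) (fiber_measurable_column hT)).
Qed.

Lemma integral_height : (\int[mu]_(x in base Delta) ((height x)%:R : R)%:E = 1)%E.
Proof.
transitivity (\int[mu]_x ((fun=> 1 : R) x)%:E)%E; last first.
  by rewrite -expectE// expect_cst.
rewrite (kac hT (psi := fun=> 1 : R))//; apply: eq_integral => x _.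
by rewrite /birkhoff_sum sumr_const_nat subn0.
Qed.

(** By quasi-independence, column by column; the mean height is 1 with respect
    to mu. *)
Lemma height_future : exists2 D : R, 0 <= D &
  forall (B : X -> bool), measurable [set x | B x] ->
  (\int[mu]_(x in base Delta) ((height x)%:R * (B (ret x))%:R)%:E
   <= (D * E (fun x => (B x)%:R))%:E)%E.
Proof.
have [K gm] := tower_gibbs_markov hT.
pose D := quasi_const K rho; have D0 : 0 <= D := le_trans ler01 (quasi_const_ge1 gm).
exists D => // B mB; have bB := bmeasurable_bool R mB.
have EB : 0 <= E (fun x => (B x)%:R) by exact: expect_ge0.
have mBr : measurable [set x | B (ret x)] := preimage_iter_measurable gm 1 mB.
have bBr := bmeasurable_bool R mBr.
have mf : measurable_fun setT (fun x => (height x)%:R * (B (ret x))%:R : R).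
  by apply: measurable_funM; [exact: measurable_height|case: bBr].
have mg : measurable_fun setT (fun x => D * E (fun x => (B x)%:R) * (height x)%:R : R).
  by apply: measurable_funM => //; exact: measurable_height.
apply: (@le_trans _ _ (\int[mu]_(x in base Delta)
    (D * E (fun x => (B x)%:R) * (height x)%:R)%:E)%E); last first.
  under eq_integral do rewrite EFinM.
  rewrite ge0_integralZl//.
  - by rewrite integral_height mule1.
  - by apply: measurable_funTS; apply/measurable_EFinP; exact: measurable_height.
  - by rewrite lee_fin mulr_ge0.
rewrite integral_mkcond [leRHS]integral_mkcond.
apply: (ge0_integral_fibers_le (fiber_measurable_column hT)).
- apply/(measurable_restrictT _ mB0); apply: measurable_funTS.
  exact/measurable_EFinP.
- apply/(measurable_restrictT _ mB0); apply: measurable_funTS.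
  exact/measurable_EFinP.
- by move=> x; rewrite patchE; case: ifP => // _; rewrite lee_fin mulr_ge0.
- by move=> x; rewrite patchE; case: ifP => // _; rewrite lee_fin !mulr_ge0.
move=> a; rewrite -!integral_mkcondr setIC !integral_mkcondr.
have bc := bmeasurable_cyl gm [:: a].
have cE x : cyl R ret col [:: a] x = (col x == a)%:R.
  by rewrite /cyl /= /word /= eqseq_cons andbT.
have loc (g : X -> R) : bm g -> (forall x, 0 <= g x) ->
    (\int[mu]_(x in base Delta) ((fun x => ((height x)%:R * g x)%:E) \_ (col @^-1` [set a])) x =
     (b * ((h a)%:R * E (fun x => cyl R ret col [:: a] x * g x)))%:E)%E.
  move=> bg g0; rewrite -expectZ; last exact: bmeasurableM.
  rewrite base_expect; first last.
  - by move=> x; rewrite !mulr_ge0// cyl_ge0.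
  - by apply: bmeasurableM => //; exact: bmeasurableM.
  apply: eq_integral => x _; rewrite patchE cE.
  case: ifPn; rewrite ?inE ?notin_setE/=.
    by move=> ca; rewrite ca eqxx mul1r /column_height ca.
  by move=> /eqP/negbTE ->; rewrite mul0r mulr0.
have -> : (fun x => (D * E (fun x => (B x)%:R) * (height x)%:R)%:E) =
    (fun x => ((height x)%:R * (D * E (fun x => (B x)%:R)))%:E).
  by apply/funext => x; rewrite mulrC.
rewrite (loc _ bBr)// loc//; last by move=> x; rewrite mulr_ge0.
rewrite lee_fin ler_wpM2l ?(ltW b0)// ler_wpM2l//.
have [+ _] := quasi_independence gm [:: a] bB (fun x => ler0n _ _).
move=> /le_trans; apply; apply: le_of_eq.
transitivity (E (fun x => D * E (fun x => (B x)%:R) * cyl R ret col [:: a] x)).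
  by rewrite expectZ// -/(quasi_const K rho) -/D; ring.
by congr expect; apply/funext => x; rewrite mulrC.
Qed.

Lemma measurable_birkhoff (f : X -> R) n : measurable_fun setT f ->
  measurable_fun setT (birkhoff_sum T f n).
Proof.
move=> mf; rewrite /birkhoff_sum; apply: measurable_sum => i.
exact: (measurableT_comp mf (measurable_iterT hT i)).
Qed.

Lemma tail_size_half r n t : 0 < t -> tail_size q hT r n (t / 2) <=
  (2 `^ q + 4 ^+ r) * tail_size q hT r n t.
Proof.
move=> t0; have h0 : 0 < t / 2 by rewrite divr_gt0.
have v1 s : 0 <= variance_size hT s by apply: le_trans (variance_size_ge1 hT s).
have e1 : (t / 2) `^ (- q) = 2 `^ q * t `^ (- q).
  by rewrite powRM ?(ltW t0)// -powR_inv1// -powRrM mulN1r opprK mulrC.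
have e2 : n%:R * variance_size hT (t / 2) / (t / 2) ^+ 2 <=
    4 * (n%:R * variance_size hT t / t ^+ 2).
  rewrite [leRHS](_ : _ = n%:R * variance_size hT t / (t / 2) ^+ 2); last first.
    by field; rewrite gt_eqF.
  rewrite ler_wpM2r ?invr_ge0 ?sqr_ge0// ler_wpM2l// variance_size_mono//.
  by have := t0; lra.
rewrite /tail_size e1.
set y := n%:R * t `^ (- q); set z := (n%:R * variance_size hT t / t ^+ 2) ^+ r.
have y0 : 0 <= y by rewrite mulr_ge0// powR_ge0.
have z0 : 0 <= z by rewrite exprn_ge0// divr_ge0 ?sqr_ge0// mulr_ge0.
have le : (n%:R * variance_size hT (t / 2) / (t / 2) ^+ 2) ^+ r <= 4 ^+ r * z.
  rewrite -exprMn lerXn2r ?nnegrE//.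
    by rewrite divr_ge0 ?sqr_ge0// mulr_ge0.
  by rewrite mulr_ge0// divr_ge0 ?sqr_ge0// mulr_ge0.
have p2 := powR_ge0 2 q.
have p4 : 0 <= (4 : R) ^+ r by rewrite exprn_ge0.
rewrite mulrCA -/y; apply: (le_trans (lerD (lexx _) le)).
rewrite -subr_ge0 (_ : _ - _ = 2 `^ q * z + 4 ^+ r * y); last by ring.
by apply: addr_ge0; exact: mulr_ge0.
Qed.

(** If the sum from a point of level i of a column is larger than t, either the
    column is higher than t / 2, or the maximal sum after the return to the
    basis is larger than t / 2. Kac multiplies the probabilities by the height.
    The first event then becomes the mass of the tall columns, and in the second
    one the height is integrated out by quasi-independence. Since |S_n f| <= n
    only t <= n matters, hence t^(1-q) <= n t^(-q). *)
Lemma tower_tail r : (0 < r)%N -> exists2 C : R, 0 <= C &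
  forall f, tower_lipschitz h Delta T rho f -> (\int[mu]_x (f x)%:E = 0)%E ->
  forall n, (0 < n)%N -> forall t, 0 < t ->
    expect mu (fun x => (t <= `|birkhoff_sum T f n x|)%R%:R) <=
    C * tail_size q hT r n t.
Proof.
move=> r0; have [C0 C00 base_tail] := base_max_tail hT hq htail r0.
have [C1 C10 tall] := tall_columns hT hq htail.
have [D D0 fut] := height_future.
have CD : 0 <= (C1 + D * C0) * (2 `^ q + 4 ^+ r).
  apply: mulr_ge0; last by rewrite addr_ge0 ?powR_ge0// exprn_ge0.
  by apply: addr_ge0 => //; exact: mulr_ge0.
exists ((C1 + D * C0) * (2 `^ q + 4 ^+ r)) => //.
move=> f fl f0 n n0 t t0.
have mf := tower_lipschitz_measurable hT fl.
have mS : measurable [set x | (t <= `|birkhoff_sum T f n x|)%R].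
  by apply: measurable_ge_norm; exact: measurable_birkhoff.
pose psi x : R := (t <= `|birkhoff_sum T f n x|)%R%:R.
have bpsi : bm psi by exact: bmeasurable_bool.
have h20 : 0 < t / 2 by rewrite divr_gt0.
have ts0 s : 0 < s -> 0 <= tail_size q hT r n s.
  by move=> s0; apply: le_trans (tail_size_ge q hT n r s0); rewrite mulr_ge0 ?powR_ge0.
have [nt|tn] := ltP n%:R t.
  rewrite (_ : (fun _ => _) = fun=> 0); first last.
    apply/funext => x; case: leP => //; rewrite leNgt => /negP nn.
    by exfalso; apply: nn; apply: le_lt_trans nt; exact: (norm_birkhoff_sum_le T _ _ fl.1).
  by rewrite expect_cst; apply: mulr_ge0 => //; exact: ts0.
have mM := measurable_max_birkhoff hT n (t / 2) mf.
have mH := measurable_height_ge hT (t / 2).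
have bH := bmeasurable_bool R mH.
have mMr : measurable [set x | max_ge T f n (t / 2) (ret x)].
  rewrite -[X in measurable X]setTI; exact: (measurable_ret hT measurableT mM).
have bMr := bmeasurable_bool R mMr.
suff main : expect mu psi <= expect mu (fun x => (t / 2 <= (height x)%:R)%R%:R) +
    D * E (fun x => (max_ge T f n (t / 2) x)%:R).
  apply: (le_trans main); rewrite -[leRHS]mulrA.
  apply: (@le_trans _ _ ((C1 + D * C0) * tail_size q hT r n (t / 2))); last first.
    apply: ler_wpM2l; first by rewrite addr_ge0// mulr_ge0.
    exact: tail_size_half.
  rewrite [leRHS]mulrDl; apply: lerD; last first.
    by rewrite -mulrA; apply: ler_wpM2l => //; exact: base_tail.
  apply: (le_trans (tall _ h20)); apply: ler_wpM2l => //.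
  apply: le_trans (tail_size_ge q hT n r h20).
  rewrite powR_1B// ler_wpM2r ?powR_ge0//; apply: le_trans tn; have := t0; lra.
rewrite -lee_fin EFinD !expectE//.
rewrite (kac hT bpsi.1)//.
rewrite [X in (_ <= X + _)%E](kac hT bH.1)//.
apply: le_trans; last by apply: leeD; [exact: lexx|exact: fut].
have mbir (g : X -> R) : bm g ->
    measurable_fun (base Delta) (fun x => (birkhoff_sum T g (height x) x)%:E).
  by move=> bg; apply: measurable_funTS; apply/measurable_EFinP; apply: measurable_height_sum; case: bg.
have mfut : measurable_fun (base Delta)
    (fun x => ((height x)%:R * (max_ge T f n (t / 2) (ret x))%:R)%:E : \bar R).
  apply: measurable_funTS; apply/measurable_EFinP.
  by apply: measurable_funM; [exact: measurable_height|case: bMr].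
rewrite -ge0_integralD//;
  [|by move=> x _; rewrite lee_fin; apply: sumr_ge0|exact: mbir].
apply: ge0_le_integral => //.
- by move=> x _; rewrite lee_fin; apply: sumr_ge0.
- exact: mbir.
- by apply: emeasurable_funD; [exact: mbir|exact: mfut].
move=> x /(baseE hT) lx; rewrite -EFinD lee_fin.
rewrite (_ : (height x)%:R * _ = \sum_(0 <= i < height x) (max_ge T f n (t / 2) (ret x))%:R); last first.
  by rewrite sumr_const_nat subn0 mulr_natl.
rewrite /birkhoff_sum -big_split/= !big_nat; apply: ler_sum => i /andP[_ ih].
have ix : (i < time_left hT x)%N by rewrite /time_left lx subn0.
have [ci li] := iter_up ix; have rx := ret_up ix.
rewrite /psi; have [tS|_] := leP t `|birkhoff_sum T f n (iter i T x)|; last exact: addr_ge0.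
rewrite {1}/column_height ci -/(height x).
have [hh|hh] := leP (t / 2) (height x)%:R; first by rewrite lerDl.
rewrite add0r; case: max_geP => // nM; exfalso; apply: nM.
set y := iter i T x in tS rx.
have ty : (time_left hT y <= height x)%N by rewrite time_left_up// /time_left lx subn0 leq_subr.
have tyR : (time_left hT y)%:R <= (height x)%:R :> R by rewrite ler_nat.
have [nle|lt] := leqP n (time_left hT y).
  have : n%:R <= (height x)%:R :> R by rewrite ler_nat (leq_trans nle).
  by have := t0; lra.
exists (n - time_left hT y)%N; first exact: leq_subr.
have := birkhoff_sum_add T f (time_left hT y) (n - time_left hT y) y.
rewrite subnKC ?(ltnW lt)// -/(ret y) rx => Sn.
have := norm_birkhoff_sum_le T (time_left hT y) y fl.1.
have := ler_normD (birkhoff_sum T f (time_left hT y) y)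
  (birkhoff_sum T f (n - time_left hT y) (ret x)).
by rewrite -Sn; lra.
Qed.

End TowerTailAll.

(** * Moments *)

Section Moments.
Context (R : realType) (d : measure_display) (X : measurableType d).
Context (mu : probability X R) (A : countType) (h : A -> nat).
Context (Delta : A -> nat -> set X) (T : X -> X) (rho q : R).
Hypothesis hT : young_tower mu h Delta T rho.
Hypothesis hq : 1 < q.
Hypothesis htail : (tail mu h Delta : nat -> R^o) =O_\oo
             (fun n : nat => n%:R `^ (- q) : R^o).

Local Notation S := (birkhoff_sum T).

Section Observable.
Variables (f : X -> R) (n : nat).
Hypothesis fl : tower_lipschitz h Delta T rho f.

Let mf : measurable_fun setT f := tower_lipschitz_measurable hT fl.

Let mSn : measurable_fun setT (fun x => `|S f n x|).
Proof.
have mS := measurable_birkhoff hT n mf.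
exact: measurableT_comp.
Qed.

Let Sn x : 0 <= `|S f n x| <= n%:R.
Proof. by rewrite normr_ge0; exact: (norm_birkhoff_sum_le T n x fl.1). Qed.

Lemma moment_expect (p : R) : 0 <= p ->
  (\int[mu]_x (`|S f n x| `^ p)%:E = (expect mu (fun x => `|S f n x| `^ p))%:E)%E.
Proof. by move=> p0; rewrite expectE//; exact: (bmeasurable_powR mSn p0 Sn). Qed.

Lemma measurable_norm_birkhoff : measurable_fun setT (fun x => `|S f n x|).
Proof. exact: mSn. Qed.

Lemma norm_birkhoff_itv x : 0 <= `|S f n x| <= n%:R.
Proof. exact: Sn. Qed.

Lemma measurable_deviation (t : R) : measurable [set x | (t <= `|S f n x|)%R].
Proof. exact: measurable_ge. Qed.

Lemma moment_large (t : R) : n%:R < t -> expect mu (fun x => (t <= `|S f n x|)%R%:R) = 0.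
Proof.
move=> nt; rewrite -[RHS](expect_cst mu); congr expect; apply/funext => x.
by have /andP[_ Sx] := Sn x; rewrite leNgt (le_lt_trans Sx nt).
Qed.

End Observable.

(** Take r = 1: for q < 2 the variance term n v(t) / t^2 is also of order n
    t^(-q). *)
Lemma deviation_bound : q < 2 -> exists2 C : R, 0 < C &
  forall f, tower_lipschitz h Delta T rho f -> (\int[mu]_x (f x)%:E = 0)%E ->
  forall n, (0 < n)%N -> forall t, 0 < t ->
    expect mu (fun x => (t <= `|S f n x|)%R%:R) <= C * t `^ (- q) * n%:R.
Proof.
move=> q2; have [C C0 tt] := tower_tail hT hq htail (ltn0Sn 0).
have [Cv Cv0 vs] := variance_size_le hT hq htail.
exists (1 + C * (1 + 2 * Cv)).
  by rewrite ltr_pwDl// mulr_ge0// addr_ge0// mulr_ge0.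
move=> f fl f0 n n0 t t0.
have tq := powR_ge0 t (- q).
have nR : 1 <= n%:R :> R by rewrite ler1n.
have ntq : 0 <= t `^ (- q) * n%:R by rewrite mulr_ge0.
rewrite -mulrA; have [t1|t1] := ltP t 1.
  apply: (le_trans (expect_bool_le1 mu (measurable_deviation n fl t))).
  apply: (le_trans (le1_powRN hq t0 (ltW t1))).
  apply: (@le_trans _ _ (t `^ (- q) * n%:R)); first by rewrite ler_peMr.
  by rewrite ler_peMl// lerDl mulr_ge0// addr_ge0// mulr_ge0.
apply: (le_trans (tt f fl f0 n n0 t t0)).
rewrite mulrDl mul1r -[leLHS]add0r; apply: lerD => //.
rewrite -[leRHS]mulrA; apply: ler_wpM2l => //.
rewrite /tail_size expr1 mulrDl mul1r mulrC; apply: lerD => //.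
have := vs t t1; rewrite /moment_size.
have -> : (2 < q) = false by apply/negbTE; rewrite -leNgt ltW.
have -> : (2 == q) = false by rewrite gt_eqF.
move=> le.
have t21 : 1 <= t `^ (2 - q).
  by rewrite -[leLHS](powRr0 t) ler_powR// subr_ge0 ltW.
have -> : t `^ (- q) = t `^ (2 - q) / t ^+ 2.
  rewrite -powR_mulrn ?(ltW t0)// -powRN -powRD; last by apply/implyP => _; rewrite gt_eqF.
  by congr (_ `^ _); lra.
rewrite -[leLHS]mulrA mulrC [leRHS]mulrA; apply: ler_wpM2r => //.
rewrite mulrA; apply: ler_wpM2r; first by rewrite invr_ge0 sqr_ge0.
apply: (le_trans le); rewrite mulrAC mulrC; apply: ler_wpM2r => //; lra.
Qed.

(** The deviation inequality is used above t = sqrt (n w), where w bounds the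
    variance, with 2 r > p so that the variance term is dominated by its value
    at this scale. *)
Lemma moment_from_tail p Cv : 1 <= p -> 0 <= Cv -> exists2 C : R, 0 <= C &
  forall f, tower_lipschitz h Delta T rho f -> (\int[mu]_x (f x)%:E = 0)%E ->
  forall n w, (0 < n)%N -> 1 <= w -> w <= n%:R ->
    (forall z, 1 <= z -> z <= n%:R -> variance_size hT z <= Cv * w) ->
  forall t, t = (n%:R * w) `^ 2^-1 ->
  expect mu (fun x => `|S f n x| `^ p) <=
    C * (t `^ p + n%:R * moment_size p q t n%:R).
Proof.
move=> p1 Cv0; have p0 : 0 < p := lt_le_trans ltr01 p1.
(* 2 r > p *)
pose r := (Num.truncn p).+1.
have pr : p < (2 * r)%:R.
  apply: (@lt_le_trans _ _ r%:R); last by rewrite ler_nat leq_pmull.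
  by rewrite -truncn_lt_nat// ltW.
have [Ct Ct0 tt] := tower_tail hT hq htail (ltn0Sn (Num.truncn p)).
have [C C0 tm] := truncated_moment mu q p0 pr.
exists (1 + C * Ct * (1 + Cv ^+ r)).
  by rewrite addr_ge0// mulr_ge0 ?mulr_ge0// addr_ge0// exprn_ge0.
move=> f fl f0 n w n0 w1 wn vw t tE.
have nR : 1 <= n%:R :> R by rewrite ler1n.
have nR0 : 0 < n%:R :> R by rewrite ltr0n.
have w0 : 0 < w := lt_le_trans ltr01 w1.
have nw : 0 < n%:R * w by rewrite mulr_gt0.
have t0 : 0 < t by rewrite tE powR_gt0.
have t2 : t `^ 2 = n%:R * w by rewrite tE -powRrM mulVf// powRr1// ltW.
have tn : t <= n%:R.
  have -> : n%:R = (n%:R `^ 2) `^ 2^-1 :> R.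
    by rewrite -powRrM divff// powRr1// ltW.
  rewrite tE; apply: ge0_ler_powR; rewrite ?nnegrE ?invr_ge0 ?powR_ge0 ?(ltW nw)//.
  by rewrite powR_mulrn ?(ltW nR0)// expr2 ler_wpM2l// ltW.
have t1 : 1 <= t.
  rewrite tE; have := @ge0_ler_powR R 2^-1 _ 1 (n%:R * w); rewrite powR1 !nnegrE invr_ge0; apply => //.
    exact: ltW.
  by rewrite -[leLHS]mulr1 ler_pM.
have ms0 : 0 <= moment_size p q t n%:R.
  rewrite /moment_size; case: ifP => _; first exact: powR_ge0.
  case: ifP => _; last exact: powR_ge0.
  by rewrite addr_ge0// ln_ge0// ler_pdivlMr// mul1r.
have c0 : 0 <= Ct * (Cv * (n%:R * w)) ^+ r.
  by rewrite mulr_ge0// exprn_ge0// mulr_ge0// ltW.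
have := tm (fun x => `|S f n x|) n%:R t (Ct * n%:R) (Ct * (Cv * (n%:R * w)) ^+ r)
  (measurable_norm_birkhoff n fl) (norm_birkhoff_itv n fl) t0 tn (mulr_ge0 Ct0 (ler0n _ n)) c0.
move=> le; apply: le_trans (le _) _.
  move=> z tz; have z0 : 0 < z := lt_le_trans t0 tz.
  have [nz|zn] := ltP n%:R z.
    by rewrite moment_large// addr_ge0// mulr_ge0 ?powR_ge0// mulr_ge0.
  apply: (le_trans (tt f fl f0 n n0 z z0)).
  rewrite /tail_size mulrDr -!mulrA lerD2l; apply: ler_wpM2l => //.
  rewrite powRN powR_mulrn ?(ltW z0)// exprM -[((z ^+ 2) ^+ r)^-1]exprVn -[leRHS]exprMn.
  have v0 : 0 <= variance_size hT z by apply: le_trans (variance_size_ge1 hT z).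
  rewrite lerXn2r ?nnegrE//.
  - by rewrite !mulr_ge0// invr_ge0 sqr_ge0.
  - by rewrite !mulr_ge0 ?invr_ge0 ?sqr_ge0// ltW.
  rewrite mulrA; apply: ler_wpM2r; first by rewrite invr_ge0 sqr_ge0.
  rewrite [leRHS]mulrCA ler_wpM2l//.
  exact: vw (le_trans t1 tz) zn.
have e : (Cv * (n%:R * w)) ^+ r * t `^ (p - (2 * r)%:R) = Cv ^+ r * t `^ p.
  rewrite exprMn -t2 powR_mulrn ?(ltW t0)// -exprM -mulrA -(powR_mulrn (2 * r) (ltW t0)).
  rewrite -powRD; last by apply/implyP => _; rewrite gt_eqF.
  by congr (_ * _ `^ _); ring.
rewrite -[X in _ + C * (_ + X)]mulrA e.
have tp := powR_ge0 t p; have nm : 0 <= n%:R * moment_size p q t n%:R by rewrite mulr_ge0.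
have CC : 0 <= C * Ct by rewrite mulr_ge0.
have Cr : 0 <= Cv ^+ r by rewrite exprn_ge0.
set x := t `^ p in tp *; set y := moment_size _ _ _ _ in nm *.
rewrite -subr_ge0 (_ : _ - _ = C * Ct * x + (1 + C * Ct * Cv ^+ r) * (n%:R * y)); last by ring.
by rewrite addr_ge0 ?mulr_ge0// addr_ge0// mulr_ge0.
Qed.

End Moments.

Section Exponents.
Context (R : realType) (p q : R).
Hypothesis p1 : 1 <= p.
Hypothesis q1 : 1 < q.

Let p0 : 0 < p := lt_le_trans ltr01 p1.
Let q0 : 0 < q := lt_trans ltr01 q1.

Lemma powR_mul_nat n (s : R) : (0 < n)%N -> n%:R * n%:R `^ s = n%:R `^ (s + 1).
Proof.
move=> n0; have nR : 0 < n%:R :> R by rewrite ltr0n.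
rewrite -[X in X * _]powRr1// -powRD; last by apply/implyP => _; rewrite gt_eqF.
by rewrite addrC.
Qed.

Lemma powR_ge1 (x s : R) : 1 <= x -> 0 <= s -> 1 <= x `^ s.
Proof. by move=> x1 s0; rewrite -[leLHS](powRr0 x) ler_powR. Qed.

Lemma ln_div_le (x t : R) : 1 <= t -> t <= x -> ln (x / t) <= ln x.
Proof.
move=> t1 tx; have t0 := lt_le_trans ltr01 t1; have x0 := lt_le_trans t0 tx.
rewrite ler_ln ?posrE ?divr_gt0// ler_pdivrMr// ler_peMr// ltW//.
Qed.

(** The logarithm that appears for p = q > 2 is absorbed in the gap between the
    powers n and n^(q/2). *)
Lemma ln_le_powR (x e : R) : 1 <= x -> 0 < e -> ln x <= x `^ e / e.
Proof.
move=> x1 e0; have x0 := lt_le_trans ltr01 x1.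
rewrite ler_pdivlMr// mulrC -ln_powR; apply: ltW; apply: ln_sublinear.
exact: powR_gt0.
Qed.

Lemma exponents_gt2 : 2 < q -> exists2 C : R, 0 <= C &
  forall n t, (0 < n)%N -> t = (n%:R * 1) `^ 2^-1 ->
    t `^ p + n%:R * moment_size p q t n%:R <= C * moment_bound p q n.
Proof.
move=> q2; have q02 : 0 <= (q - 2) / 2 by rewrite divr_ge0// subr_ge0 ltW.
pose ci := 1 + ((q - 2) / 2)^-1.
have ci0 : 1 <= ci by rewrite lerDl invr_ge0.
exists (1 + ci) => [|n t n0 tE]; first lra.
have nR : 1 <= n%:R :> R by rewrite ler1n.
have nR0 : 0 < n%:R :> R by rewrite ltr0n.
rewrite mulr1 in tE.
have t1 : 1 <= t by rewrite tE powR_ge1// invr_ge0.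
have tn : t <= n%:R.
  rewrite tE -[leRHS]powRr1 ?(ltW nR0)// ler_powR//; lra.
have tp s : t `^ s = n%:R `^ (s / 2) by rewrite tE -powRrM mulrC.
rewrite /moment_bound q2 tp; set B1 := n%:R `^ (p / 2).
set B2 := n%:R `^ (p - q + 1).
have B10 : 0 <= B1 := powR_ge0 _ _.
have mB : B1 <= Num.max B1 B2 by rewrite le_max lexx.
have mB2 : B2 <= Num.max B1 B2 by rewrite le_max lexx orbT.
suff : n%:R * moment_size p q t n%:R <= ci * Num.max B1 B2.
  by move=> le; rewrite mulrDl mul1r lerD.
have mB0 : 0 <= Num.max B1 B2 := le_trans B10 mB.
rewrite /moment_size; have [pq|qp|pq] := ltgtP p q.
- apply: (@le_trans _ _ B1).
    by rewrite tp powR_mul_nat// ler_powR//; lra.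
  by apply: (le_trans mB); rewrite ler_peMl.
- by rewrite powR_mul_nat//; apply: (le_trans mB2); rewrite ler_peMl.
- apply: (@le_trans _ _ (ci * B1)); last by rewrite ler_wpM2l// (le_trans _ ci0).
  have e0 : 0 < (q - 2) / 2 by rewrite divr_gt0// subr_gt0.
  have -> : B1 = n%:R * n%:R `^ ((q - 2) / 2).
    by rewrite powR_mul_nat// /B1 pq; congr (_ `^ _); lra.
  rewrite [leRHS]mulrCA; apply: ler_wpM2l; first exact: ltW.
  rewrite /ci mulrDl mul1r; apply: lerD; first exact: powR_ge1.
  apply: (le_trans (ln_div_le t1 tn)).
  by rewrite mulrC; exact: ln_le_powR.
Qed.

Lemma exponents_eq2 : q = 2 -> exists2 C : R, 0 <= C &
  forall n t, (0 < n)%N -> t = (n%:R * (1 + ln n%:R)) `^ 2^-1 -> 1 <= t -> t <= n%:R ->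
    t `^ p + n%:R * moment_size p q t n%:R <= C * moment_bound p q n.
Proof.
move=> q2; have l2 : 0 < ln 2 :> R by rewrite ln_gt0// ltr1n.
pose ka : R := 1 + (ln 2)^-1.
have ka1 : 1 <= ka by rewrite lerDl invr_ge0 ltW.
exists (2 * ka `^ (p / 2) + 3) => [|n t n0 tE t1 tn].
  by rewrite addr_ge0// mulr_ge0// powR_ge0.
have nR : 1 <= n%:R :> R by rewrite ler1n.
have nR0 : 0 < n%:R :> R by rewrite ltr0n.
have t0 : 0 < t := lt_le_trans ltr01 t1.
have ln0 : 0 <= ln n%:R :> R by rewrite ln_ge0.
rewrite /moment_bound q2 ltxx eqxx.
set B1 := (n%:R * ln n%:R) `^ (p / 2); set B2 := n%:R `^ (p - 2 + 1).
have B10 : 0 <= B1 := powR_ge0 _ _.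
have B20 : 0 <= B2 := powR_ge0 _ _.
have mB : B1 <= Num.max B1 B2 by rewrite le_max lexx.
have mB2 : B2 <= Num.max B1 B2 by rewrite le_max lexx orbT.
have t2 : t `^ 2 = n%:R * (1 + ln n%:R).
  by rewrite tE -powRrM mulVf// powRr1// mulr_ge0 ?addr_ge0.
have ms : n%:R * moment_size p 2 t n%:R <= t `^ p + B2.
  rewrite /moment_size; have [pq|qp|pq] := ltgtP p 2.
  - rewrite -[leLHS]addr0 lerD//.
    have -> : t `^ p = t `^ 2 * t `^ (p - 2).
      rewrite -powRD; last by apply/implyP => _; rewrite gt_eqF.
      by rewrite addrC subrK.
    by rewrite ler_wpM2r ?powR_ge0// t2 ler_peMr ?(ltW nR0)// lerDl.
  - by rewrite powR_mul_nat// lerDr powR_ge0.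
  - rewrite pq t2 -[leLHS]addr0 lerD//; apply: ler_wpM2l; first exact: ltW.
    by rewrite lerD2l; exact: ln_div_le.
have tp : t `^ p <= ka `^ (p / 2) * B1 + B2.
  have [n1|n2] := leqP n 1.
    have n1' : n = 1%N by apply/eqP; rewrite eqn_leq n1.
    have -> : t = 1 by rewrite tE n1' ln1 addr0 mulr1 powR1.
    by rewrite /B2 n1' !powR1 lerDr mulr_ge0// powR_ge0.
  have l2n : ln 2 <= ln n%:R :> R by rewrite ler_ln ?posrE// ler_nat.
  rewrite -[leLHS]addr0; apply: lerD => //.
  rewrite tE -powRrM [2^-1 * _]mulrC /B1 -powRM; last 2 first.
  - exact: le_trans ka1.
  - by rewrite mulr_ge0// ltW.
  apply: ge0_ler_powR.
  - by rewrite divr_ge0// ltW.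
  - by rewrite nnegrE mulr_ge0 ?addr_ge0.
  - by rewrite nnegrE mulr_ge0// ?(le_trans _ ka1)// mulr_ge0.
  rewrite mulrCA ler_wpM2l//.
  rewrite /ka mulrDl mul1r addrC lerD2l.
  by rewrite mulrC ler_pdivlMr// mul1r.
have kp : 0 <= ka `^ (p / 2) := powR_ge0 _ _.
apply: (@le_trans _ _ (2 * (ka `^ (p / 2) * B1 + B2) + B2)).
  by move: ms tp; lra.
by have := ler_wpM2l kp mB; move: mB2; lra.
Qed.

Lemma exponents_lt2 : q < 2 -> exists2 C : R, 0 <= C &
  forall n t, (0 < n)%N -> t = n%:R `^ q^-1 -> p != q ->
    t `^ p + n%:R * moment_size p q t n%:R <= C * moment_bound p q n.
Proof.
move=> q2; exists 2 => // n t n0 tE pq.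
have nR : 1 <= n%:R :> R by rewrite ler1n.
have nR0 : 0 < n%:R :> R by rewrite ltr0n.
have tp s : t `^ s = n%:R `^ (s / q) by rewrite tE -powRrM mulrC.
rewrite /moment_bound; have -> : (2 < q) = false by apply/negbTE; rewrite -leNgt ltW.
have -> : (q == 2) = false by rewrite lt_eqF.
rewrite tp; set B1 := n%:R `^ (p / q); set B2 := n%:R `^ (p - q + 1).
have mB : B1 <= Num.max B1 B2 by rewrite le_max lexx.
have mB2 : B2 <= Num.max B1 B2 by rewrite le_max lexx orbT.
suff : n%:R * moment_size p q t n%:R <= Num.max B1 B2 by move: mB; lra.
rewrite /moment_size; have [lt|lt|eq] := ltgtP p q.
- rewrite tp powR_mul_nat//; apply: le_trans mB; apply: le_of_eq.
  by congr (_ `^ _); field; rewrite gt_eqF.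
- by rewrite powR_mul_nat.
- by rewrite eq eqxx in pq.
Qed.

End Exponents.

Section FinalMoments.
Context (R : realType) (d : measure_display) (X : measurableType d).
Context (mu : probability X R) (A : countType) (h : A -> nat).
Context (Delta : A -> nat -> set X) (T : X -> X) (rho q : R).
Hypothesis hT : young_tower mu h Delta T rho.
Hypothesis hq : 1 < q.
Hypothesis htail : (tail mu h Delta : nat -> R^o) =O_\oo
             (fun n : nat => n%:R `^ (- q) : R^o).
Local Notation S := (birkhoff_sum T).

Lemma ln_le_subr1 (x : R) : 0 < x -> 1 + ln x <= x.
Proof.
by move=> x0; have := expR_ge1Dx (ln x); rewrite lnK ?posrE.
Qed.

Lemma moment_ge2 p : 1 <= p -> 2 <= q -> exists2 C : R, 0 <= C &
  forall f, tower_lipschitz h Delta T rho f -> (\int[mu]_x (f x)%:E = 0)%E ->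
  forall n, (0 < n)%N ->
    expect mu (fun x => `|S f n x| `^ p) <= C * moment_bound p q n.
Proof.
move=> p1 q2; have [Cv Cv0 vs] := variance_size_le hT hq htail.
have Cv2 : 0 <= 2 * Cv by rewrite mulr_ge0.
have [C C0 mt] := moment_from_tail hT hq htail p1 Cv2.
have [lt2|eq2] : 2 < q \/ q = 2.
  by move: q2; rewrite le_eqVlt => /orP[/eqP ->|]; [right|left].
- have [C' C'0 ex] := exponents_gt2 p lt2.
  exists (C * C') => [|f fl f0 n n0]; first exact: mulr_ge0.
  have n1 : 1 <= n%:R :> R by rewrite ler1n.
  rewrite -mulrA; apply: le_trans (ler_wpM2l C0 (ex n _ n0 erefl)).
  apply: (mt f fl f0 n 1 n0) => // z z1 _.
  apply: (le_trans (vs z z1)).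
  by rewrite /moment_size lt2 powR1; lra.
- have [C' C'0 ex] := exponents_eq2 p1 eq2.
  exists (C * C') => [|f fl f0 n n0]; first exact: mulr_ge0.
  have n1 : 1 <= n%:R :> R by rewrite ler1n.
  have nR0 : 0 < n%:R :> R by rewrite ltr0n.
  have l0 : 0 <= ln n%:R :> R by rewrite ln_ge0.
  have w1 : 1 <= 1 + ln n%:R :> R by rewrite lerDl.
  have wn : 1 + ln n%:R <= n%:R :> R by exact: ln_le_subr1.
  rewrite -mulrA; apply: le_trans (ler_wpM2l C0 (ex n _ n0 erefl _ _)).
  + apply: (mt f fl f0 n _ n0 w1 wn) => // z z1 zn.
    apply: (le_trans (vs z z1)); rewrite /moment_size eq2 ltxx eqxx divr1.
    have : ln z <= ln n%:R by rewrite ler_ln ?posrE// (lt_le_trans ltr01).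
    have := l0; move=> *; rewrite [2 * Cv]mulrC -mulrA ler_wpM2l//; lra.
  + by rewrite powR_ge1 ?invr_ge0// -[leLHS]mulr1 ler_pM.
  + rewrite [leRHS](_ : _ = (n%:R * n%:R) `^ 2^-1); last first.
      by rewrite -expr2 -powR_mulrn// -powRrM divff// powRr1.
    apply: ge0_ler_powR; rewrite ?nnegrE ?invr_ge0//.
    * by apply: mulr_ge0 => //; exact: addr_ge0.
    * by rewrite ler_wpM2l// ltW.
Qed.

(** Integrate the weak bound above n^(1/q), the scale at which it becomes
    trivial. *)
Lemma moment_lt2 p : 1 <= p -> q < 2 -> exists2 C : R, 0 <= C &
  forall f, tower_lipschitz h Delta T rho f -> (\int[mu]_x (f x)%:E = 0)%E ->
  forall n, (0 < n)%N -> forall t, t = n%:R `^ q^-1 ->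
    expect mu (fun x => `|S f n x| `^ p) <=
      C * (t `^ p + n%:R * moment_size p q t n%:R).
Proof.
move=> p1 q2; have [C C0 db] := deviation_bound hT hq htail q2.
have p0 : 0 < p := lt_le_trans ltr01 p1.
have q0 : 0 < q := lt_trans ltr01 hq.
have pS : p < p + 1 by rewrite ltrDl.
have [C' C'0 tm] := truncated_moment mu q p0 pS.
have CC : 0 <= C' * C by rewrite mulr_ge0// ltW.
exists (1 + C' * C) => [|f fl f0 n n0 t tE]; first exact: addr_ge0.
have n1 : 1 <= n%:R :> R by rewrite ler1n.
have nR0 : 0 < n%:R :> R by rewrite ltr0n.
have t1 : 1 <= t by rewrite tE powR_ge1// invr_ge0 ltW.
have t0 : 0 < t := lt_le_trans ltr01 t1.
have tn : t <= n%:R.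
  rewrite tE -[leRHS]powRr1 ?(ltW nR0)// ler_powR// invf_le1//.
  exact: ltW.
have le := tm (fun x => `|S f n x|) n%:R t (C * n%:R) 0
  (measurable_norm_birkhoff hT n fl) (norm_birkhoff_itv n fl) t0 tn
  (mulr_ge0 (ltW C0) (ler0n _ n)) (lexx 0).
apply: le_trans (le _) _.
  move=> z tz; rewrite mul0r addr0.
  by rewrite mulrAC; apply: db => //; exact: lt_le_trans tz.
rewrite mul0r addr0 -mulrA mulrA.
have ms : 0 <= n%:R * moment_size p q t n%:R.
  rewrite mulr_ge0// /moment_size; case: ifP => _; first exact: powR_ge0.
  case: ifP => _; last exact: powR_ge0.
  by rewrite addr_ge0// ln_ge0// ler_pdivlMr// mul1r.
have tp := powR_ge0 t p.
rewrite [leRHS]mulrDl mul1r [leLHS]addrC [leRHS]addrC mulrDr.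
by rewrite -subr_ge0 (_ : _ - _ = C' * C * t `^ p + n%:R * moment_size p q t n%:R);
  [rewrite addr_ge0// mulr_ge0|ring].
Qed.

End FinalMoments.

Theorem theorem1p4 (R : realType) (d : measure_display)
    (X : measurableType d) (mu : probability X R) (A : countType)
    (h : A -> nat) (Delta : A -> nat -> set X) (T : X -> X) (rho q : R)
    (hT : young_tower mu h Delta T rho) (hq : 1 < q)
    (htail : (tail mu h Delta : nat -> R^o) =O_\oo
             (fun n : nat => n%:R `^ (- q) : R^o)) :
  (forall p : R, 1 <= p -> (q < 2 -> p != q) ->
    exists2 C : R, 0 < C &
      forall f : X -> R, (lip_norm h Delta T rho f <= 1)%E ->
        (\int[mu]_x (f x)%:E = 0)%E ->
        forall n : nat, (1 <= n)%N ->
          (\int[mu]_x (`|birkhoff_sum T f n x| `^ p)%:E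
             <= (C * moment_bound p q n)%:E)%E) /\
  (q < 2 ->
    (exists2 C : R, 0 < C &
      forall f : X -> R, (lip_norm h Delta T rho f <= 1)%E ->
        (\int[mu]_x (f x)%:E = 0)%E ->
        forall n : nat, (1 <= n)%N -> forall t : R, 0 < t ->
          (mu [set x : X | (t <= `|birkhoff_sum T f n x|)%R]
             <= (C * t `^ (- q) * n%:R)%:E)%E) /\
    (exists2 C : R, 0 < C &
      forall f : X -> R, (lip_norm h Delta T rho f <= 1)%E ->
        (\int[mu]_x (f x)%:E = 0)%E ->
        forall n : nat, (2 <= n)%N ->
          (\int[mu]_x (`|birkhoff_sum T f n x| `^ q)%:E
             <= (C * (n%:R * ln n%:R))%:E)%E)).
Proof.
have q0 : 0 < q := lt_trans ltr01 hq.
split=> [p p1 pq|q2].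
  have p0 : 0 <= p := le_trans ler01 p1.
  have [C C0 H] : exists2 C : R, 0 <= C &
      forall f, tower_lipschitz h Delta T rho f -> (\int[mu]_x (f x)%:E = 0)%E ->
      forall n, (0 < n)%N ->
      expect mu (fun x => `|birkhoff_sum T f n x| `^ p) <= C * moment_bound p q n.
    have [q2|q2] := leP 2 q; first exact: (moment_ge2 hT hq htail p1 q2).
    have [C C0 H] := moment_lt2 hT hq htail p1 q2.
    have [C' C'0 ex] := exponents_lt2 p hq q2.
    exists (C * C') => [|f fl f0 n n0]; first exact: mulr_ge0.
    rewrite -mulrA; apply: (le_trans (H f fl f0 n n0 _ erefl)).
    by apply: ler_wpM2l => //; apply: ex => //; exact: pq.
  exists (C + 1) => [|f /(lip_norm_le1 hT) fl f0 n n0]; first by rewrite ltr_wpDl.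
  rewrite (moment_expect hT n fl p0) lee_fin; apply: (le_trans (H f fl f0 n n0)).
  rewrite ler_wpM2r ?lerDl// /moment_bound.
  by case: ifP => _; [|case: ifP => _]; rewrite le_max powR_ge0.
split.
  have [C C0 H] := deviation_bound hT hq htail q2.
  exists C => // f /(lip_norm_le1 hT) fl f0 n n0 t t0.
  by rewrite -expect_bool ?lee_fin; [exact: H|exact: (measurable_deviation hT n fl t)].
have [C C0 H] := moment_lt2 hT hq htail (ltW hq) q2.
have l2 : 0 < ln 2 :> R by rewrite ln_gt0// ltr1n.
have i2 : 0 < (ln 2 : R)^-1 by rewrite invr_gt0.
exists (C * (2 * (ln 2)^-1 + 1) + 1) => [|f /(lip_norm_le1 hT) fl f0 n n2].
  by rewrite ltr_wpDl// mulr_ge0// addr_ge0// mulr_ge0// ltW.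
have n0 : (0 < n)%N := ltnW n2.
have n1 : 1 <= n%:R :> R by rewrite ler1n.
have nR0 : 0 < n%:R :> R by rewrite ltr0n.
rewrite (moment_expect hT n fl (ltW q0)) lee_fin.
apply: (le_trans (H f fl f0 n n0 _ erefl)).
have t1 : 1 <= n%:R `^ q^-1 :> R by rewrite powR_ge1// invr_ge0 ltW.
have tn : n%:R `^ q^-1 <= n%:R :> R.
  rewrite -[leRHS]powRr1 ?(ltW nR0)// ler_powR// invf_le1//.
  exact: ltW.
have lnn : 1 <= (ln 2)^-1 * ln n%:R :> R.
  by rewrite mulrC ler_pdivlMr// mul1r ler_ln ?posrE// ler_nat.
rewrite -powRrM mulVf ?gt_eqF// powRr1 ?(ltW nR0)// /moment_size ltxx eqxx.
have ld := ln_div_le t1 tn.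
have ln0 : 0 <= ln n%:R :> R by rewrite ln_ge0.
apply: (@le_trans _ _ (C * (n%:R * ((2 * (ln 2)^-1 + 1) * ln n%:R)))).
  apply: ler_wpM2l => //; rewrite -[X in X + _]mulr1 -mulrDr ler_wpM2l ?(ltW nR0)//.
  by move: lnn ld; rewrite mulrDl mul1r -mulrA; lra.
rewrite -subr_ge0 (_ : _ - _ = n%:R * ln n%:R); last by ring.
by rewrite mulr_ge0.
Qed.
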